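(* Consider the $37$ tensors in $\mathbb{C}^5\otimes\mathbb{C}^5\otimes\mathbb{C}^5$ listed in the context (they represent all minimal border rank tensors for $m=5$ up to isomorphism and permutations of factors). For $T,T'$ among these tensors, $T$ degenerates to $T'$ up to permutations if and only if there is a directed path (possibly of length zero) from $T$ to $T'$ in the directed graph whose arrows are the following: $T_{5,1}\to T_{4,1}$; $T_{4,1}\to T_{3,3},T_{3,1}$; $T_{3,3}\to T_{2,1},T_{2,3}$; $T_{3,1}\to T_{2,1},T_{2,3},T_{3,2}$; $T_{2,1}\to T_{1,1},T_{2,2}$; $T_{2,3}\to T_{2,5},T_{1,1},T_{2,7}$; $T_{3,2}\to T_{2,2},T_{2,4}$; $T_{2,5}\to T_{2,4},T_{1,3}$; $T_{1,1}\to T_{1,3},T_{1,11},T_{\mathcal{O}_{58}}$; $T_{2,2}\to T_{1,2}$; $T_{2,4}\to T_{1,2},T_{1,4},T_{2,6},T_{2,8}$; $T_{1,3}\to T_{1,2},T_{1,4},T_{1,8},T_{1,19}$; $T_{2,7}\to T_{2,8},T_{1,19}$; $T_{1,11}\to T_{1,12}$; $T_{1,19}\to T_{1,18},T_{1,12},T_{\mathcal{O}_{57}}$; $T_{1,2}\to T_{1,5},T_{1,12},T_{1,18},T_{\mathcal{O}_{57}}$; $T_{1,4}\to T_{1,5},T_{1,18}$; $T_{2,8}\to T_{1,18}$; $T_{1,12}\to T_{1,13}$; $T_{1,18}\to T_{1,17},T_{1,13},T_{\widetilde{\mathcal{O}_{56}}}$; $T_{1,5}\to T_{1,7},T_{1,17}$;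 $T_{1,8}\to T_{1,7}$; $T_{1,13}\to T_{1,14}$; $T_{1,17}\to T_{1,16},T_{1,14},T_{\mathcal{O}_{55}}$; $T_{1,7}\to T_{1,6},T_{1,16}$; $T_{1,14}\to T_{1,15},T_{1,10}$; $T_{1,16}\to T_{1,15},T_{\mathcal{O}_{54}}$; $T_{2,6}\to T_{1,6}$; $T_{1,6}\to T_{1,15},T_{1,9}$; $T_{\mathcal{O}_{58}}\to T_{\mathcal{O}_{57}}$; $T_{\mathcal{O}_{57}}\to T_{\widetilde{\mathcal{O}_{56}}}$; $T_{\widetilde{\mathcal{O}_{56}}}\to T_{\mathcal{O}_{55}}$; $T_{\mathcal{O}_{55}}\to T_{\mathcal{O}_{54}}$. There are exactly $66$ minimal degenerations (covering relations of the partial order given by degeneration up to permutations), and they are precisely the $66$ arrows above.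
   Context: Let $A,B,C$ be copies of $\mathbb{C}^5$. A tensor $T\in A\otimes B\otimes C$ degenerates to $T'$ if $T'$ lies in the closure of the $\mathrm{GL}(A)\times\mathrm{GL}(B)\times\mathrm{GL}(C)$-orbit of $T$. It degenerates to $T'$ up to permutations if for some $\sigma\in\Sigma_3$ (acting by permuting the tensor factors, identified with $\mathbb{C}^5$) the tensor $\sigma\cdot T$ degenerates to $T'$. This is a partial order on isomorphism classes up to permutations. A minimal degeneration is a covering relation of this order: $T$ degenerates to $T'$ up to permutations, $T\ne T'$, and there is no third class strictly in between. A tensor has minimal border rank (for $m=5$) if it is concise (not contained in $V_1\otimes V_2\otimes V_3$ for linear subspaces $V_i$, not all equal to $\mathbb{C}^5$) and is a limit of tensors of rank at most $5$. Matrix notation: $E_{ij}$ is the $5\times5$ matrix unit with $1$ in row $i$, column $j$; $I$ is the identity matrix; $J=E_{11}+E_{22}+E_{33}+E_{44}$. A matrix $\sum\lambda_{kij}\,x_kE_{ij}$ of linear forms in $x_0,\dots,x_4$ denotes the tensor $\sum\lambda_{kij}\,a_{k+1}\otimes b_j\otimes c_i$, where $(a_i),(b_i),(c_i)$ are bases of the three factors. The $37$ tensors are: $T_{1,1}=x_0I+x_1(E_{21}+E_{32}+E_{43}+E_{54})+x_2(E_{31}+E_{42}+E_{53})+x_3(E_{41}+E_{52})+x_4E_{51}$; $T_{1,2}=x_0I+x_1E_{21}+x_2(E_{31}+E_{43}+E_{54})+x_3(E_{41}+E_{53})+x_4E_{51}$; $T_{1,3}=x_0I+x_1(E_{21}+E_{52})+x_2(E_{31}+E_{43}+E_{54})+x_3(E_{41}+E_{53})+x_4E_{51}$;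 $T_{1,4}=x_0I+x_1(E_{21}+E_{32})+x_2E_{31}+x_3(E_{41}+E_{54})+x_4E_{51}$; $T_{1,5}=x_0I+x_1(E_{21}+E_{53})+x_2(E_{31}+E_{43}+E_{52})+x_3E_{41}+x_4E_{51}$; $T_{1,6}=x_0I+x_1E_{21}+x_2E_{31}+x_3(E_{41}+E_{54})+x_4E_{51}$; $T_{1,7}=x_0I+x_1E_{21}+x_2(E_{31}+E_{54})+x_3(E_{41}+E_{53})+x_4E_{51}$; $T_{1,8}=x_0I+x_1(E_{21}+E_{53})+x_2(E_{31}+E_{52})+x_3(E_{41}+E_{54})+x_4E_{51}$; $T_{1,9}=x_0I+x_1E_{21}+x_2E_{31}+x_3E_{41}+x_4E_{51}$; $T_{1,10}=x_0I+x_1E_{42}+x_2E_{52}+x_3E_{43}+x_4E_{53}$; $T_{1,11}=x_0I+x_1E_{51}+x_2(E_{41}+E_{52})+x_3(E_{42}+E_{53})+x_4E_{43}$; $T_{1,12}=x_0I+x_1(E_{41}+E_{53})+x_2E_{51}+x_3E_{52}+x_4E_{43}$; $T_{1,13}=x_0I+x_1E_{41}+x_2E_{51}+x_3E_{52}+x_4E_{43}$; $T_{1,14}=x_0I+x_1E_{41}+x_2E_{51}+x_3E_{52}+x_4(E_{42}+E_{53})$; $T_{1,15}=x_0I+x_1E_{41}+x_2E_{51}+x_3E_{42}+x_4E_{43}$; $T_{1,16}=x_0I+x_1(E_{31}+E_{53})+x_2E_{51}+x_3E_{41}+x_4E_{52}$; $T_{1,17}=x_0I+x_1(E_{31}+E_{42}+E_{53})+x_2E_{51}+x_3E_{41}+x_4E_{52}$;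 $T_{1,18}=x_0I+x_1(E_{31}+E_{53})+x_2E_{51}+x_3E_{41}+x_4E_{42}$; $T_{1,19}=x_0I+x_1(E_{31}+E_{53})+x_2E_{51}+x_3(E_{41}+E_{52})+x_4E_{42}$; $T_{2,1}=x_0I+x_1(E_{21}+E_{32})+x_2E_{31}+x_3E_{54}+x_4(E_{44}+E_{55})$; $T_{2,2}=x_0I+x_1E_{21}+x_2E_{31}+x_3E_{54}+x_4(E_{44}+E_{55})$; $T_{2,3}=x_0I+x_1(E_{21}+E_{32}+E_{43})+x_2(E_{31}+E_{42})+x_3E_{41}+x_4E_{55}$; $T_{2,4}=x_0I+x_1E_{21}+x_2(E_{31}+E_{43})+x_3E_{41}+x_4E_{55}$; $T_{2,5}=x_0I+x_1(E_{21}+E_{43})+x_2(E_{31}+E_{42})+x_3E_{41}+x_4E_{55}$; $T_{2,6}=x_0I+x_1E_{21}+x_2E_{31}+x_3E_{41}+x_4E_{55}$; $T_{2,7}=x_0I+x_1(E_{31}-E_{42})+x_2E_{32}+x_3E_{41}+x_4E_{55}$; $T_{2,8}=x_0I+x_1E_{31}+x_2E_{32}+x_3E_{41}+x_4E_{55}$; $T_{3,1}=x_0I+x_1(E_{21}+E_{32})+x_2E_{31}+x_3E_{44}+x_4E_{55}$; $T_{3,2}=x_0I+x_1E_{21}+x_2E_{31}+x_3E_{44}+x_4E_{55}$; $T_{3,3}=x_0I+x_1E_{21}+x_2E_{43}+x_3(E_{33}+E_{44})+x_4E_{55}$; $T_{4,1}=x_0I+x_1E_{21}+x_2E_{33}+x_3E_{44}+x_4E_{55}$;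 $T_{5,1}=x_0I+x_1E_{22}+x_2E_{33}+x_3E_{44}+x_4E_{55}$; $T_{\mathcal{O}_{58}}=x_0J+x_1(E_{13}-E_{24})+x_2E_{14}+x_3E_{23}+x_4(E_{15}+E_{21}-E_{43}+E_{54})$; $T_{\mathcal{O}_{57}}=x_0J+x_1(E_{13}-E_{24})+x_2E_{14}+x_3E_{23}+x_4(E_{15}+E_{54})$; $T_{\widetilde{\mathcal{O}_{56}}}=x_0J+x_1E_{13}+x_2E_{14}+x_3E_{24}+x_4(E_{15}+E_{25}+E_{54})$; $T_{\mathcal{O}_{55}}=x_0J+x_1E_{13}+x_2E_{14}+x_3E_{24}+x_4(E_{15}+E_{23}+E_{54})$; $T_{\mathcal{O}_{54}}=x_0J+x_1E_{13}+x_2E_{14}+x_3E_{24}+x_4(E_{15}+E_{54})$. *)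

(* Defs.v *)
From HB Require Import structures.
From mathcomp Require Import all_boot all_order all_fingroup all_algebra.
From mathcomp Require Import complex.
From mathcomp Require Import all_classical all_reals all_analysis.

Set Implicit Arguments.
Unset Strict Implicit.
Unset Printing Implicit Defensive.

Import Order.TTheory GRing.Theory Num.Theory.
Import numFieldTopology.Exports ArrowAsUniformType.

Local Open Scope classical_set_scope.
Local Open Scope ring_scope.

(* The ascription to numClosedFieldType is what gives R[i] the topology of its
   absolute value. *)
Definition Cplx (R : realType) : numClosedFieldType := R[i].

(* T i j k is the coefficient of a_i (x) b_j (x) c_k, indices starting from 0.
   The topology is that of uniform convergence; as 'I_5 is finite, this is the
   usual topology of C^125. *)
Definition tensor (R : realType) : Type := 'I_5 -> 'I_5 -> 'I_5 -> Cplx R.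

HB.instance Definition _ (R : realType) :=
  PseudoMetric.copy (tensor R) ('I_5 -> 'I_5 -> 'I_5 -> Cplx R).

Section Degenerations.
Variable R : realType.
Local Notation C := (Cplx R).
Local Notation tensor := (tensor R).
Implicit Types (T : tensor) (K : set tensor).

Definition act (g1 g2 g3 : 'M[C]_5) T : tensor := fun i j k =>
  \sum_(i' < 5) \sum_(j' < 5) \sum_(k' < 5)
    g1 i i' * g2 j j' * g3 k k' * T i' j' k'.

Definition orbit T : set tensor :=
  [set S | exists g1 g2 g3 : 'M[C]_5,
    [/\ g1 \in unitmx, g2 \in unitmx, g3 \in unitmx & S = act g1 g2 g3 T]].

Definition permute (s : 'S_3) T : tensor := fun i j k =>
  let idx := tnth [tuple i; j; k] in T (idx (s 0)) (idx (s 1)) (idx (s 2)).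

Definition degenerates T T' : Prop := closure (orbit T) T'.

Definition degenerates_perm T T' : Prop :=
  exists s : 'S_3, degenerates (permute s T) T'.

Definition isomorphic_perm T T' : Prop :=
  exists s : 'S_3, orbit (permute s T) T'.

(* Covering relation of the order induced by degenerates_perm on the
   isomorphism classes up to permutations of the tensors in K. *)
Definition minimal_degeneration K T T' : Prop :=
  [/\ degenerates_perm T T', ~ isomorphic_perm T T' &
      ~ exists S, [/\ K S, degenerates_perm T S, degenerates_perm S T',
                      ~ isomorphic_perm T S & ~ isomorphic_perm S T']].

Definition sum_of_simple (n : nat) (a b c : 'I_n -> 'rV[C]_5) : tensor :=
  fun i j k => \sum_(s < n) a s 0 i * b s 0 j * c s 0 k.

Definition in_tensor_product (V1 V2 V3 : {vspace 'rV[C]_5}) T : Prop :=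
  exists (n : nat) (a b c : 'I_n -> 'rV[C]_5),
    (forall s, [/\ a s \in V1, b s \in V2 & c s \in V3]) /\
    T = sum_of_simple a b c.

Definition concise T : Prop :=
  forall V1 V2 V3 : {vspace 'rV[C]_5}, in_tensor_product V1 V2 V3 T ->
    [/\ V1 = fullv, V2 = fullv & V3 = fullv].

(* Zero summands are allowed, so r summands means rank at most r. *)
Definition rank_le (r : nat) : set tensor :=
  [set T | exists a b c : 'I_r -> 'rV[C]_5, T = sum_of_simple a b c].

Definition minimal_border_rank T : Prop :=
  concise T /\ closure (rank_le 5) T.

End Degenerations.

Inductive label := | T1_1 | T1_2 | T1_3 | T1_4 | T1_5 | T1_6 | T1_7 | T1_8
    | T1_9 | T1_10 | T1_11 | T1_12 | T1_13 | T1_14 | T1_15 | T1_16 | T1_17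
    | T1_18 | T1_19 | T2_1 | T2_2 | T2_3 | T2_4 | T2_5 | T2_6 | T2_7 | T2_8
    | T3_1 | T3_2 | T3_3 | T4_1 | T5_1 | TO58 | TO57 | TO56 | TO55 | TO54.

Definition labels : seq label :=
  [:: T1_1; T1_2; T1_3; T1_4; T1_5; T1_6;
    T1_7; T1_8; T1_9; T1_10; T1_11; T1_12; T1_13; T1_14; T1_15; T1_16; T1_17;
    T1_18; T1_19; T2_1; T2_2; T2_3; T2_4; T2_5; T2_6; T2_7; T2_8; T3_1; T3_2;
    T3_3; T4_1; T5_1; TO58; TO57; TO56; TO55; TO54].

Definition label_index (u : label) : nat :=
  match u with
  | T1_1 => 0 | T1_2 => 1 | T1_3 => 2 | T1_4 => 3 | T1_5 => 4 | T1_6 => 5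
  | T1_7 => 6 | T1_8 => 7 | T1_9 => 8 | T1_10 => 9 | T1_11 => 10 | T1_12 => 11
  | T1_13 => 12 | T1_14 => 13 | T1_15 => 14 | T1_16 => 15 | T1_17 => 16
  | T1_18 => 17 | T1_19 => 18 | T2_1 => 19 | T2_2 => 20 | T2_3 => 21
  | T2_4 => 22 | T2_5 => 23 | T2_6 => 24 | T2_7 => 25 | T2_8 => 26
  | T3_1 => 27 | T3_2 => 28 | T3_3 => 29 | T4_1 => 30 | T5_1 => 31
  | TO58 => 32 | TO57 => 33 | TO56 => 34 | TO55 => 35 | TO54 => 36
  end.

Lemma label_indexK : pcancel label_index (onth labels).
Proof. by case. Qed.

HB.instance Definition _ := Countable.copy label (pcan_type label_indexK).

Lemma labels_enumP : Finite.axiom labels.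
Proof. by case. Qed.

HB.instance Definition _ := fintype.isFinite.Build label labels_enumP.

Definition successors (u : label) : seq label :=
  match u with
  | T1_1 => [:: T1_3; T1_11; TO58]
  | T1_2 => [:: T1_5; T1_12; T1_18; TO57]
  | T1_3 => [:: T1_2; T1_4; T1_8; T1_19]
  | T1_4 => [:: T1_5; T1_18]
  | T1_5 => [:: T1_7; T1_17]
  | T1_6 => [:: T1_15; T1_9]
  | T1_7 => [:: T1_6; T1_16]
  | T1_8 => [:: T1_7]
  | T1_9 => [::]
  | T1_10 => [::]
  | T1_11 => [:: T1_12]
  | T1_12 => [:: T1_13]
  | T1_13 => [:: T1_14]
  | T1_14 => [:: T1_15; T1_10]
  | T1_15 => [::]
  | T1_16 => [:: T1_15; TO54]
  | T1_17 => [:: T1_16; T1_14; TO55]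
  | T1_18 => [:: T1_17; T1_13; TO56]
  | T1_19 => [:: T1_18; T1_12; TO57]
  | T2_1 => [:: T1_1; T2_2]
  | T2_2 => [:: T1_2]
  | T2_3 => [:: T2_5; T1_1; T2_7]
  | T2_4 => [:: T1_2; T1_4; T2_6; T2_8]
  | T2_5 => [:: T2_4; T1_3]
  | T2_6 => [:: T1_6]
  | T2_7 => [:: T2_8; T1_19]
  | T2_8 => [:: T1_18]
  | T3_1 => [:: T2_1; T2_3; T3_2]
  | T3_2 => [:: T2_2; T2_4]
  | T3_3 => [:: T2_1; T2_3]
  | T4_1 => [:: T3_3; T3_1]
  | T5_1 => [:: T4_1]
  | TO58 => [:: TO57]
  | TO57 => [:: TO56]
  | TO56 => [:: TO55]
  | TO55 => [:: TO54]
  | TO54 => [::]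
  end.

Definition arrow : rel label := grel successors.

Section Tensors.
Variable R : realType.

(* Rows and columns of E and J are numbered from 1. *)
Definition E (i j : nat) : 'M[Cplx R]_5 :=
  \matrix_(r, c) ((r.+1 == i) && (c.+1 == j))%:R.

Definition J : 'M[Cplx R]_5 := E 1 1 + E 2 2 + E 3 3 + E 4 4.

(* M_k is the coefficient of x_k: the entry (i, j) of the matrix sum_k x_k M_k
   of linear forms stands for a_k (x) b_j (x) c_i. *)
Definition tensor_of (M0 M1 M2 M3 M4 : 'M[Cplx R]_5) : tensor R :=
  fun k j i => tnth [tuple M0; M1; M2; M3; M4] k i j.

(* TO54, ..., TO58 stand for the tensors indexed by the orbits O_54, ..., O_58;
   for TO56 the orbit carries a tilde. *)
Definition tensor_of_label (u : label) : tensor R :=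
  match u with
  | T1_1 => tensor_of 1%:M (E 2 1 + E 3 2 + E 4 3 + E 5 4)
      (E 3 1 + E 4 2 + E 5 3) (E 4 1 + E 5 2) (E 5 1)
  | T1_2 => tensor_of 1%:M (E 2 1)
      (E 3 1 + E 4 3 + E 5 4) (E 4 1 + E 5 3) (E 5 1)
  | T1_3 => tensor_of 1%:M (E 2 1 + E 5 2)
      (E 3 1 + E 4 3 + E 5 4) (E 4 1 + E 5 3) (E 5 1)
  | T1_4 => tensor_of 1%:M (E 2 1 + E 3 2) (E 3 1) (E 4 1 + E 5 4) (E 5 1)
  | T1_5 => tensor_of 1%:M (E 2 1 + E 5 3)
      (E 3 1 + E 4 3 + E 5 2) (E 4 1) (E 5 1)
  | T1_6 => tensor_of 1%:M (E 2 1) (E 3 1) (E 4 1 + E 5 4) (E 5 1)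
  | T1_7 => tensor_of 1%:M (E 2 1) (E 3 1 + E 5 4) (E 4 1 + E 5 3) (E 5 1)
  | T1_8 => tensor_of 1%:M (E 2 1 + E 5 3)
      (E 3 1 + E 5 2) (E 4 1 + E 5 4) (E 5 1)
  | T1_9 => tensor_of 1%:M (E 2 1) (E 3 1) (E 4 1) (E 5 1)
  | T1_10 => tensor_of 1%:M (E 4 2) (E 5 2) (E 4 3) (E 5 3)
  | T1_11 => tensor_of 1%:M (E 5 1) (E 4 1 + E 5 2) (E 4 2 + E 5 3) (E 4 3)
  | T1_12 => tensor_of 1%:M (E 4 1 + E 5 3) (E 5 1) (E 5 2) (E 4 3)
  | T1_13 => tensor_of 1%:M (E 4 1) (E 5 1) (E 5 2) (E 4 3)
  | T1_14 => tensor_of 1%:M (E 4 1) (E 5 1) (E 5 2) (E 4 2 + E 5 3)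
  | T1_15 => tensor_of 1%:M (E 4 1) (E 5 1) (E 4 2) (E 4 3)
  | T1_16 => tensor_of 1%:M (E 3 1 + E 5 3) (E 5 1) (E 4 1) (E 5 2)
  | T1_17 => tensor_of 1%:M (E 3 1 + E 4 2 + E 5 3) (E 5 1) (E 4 1) (E 5 2)
  | T1_18 => tensor_of 1%:M (E 3 1 + E 5 3) (E 5 1) (E 4 1) (E 4 2)
  | T1_19 => tensor_of 1%:M (E 3 1 + E 5 3) (E 5 1) (E 4 1 + E 5 2) (E 4 2)
  | T2_1 => tensor_of 1%:M (E 2 1 + E 3 2) (E 3 1) (E 5 4) (E 4 4 + E 5 5)
  | T2_2 => tensor_of 1%:M (E 2 1) (E 3 1) (E 5 4) (E 4 4 + E 5 5)
  | T2_3 => tensor_of 1%:M (E 2 1 + E 3 2 + E 4 3)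
      (E 3 1 + E 4 2) (E 4 1) (E 5 5)
  | T2_4 => tensor_of 1%:M (E 2 1) (E 3 1 + E 4 3) (E 4 1) (E 5 5)
  | T2_5 => tensor_of 1%:M (E 2 1 + E 4 3) (E 3 1 + E 4 2) (E 4 1) (E 5 5)
  | T2_6 => tensor_of 1%:M (E 2 1) (E 3 1) (E 4 1) (E 5 5)
  | T2_7 => tensor_of 1%:M (E 3 1 - E 4 2) (E 3 2) (E 4 1) (E 5 5)
  | T2_8 => tensor_of 1%:M (E 3 1) (E 3 2) (E 4 1) (E 5 5)
  | T3_1 => tensor_of 1%:M (E 2 1 + E 3 2) (E 3 1) (E 4 4) (E 5 5)
  | T3_2 => tensor_of 1%:M (E 2 1) (E 3 1) (E 4 4) (E 5 5)
  | T3_3 => tensor_of 1%:M (E 2 1) (E 4 3) (E 3 3 + E 4 4) (E 5 5)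
  | T4_1 => tensor_of 1%:M (E 2 1) (E 3 3) (E 4 4) (E 5 5)
  | T5_1 => tensor_of 1%:M (E 2 2) (E 3 3) (E 4 4) (E 5 5)
  | TO58 => tensor_of J (E 1 3 - E 2 4)
      (E 1 4) (E 2 3) (E 1 5 + E 2 1 - E 4 3 + E 5 4)
  | TO57 => tensor_of J (E 1 3 - E 2 4) (E 1 4) (E 2 3) (E 1 5 + E 5 4)
  | TO56 => tensor_of J (E 1 3) (E 1 4) (E 2 4) (E 1 5 + E 2 5 + E 5 4)
  | TO55 => tensor_of J (E 1 3) (E 1 4) (E 2 4) (E 1 5 + E 2 3 + E 5 4)
  | TO54 => tensor_of J (E 1 3) (E 1 4) (E 2 4) (E 1 5 + E 5 4)
  end.

Definition listed : set (tensor R) :=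
  [set T | exists u : label, isomorphic_perm (tensor_of_label u) T].

End Tensors.

(* Main.v *)
(* Each arrow is certified by integer base changes after which a one-parameter
   subgroup of the torus degenerates the permuted source to the target.

   Conversely, by transitivity it is enough to exclude 34 pairs (maximal source,
   minimal target), for all six permutations. Most are excluded by the
   semicontinuity of the rank of linear systems attached equivariantly to a tensor
   (systems in 125 unknowns, whose ranks are computed by elimination over Z).
   For others, the determinant of a slice of the source, or the entries of the
   adjugate of a slice, are products of linear forms with prescribed
   multiplicities; as linear forms up to scaling form a compact space, this
   persists in the closure of the orbit, and the root multiplicities of the same
   polynomial of the target on a line contradict it. For T1_5 and T1_13 two
   permutations remain, where compactness is used in the same way: the source
   admits a nonzero linear map B^* -> A^* satisfying polynomial equations that force
   such a map to vanish for the target.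

   Covering relations are then read off the graph, since a tensor between two
   listed ones is concise and a limit of degenerations of the unit tensor T5_1. *)
Require Import Defs.
From Stdlib Require Import ZArith.
From HB Require Import structures.
From mathcomp Require Import all_boot all_order all_fingroup all_algebra.
From mathcomp Require Import complex zify ring lra ssrZ.
From mathcomp Require Import all_classical all_reals all_analysis.
Set Implicit Arguments.
Unset Strict Implicit.
Unset Printing Implicit Defensive.
Import Order.TTheory GRing.Theory Num.Theory.
Import numFieldTopology.Exports numFieldNormedType.Exports ArrowAsUniformType.
Local Open Scope classical_set_scope.
Local Open Scope ring_scope.

(* The entries of the 37 tensors are 0, 1 and -1, so that every rank and determinant is computed
   over Z and carried to C by [zK], whatever the real field [R]. Invariance under the group does not
   suffice for an obstruction: the condition must also pass to limits. For ranks this is the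
   vanishing of minors. For the existence of linear factors, or of a linear map, the witnesses might
   escape to infinity along a sequence; the equations on them are homogeneous, which allows
   normalising the witnesses into a compact set. The three factors play unequal roles in each
   invariant, hence the separate treatment of the six permutations. As degeneration commutes with
   permuting both tensors, each of the six cases may be attacked after any further common
   permutation, and one success is enough. No argument on orbit dimensions is made: that the order
   is antisymmetric on the listed tensors, and that they are pairwise non-isomorphic, is read off
   the graph once degeneration is known to coincide with reachability. *)
Delimit Scope Z_scope with BZ.

(** * Continuity and closures *)

Section Cont.
Variable (K : numFieldType) (X : topologicalType).

Lemma continuous_sum (I : Type) (r : seq I) (P : pred I) (f : I -> X -> K) :
  (forall i, continuous (f i)) -> continuous (fun x => \sum_(i <- r | P i) f i x).
Proof.
move=> fc; elim: r => [|i r IH].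
  have -> : (fun x => \sum_(i <- [::] | P i) f i x) = fun=> 0.
    by apply/funext => x; rewrite big_nil.
  exact: cst_continuous.
have -> : (fun x => \sum_(i <- i :: r | P i) f i x) =
    fun x => if P i then f i x + \sum_(i <- r | P i) f i x
             else \sum_(i <- r | P i) f i x.
  by apply/funext => x; rewrite big_cons.
by case: (P i) => // x; apply: cvgD; [exact: fc | exact: IH].
Qed.

Lemma continuous_prod (I : Type) (r : seq I) (P : pred I) (f : I -> X -> K) :
  (forall i, continuous (f i)) -> continuous (fun x => \prod_(i <- r | P i) f i x).
Proof.
move=> fc; elim: r => [|i r IH].
  have -> : (fun x => \prod_(i <- [::] | P i) f i x) = fun=> 1.
    by apply/funext => x; rewrite big_nil.
  exact: cst_continuous.
have -> : (fun x => \prod_(i <- i :: r | P i) f i x) =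
    fun x => if P i then f i x * \prod_(i <- r | P i) f i x
             else \prod_(i <- r | P i) f i x.
  by apply/funext => x; rewrite big_cons.
by case: (P i) => // x; apply: cvgM; [exact: fc | exact: IH].
Qed.

Lemma continuous_add (f g : X -> K) :
  continuous f -> continuous g -> continuous (fun x => f x + g x).
Proof. by move=> fc gc x; apply: cvgD; [exact: fc | exact: gc]. Qed.

Lemma continuous_opp (f : X -> K) : continuous f -> continuous (fun x => - f x).
Proof. by move=> fc x; apply: cvgN; exact: fc. Qed.

Lemma continuous_mul (f g : X -> K) :
  continuous f -> continuous g -> continuous (fun x => f x * g x).
Proof. by move=> fc gc x; apply: cvgM; [exact: fc | exact: gc]. Qed.

Lemma continuous_det (n : nat) (M : X -> 'M[K]_n) :
  (forall i j, continuous (fun x => M x i j)) -> continuous (fun x => \det (M x)).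
Proof.
move=> Mc; apply: continuous_sum => s; apply: continuous_mul.
  exact: cst_continuous.
by apply: continuous_prod => i; exact: Mc.
Qed.

Lemma closure_eq0 (A : set X) (f : X -> K) x :
  continuous f -> (forall y, A y -> f y = 0) -> closure A x -> f x = 0.
Proof.
move=> fc f0 clx.
have cl0 : closed (f @^-1` [set 0]).
  apply: closed_comp => [y _|]; first exact: fc.
  by apply: accessible_closed_set1; exact/hausdorff_accessible/(@norm_hausdorff _ K^o).
have := closureS (f0 : A `<=` f @^-1` [set 0]) clx.
by rewrite -((closure_id _).1 cl0).
Qed.

Lemma closure_sub_closure (A B : set X) : B `<=` closure A -> closure B `<=` closure A.
Proof.
by move=> BA; rewrite [X in _ `<=` X](closure_id _).1; [exact: closureS | exact: closed_closure].
Qed.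

Lemma near_ball (f : X -> K) x (e : K) : continuous f -> 0 < e ->
  \forall y \near x, ball (f x) e (f y).
Proof. by move=> fc e0; apply: (fc x); exact: nbhsx_ballx. Qed.

(* Rank conditions are the vanishing of all the minors of [L *m M x *m N]. *)
Lemma closure_rank_le (A : set X) m n (M : X -> 'M[K]_(m, n)) r x :
    (forall i j, continuous (fun y => M y i j)) ->
    (forall y, A y -> (\rank (M y) <= r)%N) -> closure A x ->
  (\rank (M x) <= r)%N.
Proof.
move=> Mc rA clx; rewrite leqNgt; apply/negP => rx.
pose B := M x.
pose L : 'M[K]_(r.+1, m) := pid_mx r.+1 *m invmx (col_ebase B).
pose N : 'M[K]_(n, r.+1) := invmx (row_ebase B) *m pid_mx r.+1.
(* The bases of the Gaussian elimination cancel and leave [pid_mx (\rank B)], whose leading block of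
   size r+1 is the identity as soon as the rank exceeds r. *)
have LBN : L *m B *m N = 1%:M.
  rewrite /L /N -{2}(mulmx_ebase B) !mulmxA mulmxKV ?col_ebase_unit//.
  rewrite -[_ *m row_ebase B *m _]mulmxA mulmxV ?row_ebase_unit// mulmx1.
  rewrite !mul_pid_mx.
  have -> : minn n (minn (minn m (minn r.+1 (\rank B))) r.+1) = r.+1.
    by have := rank_leq_row B; have := rank_leq_col B; rewrite -/B in rx *; lia.
  exact: pid_mx_1.
have : \det (L *m M x *m N) = 0.
  apply: (@closure_eq0 A (fun y => \det (L *m M y *m N))) clx.
    apply: continuous_det => i j.
    have -> : (fun y => (L *m M y *m N) i j) =
        fun y => \sum_k (\sum_l L i l * M y l k) * N k j.
      by apply/funext => y; rewrite mxE; apply: eq_bigr => k _; rewrite mxE.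
    apply: continuous_sum => k; apply: continuous_mul; last exact: cst_continuous.
    apply: continuous_sum => l; apply: continuous_mul; last exact: Mc.
    exact: cst_continuous.
  move=> y /rA ry; apply/eqP; rewrite -[_ == _]negbK -unitfE -unitmxE -row_full_unit.
  apply/negP => /eqP fu; have : (r.+1 <= r)%N; last by rewrite ltnn.
  rewrite -{1}fu; apply: leq_trans ry.
  by apply: leq_trans (mxrankM_maxl _ _) _; exact: mxrankM_maxr.
by rewrite LBN det1 => /eqP; rewrite oner_eq0.
Qed.
End Cont.

Section ContTensor.
Variable R : realType.
Lemma entry_continuous (i j k : 'I_5) : continuous (fun T : tensor R => T i j k).
Proof.
move=> T U /nbhs_ballP[e /= e0 eU]; apply/nbhs_ballP.
by exists e => // S TS; apply: eU; exact: TS.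
Qed.
End ContTensor.

(** * Ranks of integer matrices *)

Section ZtoK.
Variable K : numFieldType.
Definition zK (z : Z) : K := (int_of_Z z)%:~R.
Lemma zK0 : zK 0 = 0. Proof. by []. Qed.
Lemma zK1 : zK 1 = 1. Proof. by []. Qed.
Lemma zKD x y : zK (x + y)%BZ = zK x + zK y.
Proof. by rewrite /zK -rmorphD /=; congr (_%:~R); lia. Qed.
Lemma zKM x y : zK (x * y)%BZ = zK x * zK y.
Proof. by rewrite /zK -rmorphM /=; congr (_%:~R); lia. Qed.
Lemma zKN x : zK (- x)%BZ = - zK x.
Proof. by rewrite /zK -rmorphN /=; congr (_%:~R); lia. Qed.
Lemma zKB x y : zK (x - y)%BZ = zK x - zK y.
Proof. by rewrite zKD zKN. Qed.
Lemma zK_eq0 x : (zK x == 0) = Z.eqb x 0.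
Proof. by rewrite /zK intr_eq0; apply/eqP/Z.eqb_spec; lia. Qed.
End ZtoK.

(** Fraction-free elimination of the first unknown, so that all entries stay integers. A row whose
    head is already zero is not multiplied by the pivot, which limits the growth of the
    coefficients. *)
Definition reduce (p : Z) (pr r : seq Z) : seq Z :=
  let h := head 0%BZ r in
  if Z.eqb h 0 then behead r
  else [seq (p * u.1 - h * u.2)%BZ | u <- zip (behead r) pr].

Fixpoint pivot (rows : seq (seq Z)) : option (seq Z * seq (seq Z)) :=
  if rows isn't r :: rows' then None
  else if Z.eqb (head 0%BZ r) 0 then
    (if pivot rows' is Some (p, l) then Some (p, r :: l) else None)
  else Some (r, rows').

Fixpoint rk (n : nat) (rows : seq (seq Z)) : nat :=
  if n isn't n'.+1 then 0 else
  if pivot rows is Some (p, l) then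
    (rk n' [seq reduce (head 0%BZ p) (behead p) r | r <- l]).+1
  else rk n' [seq behead r | r <- rows].

Section RkP.
Variable K : numFieldType.
Local Notation zK := (zK K).

Definition dotr n (r : seq Z) (x : 'rV[K]_n) : K :=
  \sum_(i < n) zK (nth 0%BZ r i) * x 0 i.

Lemma dotrS n r (x0 : K) (x : 'rV[K]_n) :
  dotr r (row_mx (x0%:M : 'rV[K]_1) x) = zK (head 0%BZ r) * x0 + dotr (behead r) x.
Proof.
rewrite /dotr (@big_split_ord _ _ _ 1 n) /= big_ord1 row_mxEl mxE eqxx mulr1n /= nth0.
by congr (_ + _); apply: eq_bigr => i _; rewrite row_mxEr nth_behead.
Qed.

(** Modulo the pivot equation, the reduced equation is the original one multiplied by [zK p], which
    is nonzero. *)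
Lemma dotr_reduce n p pr r (x0 : K) (x : 'rV[K]_n) :
    size pr = n -> size r = n.+1 -> p != 0%BZ ->
    zK p * x0 + dotr pr x = 0 ->
  (dotr (reduce p pr r) x == 0) = (zK (head 0%BZ r) * x0 + dotr (behead r) x == 0).
Proof.
move=> spr sr p0 px; rewrite /reduce; case: ifPn => [/Z.eqb_spec ->|h0].
  by rewrite zK0 mul0r add0r.
have pK : zK p != 0 by rewrite zK_eq0; apply/negP => /Z.eqb_spec; exact/eqP.
have -> : dotr [seq (p * u.1 - head 0%BZ r * u.2)%BZ | u <- zip (behead r) pr] x =
    zK p * dotr (behead r) x - zK (head 0%BZ r) * dotr pr x.
  rewrite /dotr !mulr_sumr -sumrB; apply: eq_bigr => i _.
  have sz : size (behead r) = size pr by rewrite size_behead sr spr.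
  rewrite (nth_map (0%BZ, 0%BZ)) ?size_zip ?sz ?minnn ?spr//.
  by rewrite nth_zip//= zKB !zKM; ring.
have -> : dotr pr x = - (zK p * x0) by apply/eqP; rewrite -addr_eq0 addrC px.
transitivity (zK p * (zK (head 0%BZ r) * x0 + dotr (behead r) x) == 0).
  by congr (_ == 0); ring.
by rewrite mulf_eq0 (negPf pK).
Qed.

Lemma pivot_none rows : pivot rows = None -> all (fun r => Z.eqb (head 0%BZ r) 0) rows.
Proof.
by elim: rows => //= r rows IH; case: ifP => //= _; case: (pivot rows) IH => [[]|] // ->.
Qed.

Lemma pivot_some rows p l : pivot rows = Some (p, l) ->
  [/\ head 0%BZ p != 0%BZ, forall r, r \in rows = (r == p) || (r \in l) &
      size rows = (size l).+1].
Proof.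
elim: rows p l => //= r rows IH p l; case: ifPn => [r0|r0].
  case: (pivot rows) IH => [[p' l']|]// /(_ _ _ erefl)[p0 rE szE] [<- <-]; split => //=.
    by move=> x; rewrite !inE rE; do !case: (_ == _); rewrite ?orbT.
  by rewrite szE.
by case=> <- <-.
Qed.

Lemma row_free_row_mx d m n (A : 'M[K]_(d, m)) (B : 'M[K]_(d, n)) :
  row_free B -> row_free (row_mx A B).
Proof.
move=> /row_freeP[D BD]; apply/row_freeP; exists (col_mx 0 D).
by rewrite mul_row_col mulmx0 add0r.
Qed.

Lemma row_free_diag1 d m n (B : 'M[K]_(d, n)) :
  row_free B -> row_free (block_mx (1%:M : 'M[K]_m) 0 0 B).
Proof.
move=> /row_freeP[D BD]; apply/row_freeP; exists (block_mx 1%:M 0 0 D).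
by rewrite mulmx_block !mulmx0 !mul0mx mulmx1 BD addr0 !add0r -scalar_mx_block.
Qed.

Lemma sub_row_mxP d m n p (A : 'M[K]_(d, m)) (B : 'M[K]_(d, n)) (a : 'M[K]_(p, m)) x :
  reflect (exists D, a = D *m A /\ x = D *m B) (row_mx a x <= row_mx A B)%MS.
Proof.
apply: (iffP submxP) => -[D]; first by rewrite mul_mx_row => /eq_row_mx; exists D.
by case=> -> ->; exists D; rewrite mul_mx_row.
Qed.

Lemma sub_diag1 d m n p (B : 'M[K]_(d, n)) (a : 'M[K]_(p, m)) x :
  (row_mx a x <= block_mx (1%:M : 'M[K]_m) 0 0 B)%MS = (x <= B)%MS.
Proof.
apply/submxP/submxP => -[D].
  rewrite -[D]hsubmxK mul_row_block !mulmx0 addr0 add0r => /eq_row_mx[_ ->].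
  by exists (rsubmx D).
by move=> ->; exists (row_mx a D); rewrite mul_row_block !mulmx0 mulmx1 addr0 add0r.
Qed.

(* [rk] counts the pivots, and the coordinates without pivot are free. *)
Lemma rkP n rows : all (fun r => size r == n) rows ->
  exists d (B : 'M[K]_(d, n)), [/\ (d + rk n rows)%N = n, row_free B &
    forall x : 'rV[K]_n, all (fun r => dotr r x == 0) rows = (x <= B)%MS].
Proof.
elim: n rows => [|n IH] rows szr.
  exists 0, 0; split => //=; first by rewrite /row_free mxrank0.
  move=> x; rewrite thinmx0 sub0mx; apply/allP => r _.
  by rewrite /dotr big_ord0.
have split_x (x : 'rV[K]_(1 + n)) : exists x0 (x' : 'rV_n), x = row_mx (x0%:M : 'rV[K]_1) x'.
  exists (lsubmx x 0 0), (rsubmx x); rewrite -[LHS]hsubmxK; congr row_mx.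
  by apply/matrixP => i j; rewrite !ord1 !mxE mulr1n.
rewrite /=; case E: (pivot rows) => [[p l]|].
  have [p0 rE szE] := pivot_some E.
  have szp : size p == n.+1 by apply: (allP szr); rewrite rE eqxx.
  have szl r : r \in l -> size r == n.+1 by move=> rl; apply: (allP szr); rewrite rE rl orbT.
  set rows' := [seq _ | _ <- l].
  have [|d [B [dn Bf BP]]] := IH rows'.
    apply/allP => r /mapP[s sl ->]; rewrite /reduce; case: ifP => _;
      first by rewrite size_behead (eqP (szl _ sl)).
    by rewrite size_map size_zip !size_behead (eqP (szl _ sl)) (eqP szp) minnn.
  have pK : zK (head 0%BZ p) != 0 by rewrite zK_eq0; apply/negP => /Z.eqb_spec; exact/eqP.
  pose q : 'cV[K]_n := \col_i zK (nth 0%BZ (behead p) i).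
  have qE (x : 'rV[K]_n) : (x *m q) 0 0 = dotr (behead p) x.
    by rewrite mxE; apply: eq_bigr => i _; rewrite mxE mulrC.
  (* The pivot equation determines the first coordinate from the others, so each solution of the
     reduced system extends in exactly one way. *)
  exists d, (row_mx (- (zK (head 0%BZ p))^-1 *: (B *m q)) B : 'M[K]_(d, 1 + n)); split.
  - by rewrite addnS dn.
  - exact: (@row_free_row_mx d 1 n _ _ Bf).
  - move=> x; have [x0 [x' ->]] := split_x x.
  have -> : all (fun r => dotr r (row_mx (x0%:M : 'rV[K]_1) x') == 0) rows =
     (zK (head 0%BZ p) * x0 + dotr (behead p) x' == 0) && (x' <= B)%MS.
    rewrite -BP; apply/allP/andP => [H|[/eqP px H] r].
      have px : zK (head 0%BZ p) * x0 + dotr (behead p) x' == 0.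
        by rewrite -dotrS; apply: H; rewrite rE eqxx.
      split => //; apply/allP => r /mapP[s sl ->].
      rewrite (dotr_reduce _ _ _ (eqP px)) ?size_behead ?(eqP szp)// ?(eqP (szl _ sl))//.
      by rewrite -dotrS; apply: H; rewrite rE sl orbT.
    rewrite rE => /orP[/eqP ->|rl]; first by rewrite dotrS px.
    rewrite dotrS -(dotr_reduce (p := head 0%BZ p) (pr := behead p)) ?size_behead ?(eqP szp)//;
      last exact/eqP/szl.
    by apply: (allP H); exact: map_f.
  apply/andP/(@sub_row_mxP d 1 n) => [[/eqP px /submxP[D x'E]]|[D [x0E x'E]]].
    exists D; split => //; rewrite -scalemxAr mulmxA -x'E.
    apply/matrixP => i j; rewrite !ord1 !mxE mulr1n.
    have := qE x'; rewrite mxE => ->.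
    have -> : dotr (behead p) x' = - (zK (head 0%BZ p) * x0).
      by apply/eqP; rewrite -addr_eq0 addrC px.
    by rewrite mulrNN mulKf.
  split; last by rewrite x'E submxMl.
  move/matrixP: x0E => /(_ 0 0); rewrite -scalemxAr mulmxA -x'E !mxE mulr1n => ->.
  by have := qE x'; rewrite mxE => ->; rewrite mulNr mulrN mulVKf// addNr.
have /allP p0 := pivot_none E.
have [|d [B [dn Bf BP]]] := IH [seq behead r | r <- rows].
  by apply/allP => r /mapP[s /(allP szr)/eqP ss ->]; rewrite size_behead ss.
(* No equation involves the first unknown: it is free and contributes one more basis vector. *)
exists d.+1, (block_mx (1%:M : 'M[K]_1) 0 0 B : 'M[K]_(1 + d, 1 + n)); split.
- by rewrite addSn dn.
- exact: (@row_free_diag1 d 1 n _ Bf).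
move=> x; have [x0 [x' ->]] := split_x x.
have -> : all (fun r => dotr r (row_mx (x0%:M : 'rV[K]_1) x') == 0) rows = (x' <= B)%MS.
  rewrite -BP all_map; apply: eq_in_all => r rr /=.
  by rewrite dotrS; have /Z.eqb_spec -> := p0 _ rr; rewrite zK0 mul0r add0r.
exact/esym/(@sub_diag1 d 1 n).
Qed.

End RkP.

(** * Trilinear forms and equivariant linear systems *)

Section Trilinear.
Variable K : numFieldType.
Local Notation rV := 'rV[K]_5.
Definition tns := 'I_5 -> 'I_5 -> 'I_5 -> K.
Implicit Types (T : tns) (a b c : rV).

Definition tri T a b c : K :=
  \sum_(i < 5) \sum_(j < 5) \sum_(k < 5) a 0 i * b 0 j * c 0 k * T i j k.

Definition dl (i : 'I_5) : rV := delta_mx 0 i.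

Lemma sum_dl (F : 'I_5 -> K) i : \sum_j dl i 0 j * F j = F i.
Proof.
rewrite (bigD1 i)//= big1 ?addr0; first by rewrite mxE !eqxx mul1r.
by move=> j ji; rewrite mxE eqxx (negPf ji) mul0r.
Qed.

Lemma tri_dl T i j k : tri T (dl i) (dl j) (dl k) = T i j k.
Proof.
rewrite /tri; under eq_bigr => i' _.
  under eq_bigr => j' _.
    under eq_bigr do rewrite -!mulrA.
    rewrite -!mulr_sumr sum_dl; over.
  rewrite -mulr_sumr sum_dl; over.
by rewrite sum_dl.
Qed.

Lemma triP1 T x a a' b c : tri T (x *: a + a') b c = x * tri T a b c + tri T a' b c.
Proof.
rewrite /tri !mulr_sumr -big_split; apply: eq_bigr => i _ /=.
rewrite !mulr_sumr -big_split; apply: eq_bigr => j _ /=.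
rewrite !mulr_sumr -big_split; apply: eq_bigr => k _ /=.
by rewrite !mxE; ring.
Qed.

Lemma triP2 T x a b b' c : tri T a (x *: b + b') c = x * tri T a b c + tri T a b' c.
Proof.
rewrite /tri !mulr_sumr -big_split; apply: eq_bigr => i _ /=.
rewrite !mulr_sumr -big_split; apply: eq_bigr => j _ /=.
rewrite !mulr_sumr -big_split; apply: eq_bigr => k _ /=.
by rewrite !mxE; ring.
Qed.

Lemma triP3 T x a b c c' : tri T a b (x *: c + c') = x * tri T a b c + tri T a b c'.
Proof.
rewrite /tri !mulr_sumr -big_split; apply: eq_bigr => i _ /=.
rewrite !mulr_sumr -big_split; apply: eq_bigr => j _ /=.
rewrite !mulr_sumr -big_split; apply: eq_bigr => k _ /=.
by rewrite !mxE; ring.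
Qed.

Lemma linear_eq0 (F : rV -> K) :
  (forall x a a', F (x *: a + a') = x * F a + F a') -> (forall i, F (dl i) = 0) ->
  forall a, F a = 0.
Proof.
move=> Fl F0 a; have FZ : F 0 = 0.
  have := Fl (-1) 0 0; rewrite scaler0 addr0 mulN1r => /eqP.
  by rewrite eq_sym addNr => /eqP <-.
rewrite (row_sum_delta a); elim: (index_enum _) => [|i r IH]; first by rewrite big_nil.
by rewrite big_cons Fl F0 mulr0 add0r.
Qed.

(* A vector of length 125 encodes the bilinear map sending the pair of basis
   vectors [y], [z] to its slice at [(y, z)]. *)
Definition idx_lt (a b k : 'I_5) : (a * 25 + b * 5 + k < 125)%N.
Proof. by have := ltn_ord a; have := ltn_ord b; have := ltn_ord k; lia. Qed.
Definition idx (a b k : 'I_5) : 'I_125 := Ordinal (idx_lt a b k).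

Lemma idx_inj (a b k a' b' k' : 'I_5) : idx a b k = idx a' b' k' -> [/\ a = a', b = b' & k = k'].
Proof.
move=> /(congr1 val) /=; have := ltn_ord b; have := ltn_ord b'.
have := ltn_ord k; have := ltn_ord k' => *; split; apply/val_inj => /=; lia.
Qed.

Lemma idxP n : exists a b k : 'I_5, n = idx a b k.
Proof.
have n1 : (n %/ 25 < 5)%N by have := ltn_ord n; lia.
have n2 : (n %/ 5 %% 5 < 5)%N by lia.
have n3 : (n %% 5 < 5)%N by lia.
by exists (Ordinal n1), (Ordinal n2), (Ordinal n3); apply/val_inj => /=; lia.
Qed.

Definition bimap (x : 'rV[K]_125) (b c : rV) : rV :=
  \row_k \sum_(y < 5) \sum_(z < 5) b 0 y * c 0 z * x 0 (idx y z k).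

Lemma bimapE x y z k : bimap x (dl y) (dl z) 0 k = x 0 (idx y z k).
Proof.
rewrite mxE; under eq_bigr => y' _.
  under eq_bigr do rewrite -mulrA.
  rewrite -mulr_sumr sum_dl; over.
by rewrite sum_dl.
Qed.

Lemma bimapP1 x s b b' c : bimap x (s *: b + b') c = s *: bimap x b c + bimap x b' c.
Proof.
apply/rowP => k; rewrite !mxE mulr_sumr -big_split; apply: eq_bigr => i _ /=.
by rewrite !mulr_sumr -big_split; apply: eq_bigr => j _ /=; rewrite !mxE; ring.
Qed.

Lemma bimapP2 x s b c c' : bimap x b (s *: c + c') = s *: bimap x b c + bimap x b c'.
Proof.
apply/rowP => k; rewrite !mxE mulr_sumr -big_split; apply: eq_bigr => i _ /=.
by rewrite !mulr_sumr -big_split; apply: eq_bigr => j _ /=; rewrite !mxE; ring.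
Qed.

Lemma bimapPx s x x' b c : bimap (s *: x + x') b c = s *: bimap x b c + bimap x' b c.
Proof.
apply/rowP => k; rewrite !mxE mulr_sumr -big_split; apply: eq_bigr => i _ /=.
by rewrite !mulr_sumr -big_split; apply: eq_bigr => j _ /=; rewrite !mxE; ring.
Qed.

(** The change of variables [g] on both arguments and [h] on the value of the bilinear map encoded
    by [x]; the quotients and remainders decode [idx]. *)
Definition transport (g h : 'M[K]_5) (x : 'rV[K]_125) : 'rV[K]_125 :=
  \row_(n < 125) (bimap x (dl (inord (n %/ 25)) *m g) (dl (inord (n %/ 5 %% 5)) *m g) *m h)
    0 (inord (n %% 5)).

Lemma bimap_ext x x' :
  (forall b c, bimap x b c = bimap x' b c) -> x = x'.
Proof.
by move=> e; apply/rowP => n; have [a [b [k ->]]] := idxP n; rewrite -!bimapE e.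
Qed.

Lemma bilinear_ext (F G : rV -> rV -> rV) :
  (forall s b b' c, F (s *: b + b') c = s *: F b c + F b' c) ->
  (forall s b c c', F b (s *: c + c') = s *: F b c + F b c') ->
  (forall s b b' c, G (s *: b + b') c = s *: G b c + G b' c) ->
  (forall s b c c', G b (s *: c + c') = s *: G b c + G b c') ->
  (forall y z, F (dl y) (dl z) = G (dl y) (dl z)) -> forall b c, F b c = G b c.
Proof.
move=> F1 F2 G1 G2 FG b c; apply/rowP => k; apply/eqP; rewrite -subr_eq0; apply/eqP.
apply: (linear_eq0 (F := fun b => F b c 0 k - G b c 0 k)) => [s d d'|y].
  by rewrite F1 G1 !mxE; ring.
apply: (linear_eq0 (F := fun c => F (dl y) c 0 k - G (dl y) c 0 k)) => [s d d'|z].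
  by rewrite F2 G2 !mxE; ring.
by rewrite FG subrr.
Qed.

Lemma bimap_transport g h x b c :
  bimap (transport g h x) b c = bimap x (b *m g) (c *m g) *m h.
Proof.
apply: (bilinear_ext (F := bimap _) (G := fun b c => bimap x (b *m g) (c *m g) *m h)).
- by move=> *; rewrite bimapP1.
- by move=> *; rewrite bimapP2.
- by move=> *; rewrite mulmxDl -scalemxAl bimapP1 mulmxDl -scalemxAl.
- by move=> *; rewrite mulmxDl -scalemxAl bimapP2 mulmxDl -scalemxAl.
move=> y z; apply/rowP => k; rewrite bimapE mxE /=.
have := ltn_ord y; have := ltn_ord z; have := ltn_ord k => *.
congr ((bimap x (dl _ *m g) (dl _ *m g) *m h) 0 _); apply/val_inj; rewrite /= inordK; lia.
Qed.

Lemma transportK g h x : g \in unitmx -> h \in unitmx ->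
  transport (invmx g) (invmx h) (transport g h x) = x.
Proof.
move=> gu hu; apply: bimap_ext => b c.
by rewrite !bimap_transport !mulmxKV// mulmxK.
Qed.

Lemma transport_linear g h : linear (transport g h).
Proof.
by move=> s x x'; apply: bimap_ext => b c;
  rewrite bimap_transport !bimapPx !bimap_transport mulmxDl scalemxAl.
Qed.

End Trilinear.

HB.instance Definition _ (K : numFieldType) (g h : 'M[K]_5) :=
  GRing.isLinear.Build K 'rV[K]_125 'rV[K]_125 _ (transport g h) (transport_linear g h).

(** * Ranks and solution spaces of linear systems in 125 unknowns *)

Section System.
Variable (K : numFieldType) (Q : finType).
Implicit Types (E : Q -> 'rV[K]_125 -> K).

(** Equations are columns, so that the solutions form the left kernel [kermx]. *)
Definition sysmx E : 'M[K]_(125, #|Q|) :=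
  \matrix_(n, q) E (enum_val q) (delta_mx 0 n).

Lemma sysmxP E x : (forall q s x x', E q (s *: x + x') = s * E q x + E q x') ->
  x *m sysmx E = 0 <-> forall q, E q x = 0.
Proof.
move=> El; have xE q : E q x = (x *m sysmx E) 0 (enum_rank q).
  rewrite mxE (eq_bigr (fun n => x 0 n * E q (delta_mx 0 n))); last first.
    by move=> n _; rewrite mxE enum_rankK.
  have E0 : E q 0 = 0.
    have := El q (-1) 0 0; rewrite scaler0 addr0 mulN1r => /eqP.
    by rewrite eq_sym addNr => /eqP <-.
  rewrite {1}(row_sum_delta x); elim: (index_enum _) => [|n r IH]; first by rewrite !big_nil.
  by rewrite !big_cons El IH.
split=> [x0 q|x0]; first by rewrite xE x0 mxE.
by apply/rowP => q; rewrite -[q]enum_valK -xE x0 mxE.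
Qed.

(** Both sides are 125 minus the dimension of the same solution space. *)
Lemma rank_sysmx E rows :
    (forall q s x x', E q (s *: x + x') = s * E q x + E q x') ->
    (forall x, (forall q, E q x = 0) <-> all (fun r => dotr r x == 0) rows) ->
    all (fun r => size r == 125%N) rows ->
  \rank (sysmx E) = rk 125%N rows.
Proof.
move=> El EP sz; have [d [B [dn Bf BP]]] := @rkP K 125%N rows sz.
have kB : (kermx (sysmx E) :=: B)%MS.
  apply/eqmxP/andP; split; apply/row_subP => i.
    rewrite -BP; apply/EP/sysmxP => //; rewrite -row_mul mulmx_ker.
    by apply/rowP => j; rewrite !mxE.
  apply/sub_kermxP/sysmxP => //; apply/EP; rewrite BP; exact: row_sub.
have := mxrank_ker (sysmx E); rewrite kB (eqP Bf).
have := rank_leq_row (sysmx E). lia.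
Qed.

(** The invertible map [f] embeds the solutions of [E] into those of [E'], and more solutions mean a
    smaller rank. *)
Lemma rank_sysmx_le E E' (f g : {linear 'rV[K]_125 -> 'rV[K]_125}) :
    (forall q s x x', E q (s *: x + x') = s * E q x + E q x') ->
    (forall q s x x', E' q (s *: x + x') = s * E' q x + E' q x') ->
    cancel f g ->
    (forall x, (forall q, E q x = 0) -> forall q, E' q (f x) = 0) ->
  (\rank (sysmx E') <= \rank (sysmx E))%N.
Proof.
move=> El E'l fK fE.
have Fu : lin1_mx f \in unitmx.
  case: (mulmx1_unit (A := lin1_mx f) (B := lin1_mx g)) => //.
  by apply/row_matrixP => i; rewrite row_mul !rowE mulmx1 !mul_rV_lin1 fK.
have /mxrankS : (kermx (sysmx E) *m lin1_mx f <= kermx (sysmx E'))%MS.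
  apply/row_subP => i; apply/sub_kermxP/sysmxP => // q.
  rewrite row_mul mul_rV_lin1; move: q; apply: fE; apply/sysmxP => //.
  by rewrite -row_mul mulmx_ker; apply/rowP => j; rewrite !mxE.
rewrite mxrankMfree ?row_free_unit// !mxrank_ker.
have := rank_leq_row (sysmx E); have := rank_leq_row (sysmx E'); lia.
Qed.
End System.

Section SymForms.
Variable K : numFieldType.
Local Notation rV := 'rV[K]_5.
Implicit Types (T : tns K) (x : 'rV[K]_125) (a b c : rV) (s : bool).

(** The sum over the six permutations of the three vectors of phi(c1, X(c2, c3)), where X is the
    bilinear map encoded by [x]. Without signs ([s] false) it is the polarisation of phi(c, X(c,
    c)); with signs it is alternating. *)
Definition symform s (phi : rV -> rV -> K) x c1 c2 c3 : K :=
  phi c1 (bimap x c2 c3) + phi c2 (bimap x c3 c1) + phi c3 (bimap x c1 c2)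
  + (-1) ^+ s * (phi c2 (bimap x c1 c3) + phi c1 (bimap x c3 c2) + phi c3 (bimap x c2 c1)).

Definition bilin (phi : rV -> rV -> K) :=
  (forall t c c' y, phi (t *: c + c') y = t * phi c y + phi c' y) /\
  (forall t c y y', phi c (t *: y + y') = t * phi c y + phi c y').

Lemma symformP s phi : bilin phi ->
  [/\ forall t x x' c1 c2 c3, symform s phi (t *: x + x') c1 c2 c3 =
        t * symform s phi x c1 c2 c3 + symform s phi x' c1 c2 c3,
      forall x t c c' c2 c3, symform s phi x (t *: c + c') c2 c3 =
        t * symform s phi x c c2 c3 + symform s phi x c' c2 c3,
      forall x t c1 c c' c3, symform s phi x c1 (t *: c + c') c3 =
        t * symform s phi x c1 c c3 + symform s phi x c1 c' c3 &
      forall x t c1 c2 c c', symform s phi x c1 c2 (t *: c + c') =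
        t * symform s phi x c1 c2 c + symform s phi x c1 c2 c'].
Proof.
move=> [p1 p2]; split=> *; rewrite /symform ?(bimapPx, bimapP1, bimapP2) ?p1 ?p2; ring.
Qed.

Lemma symform_eq0 s phi x : bilin phi ->
  (forall y1 y2 y3, symform s phi x (dl K y1) (dl K y2) (dl K y3) = 0) ->
  forall c1 c2 c3, symform s phi x c1 c2 c3 = 0.
Proof.
move=> /(symformP s)[_ l1 l2 l3] H c1 c2 c3.
apply: (linear_eq0 (F := fun c => symform s phi x c c2 c3)) => // y1.
apply: (linear_eq0 (F := fun c => symform s phi x _ c c3)) => // y2.
exact: (linear_eq0 (F := fun c => symform s phi x _ _ c)).
Qed.

Lemma symform_swap12 s phi x c1 c2 c3 :
  symform s phi x c2 c1 c3 = (-1) ^+ s * symform s phi x c1 c2 c3.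
Proof. rewrite /symform; case: s => /=; ring. Qed.

Lemma symform_swap23 s phi x c1 c2 c3 :
  symform s phi x c1 c3 c2 = (-1) ^+ s * symform s phi x c1 c2 c3.
Proof. rewrite /symform; case: s => /=; ring. Qed.

Definition phi3 T b c y : K := tri T y b c.

(** The polarised 2 x 2 minor of the matrices T(., ., c) and T(., ., y) on rows a, a' and columns b,
    b': for c = y it is twice the minor. *)
Definition phi2 T a a' b b' c y : K :=
  tri T a b c * tri T a' b' y - tri T a' b c * tri T a b' y
  - tri T a b' c * tri T a' b y + tri T a' b' c * tri T a b y.

Lemma phi3_bilin T b : bilin (phi3 T b).
Proof. by split=> *; rewrite /phi3 (triP1, triP3). Qed.

Lemma phi2_bilin T a a' b b' : bilin (phi2 T a a' b b').
Proof. by split=> *; rewrite /phi2 !triP3; ring. Qed.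

Definition Q3 : finType := ('I_5 * ('I_5 * 'I_5 * 'I_5))%type.
Definition Q2 : finType :=
  (('I_5 * 'I_5) * ('I_5 * 'I_5) * ('I_5 * 'I_5 * 'I_5))%type.

(* For a bilinear map X from pairs of vectors of C^* to A^*, [E3 T] is the system
   T(X(c, c), b, c) = 0; for X with values in C^*, [E2 T] is the antisymmetrisation
   in c1, c2, c3 of the 2 x 2 minors of T(., ., c1) and T(., ., X(c2, c3)). *)
Definition E3 T (q : Q3) x : K :=
  symform false (phi3 T (dl K q.1)) x (dl K q.2.1.1) (dl K q.2.1.2) (dl K q.2.2).

Definition E2 T (q : Q2) x : K :=
  symform true (phi2 T (dl K q.1.1.1) (dl K q.1.1.2) (dl K q.1.2.1) (dl K q.1.2.2)) x
    (dl K q.2.1.1) (dl K q.2.1.2) (dl K q.2.2).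

Lemma E3_linear T q t x x' : E3 T q (t *: x + x') = t * E3 T q x + E3 T q x'.
Proof. by have [l _ _ _] := symformP false (phi3_bilin T (dl K q.1)); exact: l. Qed.

Lemma E2_linear T q t x x' : E2 T q (t *: x + x') = t * E2 T q x + E2 T q x'.
Proof.
by have [l _ _ _] := symformP true (phi2_bilin T (dl K q.1.1.1) (dl K q.1.1.2)
  (dl K q.1.2.1) (dl K q.1.2.2)); exact: l.
Qed.

Lemma E3P T x : (forall q, E3 T q x = 0) ->
  forall b c1 c2 c3, symform false (phi3 T b) x c1 c2 c3 = 0.
Proof.
move=> H b c1 c2 c3.
apply: (linear_eq0 (F := fun b => symform false (phi3 T b) x c1 c2 c3)) => [t d d'|j].
  by rewrite /symform /phi3 !triP2; ring.
by apply: symform_eq0 (phi3_bilin _ _) _ _ _ _ => y1 y2 y3; exact: (H (j, (y1, y2, y3))).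
Qed.

Lemma E2P T x : (forall q, E2 T q x = 0) ->
  forall a a' b b' c1 c2 c3, symform true (phi2 T a a' b b') x c1 c2 c3 = 0.
Proof.
move=> H a a' b b' c1 c2 c3; pose F a a' b b' := symform true (phi2 T a a' b b') x c1 c2 c3.
apply: (linear_eq0 (F := fun a => F a a' b b')) => [t d d'|i].
  by rewrite /F /symform /phi2 !triP1; ring.
apply: (linear_eq0 (F := fun a' => F _ a' b b')) => [t d d'|i'].
  by rewrite /F /symform /phi2 !triP1; ring.
apply: (linear_eq0 (F := fun b => F _ _ b b')) => [t d d'|j].
  by rewrite /F /symform /phi2 !triP2; ring.
apply: (linear_eq0 (F := fun b' => F _ _ _ b')) => [t d d'|j'].
  by rewrite /F /symform /phi2 !triP2; ring.
by apply: symform_eq0 (phi2_bilin _ _ _ _ _) _ _ _ _ => y1 y2 y3;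
  exact: (H (((i, i'), (j, j')), (y1, y2, y3))).
Qed.

Section Equivariance.
Variables (T T' : tns K) (g1 g2 g3 : 'M[K]_5).
Hypotheses (u1 : g1 \in unitmx) (u3 : g3 \in unitmx).
Hypothesis TT' : forall a b c, tri T' a b c = tri T (a *m g1) (b *m g2) (c *m g3).

(** A solution has arguments in C^* and values in A^*: it is transported by [g3] on the arguments
    and by the inverse of [g1] on the value. For [E2] the values lie in C^*, and the inverse of [g3]
    is used instead. *)
Lemma rank_E3_act : (\rank (sysmx (E3 T')) <= \rank (sysmx (E3 T)))%N.
Proof.
apply: (rank_sysmx_le (f := transport g3 (invmx g1)) (g := transport (invmx g3) g1)).
- exact: E3_linear.
- exact: E3_linear.
- by move=> x /=; have := transportK x u3 (_ : invmx g1 \in unitmx); rewrite invmxK unitmx_inv;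
  exact.
move=> x /E3P H q; rewrite /E3 /symform /phi3 !TT' !bimap_transport !mulmxKV//.
exact: H.
Qed.

Lemma rank_E2_act : (\rank (sysmx (E2 T')) <= \rank (sysmx (E2 T)))%N.
Proof.
apply: (rank_sysmx_le (f := transport g3 (invmx g3)) (g := transport (invmx g3) g3)).
- exact: E2_linear.
- exact: E2_linear.
- by move=> x /=; have := transportK x u3 (_ : invmx g3 \in unitmx); rewrite invmxK unitmx_inv;
  exact.
move=> x /E2P H q; rewrite /E2 /symform /phi2 !TT' !bimap_transport !mulmxKV//.
exact: H.
Qed.
End Equivariance.
End SymForms.

(** * Integer matrices of the systems [E3] and [E2] *)

Definition allpairs5 : seq (nat * nat) := [seq (a, b) | a <- iota 0 5, b <- iota 0 5].
Definition alltriples5 : seq (nat * nat * nat) :=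
  [seq (ab.1, ab.2, c) | ab <- allpairs5, c <- iota 0 5].
Definition ltpairs := [seq p <- allpairs5 | (p.1 < p.2)%N].
Definition lttriples := [seq p <- alltriples5 | (p.1.1 < p.1.2)%N && (p.1.2 < p.2)%N].
Definition letriples := [seq p <- alltriples5 | (p.1.1 <= p.1.2)%N && (p.1.2 <= p.2)%N].

Definition zentry (s : bool) (ph : nat -> nat -> Z) (y u : nat * nat * nat) : Z :=
  let: (y1, y2, y3) := y in let: (a, b, k) := u in
  let w y z c := if (a == y) && (b == z) then ph c k else 0%BZ in
  let v := (w y1 y3 y2 + w y3 y2 y1 + w y2 y1 y3)%BZ in
  (w y2 y3 y1 + w y3 y1 y2 + w y1 y2 y3 + (if s then - v else v))%BZ.

(** The unknown at [idx a b k] can occur only when a and b are both among the three indices of the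
    equation; the other blocks of five zeros are written without calling [zentry]. *)
Definition zrow (s : bool) (ph : nat -> nat -> Z) (y : nat * nat * nat) : seq Z :=
  let l := [:: y.1.1; y.1.2; y.2] in
  flatten [seq (if (ab.1 \in l) && (ab.2 \in l)
                then [seq zentry s ph y (ab.1, ab.2, k) | k <- iota 0 5]
                else nseq 5 0%BZ) | ab <- allpairs5].

Lemma zrowE s ph y : zrow s ph y = [seq zentry s ph y u | u <- alltriples5].
Proof.
rewrite /zrow /alltriples5 map_flatten -map_comp; congr flatten; apply: eq_map => -[a b].
case: y => [[y1 y2] y3] /=; case: ifP => // /negbT; rewrite !inE /zentry /= negb_and !negb_or.
by case/orP=> /and3P[/negbTE-> /negbTE-> /negbTE->]; rewrite ?andbF; case: s.
Qed.

Definition ztns := nat -> nat -> nat -> Z.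

(** The form is symmetric in its three vectors, so weakly increasing triples give all the
    equations. *)
Definition rows3 (t : ztns) : seq (seq Z) :=
  [seq zrow false (fun c k => t k j c) y | j <- iota 0 5, y <- letriples].

(** Here the form is alternating in the three vectors and in each pair of indices of the minor, so
    strictly increasing triples and pairs suffice in characteristic 0. *)
Definition rows2 (t : ztns) : seq (seq Z) :=
  [seq zrow true (fun c k =>
      t p.1.1 p.2.1 c * t p.1.2 p.2.2 k - t p.1.2 p.2.1 c * t p.1.1 p.2.2 k
      - t p.1.1 p.2.2 c * t p.1.2 p.2.1 k + t p.1.2 p.2.2 c * t p.1.1 p.2.1 k)%BZ y
  | p <- [seq (ii, jj) | ii <- ltpairs, jj <- ltpairs], y <- lttriples].

Lemma mem_allpairs5 (a b : 'I_5) : (nat_of_ord a, nat_of_ord b) \in allpairs5.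
Proof.
by apply/allpairsP; exists (nat_of_ord a, nat_of_ord b); split; rewrite ?mem_iota /= ?ltn_ord.
Qed.

Lemma mem_alltriples5 (a b c : 'I_5) :
  (nat_of_ord a, nat_of_ord b, nat_of_ord c) \in alltriples5.
Proof.
by apply/allpairsP; exists (nat_of_ord a, nat_of_ord b, nat_of_ord c); split;
  rewrite ?mem_iota /= ?mem_allpairs5 ?ltn_ord.
Qed.

Lemma allpairs5P p : p \in allpairs5 -> exists a b : 'I_5, p = (val a, val b).
Proof.
case/allpairsP => -[a b] []; rewrite !mem_iota /= => a5 b5 ->.
by exists (Ordinal a5), (Ordinal b5).
Qed.

Lemma alltriples5P p : p \in alltriples5 -> exists a b c : 'I_5, p = (val a, val b, val c).
Proof.
case/allpairsP => -[ab c] [/allpairs5P[a [b abE]]]; rewrite mem_iota => /= c5 ->.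
by exists a, b, (Ordinal c5); rewrite /= in abE *; rewrite abE.
Qed.

Lemma nth_alltriples5 (a b k : 'I_5) :
  nth (0, 0, 0)%N alltriples5 (idx a b k) = (val a, val b, val k).
Proof.
case: a => [[|[|[|[|[|//]]]]] ?]; case: b => [[|[|[|[|[|//]]]]] ?];
by case: k => [[|[|[|[|[|//]]]]] ?].
Qed.

Lemma sorted3 (P : 'I_5 -> 'I_5 -> 'I_5 -> Prop) :
    (forall a b c, P a b c -> P b a c) -> (forall a b c, P a b c -> P a c b) ->
    (forall a b c : 'I_5, (a <= b <= c)%N -> P a b c) ->
  forall a b c, P a b c.
Proof.
move=> s12 s23 Ple a b c.
wlog ab : a b c / (a <= b)%N.
  by move=> H; case: (leqP a b) => [|/ltnW] ab; [exact: H | apply/s12/H].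
case: (leqP b c) => [bc|/ltnW cb]; first by apply: Ple; rewrite ab.
case: (leqP a c) => [ac|/ltnW ca]; first by apply/s23/Ple; rewrite ac.
by apply/s23/s12/Ple; rewrite ca.
Qed.

Section Rows.
Variable K : numFieldType.
Implicit Types (T : tns K) (x : 'rV[K]_125) (s : bool).

Lemma sum125 (F : 'I_125 -> K) :
  \sum_(n < 125) F n = \sum_(a < 5) \sum_(b < 5) \sum_(k < 5) F (idx a b k).
Proof.
pose h (u : 'I_5 * 'I_5 * 'I_5) := idx u.1.1 u.1.2 u.2.
have hb : bijective h.
  apply: inj_card_bij; last by rewrite !card_prod !card_ord.
  by move=> [[a b] k] [[a' b'] k'] /idx_inj/= [-> -> ->].
rewrite (reindex h); last exact: onW_bij.
by rewrite pair_big pair_big; apply: eq_bigr => -[[a b] k].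
Qed.

Lemma dotr_zrow s (phi : 'rV[K]_5 -> 'rV[K]_5 -> K) (ph : nat -> nat -> Z) x (y1 y2 y3 : 'I_5) :
    bilin phi -> (forall c k : 'I_5, phi (dl K c) (dl K k) = zK K (ph c k)) ->
  dotr (zrow s ph (val y1, val y2, val y3)) x =
  symform s phi x (dl K y1) (dl K y2) (dl K y3).
Proof.
move=> [p1 p2] phE.
have phi0 c : phi c 0 = 0.
  have := p2 (-1) c 0 0; rewrite scaler0 addr0 mulN1r => /eqP.
  by rewrite eq_sym addNr => /eqP <-.
pose w (y z c : 'I_5) (a b k : nat) :=
  if (a == y) && (b == z) then ph c k else 0%BZ.
have wE (y z c : 'I_5) : \sum_(a < 5) \sum_(b < 5) \sum_(k < 5)
     zK K (w y z c a b k) * x 0 (idx a b k) = phi (dl K c) (bimap x (dl K y) (dl K z)).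
  rewrite (bigD1 y)//= [X in _ + X]big1 ?addr0; last first.
    move=> a ay; rewrite big1// => b _; rewrite big1// => k _.
    by rewrite /w (_ : (nat_of_ord a == y) = false) ?mul0r//; apply: negbTE.
  rewrite (bigD1 z)//= [X in _ + X]big1 ?addr0; last first.
    move=> b bz; rewrite big1// => k _.
    by rewrite /w eqxx (_ : (nat_of_ord b == z) = false) ?mul0r//; apply: negbTE.
  rewrite [bimap x _ _]row_sum_delta.
  under eq_bigr do rewrite /w !eqxx /= -phE mulrC -bimapE.
  elim: (index_enum _) => [|k r IH]; first by rewrite !big_nil phi0.
  by rewrite !big_cons p2 IH.
rewrite /dotr sum125 /symform -!wE.
have -> : (-1) ^+ s = (if s then -1 else 1) :> K by case: s.
rewrite -!big_split/= mulr_sumr -big_split; apply: eq_bigr => a _ /=.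
rewrite -!big_split/= mulr_sumr -big_split; apply: eq_bigr => b _ /=.
rewrite -!big_split/= mulr_sumr -big_split; apply: eq_bigr => k _ /=.
rewrite zrowE (nth_map (0, 0, 0)%N) ?nth_alltriples5; last first.
  by have := ltn_ord (idx a b k).
rewrite /zentry.
rewrite -/(w y2 y3 y1 a b k) -/(w y3 y1 y2 a b k) -/(w y1 y2 y3 a b k).
rewrite -/(w y1 y3 y2 a b k) -/(w y3 y2 y1 a b k) -/(w y2 y1 y3 a b k).
by case: s; rewrite ?(zKN, zKD); ring.
Qed.

Lemma size_zrow s ph y : size (zrow s ph y) = 125%N.
Proof. by rewrite zrowE size_map. Qed.

Lemma rank_E3 T (t : ztns) : (forall i j k : 'I_5, T i j k = zK K (t i j k)) ->
  \rank (sysmx (E3 T)) = rk 125%N (rows3 t).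
Proof.
move=> Tt; have rE x (j y1 y2 y3 : 'I_5) :
   dotr (zrow false (fun c k => t k j c) (val y1, val y2, val y3)) x =
   E3 T (j, (y1, y2, y3)) x.
  apply: dotr_zrow => [|c k]; first exact: phi3_bilin.
  by rewrite /phi3 tri_dl Tt.
apply: rank_sysmx; first exact: E3_linear.
  move=> x; split=> [H|/allP H [j [[y1 y2] y3]]].
    apply/allP => r /allpairsP[[j y] []]; rewrite mem_iota /= => j5 yl ->.
    move: yl; rewrite mem_filter => /andP[_ /alltriples5P[y1 [y2 [y3 ->]]]].
    by rewrite (rE x (Ordinal j5)) H.
  move: y1 y2 y3; apply: sorted3 => [a b c|a b c|a b c abc].
  - by move=> e; rewrite /E3 /= symform_swap12; move: e; rewrite /E3 /= => ->; rewrite mulr0.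
  - by move=> e; rewrite /E3 /= symform_swap23; move: e; rewrite /E3 /= => ->; rewrite mulr0.
  rewrite -rE; apply/eqP/H; apply: (allpairs_f (fun j y => zrow _ (fun c k => t k j c) y)).
    by rewrite mem_iota /=.
  by rewrite mem_filter abc mem_alltriples5.
by apply/allP => r /allpairsP[[j y] /= [_ _ ->]]; rewrite size_zrow.
Qed.

Lemma rank_E2 T (t : ztns) : (forall i j k : 'I_5, T i j k = zK K (t i j k)) ->
  \rank (sysmx (E2 T)) = rk 125%N (rows2 t).
Proof.
move=> Tt; pose ph (p : nat * nat * (nat * nat)) c k :=
  (t p.1.1 p.2.1 c * t p.1.2 p.2.2 k - t p.1.2 p.2.1 c * t p.1.1 p.2.2 k
      - t p.1.1 p.2.2 c * t p.1.2 p.2.1 k + t p.1.2 p.2.2 c * t p.1.1 p.2.1 k)%BZ.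
have rE x (i i' j j' y1 y2 y3 : 'I_5) :
   dotr (zrow true (ph (val i, val i', (val j, val j'))) (val y1, val y2, val y3)) x =
   E2 T ((i, i'), (j, j'), (y1, y2, y3)) x.
  apply: dotr_zrow => [|c k]; first exact: phi2_bilin.
  by rewrite /phi2 !tri_dl !Tt /ph /= zKD !zKB !zKM.
apply: rank_sysmx; first exact: E2_linear.
  move=> x; split=> [H|/allP H [[[i i'] [j j']] [[y1 y2] y3]]].
    apply/allP => r /allpairsP[[p y] [/allpairsP[[ii jj] [il jl pE]] yl ->]].
    rewrite [p]pE.
    move: il; rewrite mem_filter => /andP[_ /allpairs5P[i [i' ->]]].
    move: jl; rewrite mem_filter => /andP[_ /allpairs5P[j [j' ->]]].
    move: yl; rewrite mem_filter => /andP[_ /alltriples5P[y1 [y2 [y3 /= ->]]]].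
    by rewrite (rE x i i' j j') H.
  have anti (a b : K) : a = - b -> b = 0 -> a = 0 by move=> -> ->; rewrite oppr0.
  have self (a : K) : a = - a -> a = 0.
    by move/eqP; rewrite -addr_eq0 -mulr2n mulrn_eq0 => /eqP.
  wlog ii' : i i' / (i < i')%N.
    move=> W; case: (ltngtP i i') => [ii'|ii'|/val_inj ->].
    - exact: W.
    - by apply: anti (W _ _ ii'); rewrite /E2 /symform /phi2 /=; ring.
    by rewrite /E2 /symform /phi2 /=; ring.
  wlog jj' : j j' / (j < j')%N.
    move=> W; case: (ltngtP j j') => [jj'|jj'|/val_inj ->].
    - exact: W.
    - by apply: anti (W _ _ jj'); rewrite /E2 /symform /phi2 /=; ring.
    by rewrite /E2 /symform /phi2 /=; ring.
  move: y1 y2 y3; apply: sorted3 => [a b c|a b c|a b c /andP[ab bc]].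
  - by move=> e; rewrite /E2 /= symform_swap12; move: e; rewrite /E2 /= => ->; rewrite mulr0.
  - by move=> e; rewrite /E2 /= symform_swap23; move: e; rewrite /E2 /= => ->; rewrite mulr0.
  case: (ltngtP a b) ab => // [ab _|/val_inj -> _]; last first.
    by apply: self; rewrite {1}/E2 /= symform_swap12 expr1 mulN1r.
  case: (ltngtP b c) bc => // [bc _|/val_inj -> _]; last first.
    by apply: self; rewrite {1}/E2 /= symform_swap23 expr1 mulN1r.
  rewrite -rE; apply/eqP/H; apply: (allpairs_f (fun p y => zrow true (ph p) y)).
    by apply: allpairs_f; rewrite mem_filter ?ii' ?jj' mem_allpairs5.
  by rewrite mem_filter /= ab bc mem_alltriples5.
by apply/allP => r /allpairsP[[j y] /= [_ _ ->]]; rewrite size_zrow.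
Qed.

End Rows.

(** * The group action *)

Section Degeneration.
Variable R : realType.
Local Notation C := (Cplx R).
Local Notation tensor := (tensor R).
Local Notation act := (@Defs.act R).
Local Notation orbit := (@Defs.orbit R).
Implicit Types (T S : tensor) (s : 'S_3).

Lemma tri_ext T (F : 'rV[C]_5 -> 'rV[C]_5 -> 'rV[C]_5 -> C) :
    (forall x a a' b c, F (x *: a + a') b c = x * F a b c + F a' b c) ->
    (forall x a b b' c, F a (x *: b + b') c = x * F a b c + F a b' c) ->
    (forall x a b c c', F a b (x *: c + c') = x * F a b c + F a b c') ->
    (forall i j k, F (dl C i) (dl C j) (dl C k) = T i j k) ->
  forall a b c, F a b c = tri T a b c.
Proof.
move=> F1 F2 F3 FT a b c; apply/eqP; rewrite -subr_eq0; apply/eqP.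
apply: (linear_eq0 (F := fun a => F a b c - tri T a b c)) => [x d d'|i].
  by rewrite F1 triP1; ring.
apply: (linear_eq0 (F := fun b => F _ b c - tri T _ b c)) => [x d d'|j].
  by rewrite F2 triP2; ring.
apply: (linear_eq0 (F := fun c => F _ _ c - tri T _ _ c)) => [x d d'|k].
  by rewrite F3 triP3; ring.
by rewrite FT tri_dl subrr.
Qed.

Lemma tri_act g1 g2 g3 T a b c :
  tri (act g1 g2 g3 T) a b c = tri T (a *m g1) (b *m g2) (c *m g3).
Proof.
symmetry; apply: (tri_ext (F := fun a b c => tri T (a *m g1) (b *m g2) (c *m g3))) => *.
- by rewrite mulmxDl -scalemxAl triP1.
- by rewrite mulmxDl -scalemxAl triP2.
- by rewrite mulmxDl -scalemxAl triP3.
by rewrite /tri /act; do 3 (apply: eq_bigr => ? _); rewrite -!rowE !mxE.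
Qed.

Lemma tensorP T S : (forall i j k, T i j k = S i j k) -> T = S.
Proof. by move=> TS; apply/funext => i; apply/funext => j; apply/funext => k. Qed.

Lemma act_act g1 g2 g3 h1 h2 h3 T :
  act g1 g2 g3 (act h1 h2 h3 T) = act (g1 *m h1) (g2 *m h2) (g3 *m h3) T.
Proof.
by apply: tensorP => i j k; rewrite -[LHS]tri_dl -[RHS]tri_dl !tri_act !mulmxA.
Qed.

Lemma act1 T : act 1%:M 1%:M 1%:M T = T.
Proof. by apply: tensorP => i j k; rewrite -[LHS]tri_dl tri_act !mulmx1 tri_dl. Qed.

Lemma orbit_refl T : orbit T T.
Proof. by exists 1%:M, 1%:M, 1%:M; rewrite !unitmx1 act1. Qed.

Lemma orbit_trans T S S' : orbit T S -> orbit S S' -> orbit T S'.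
Proof.
move=> [g1 [g2 [g3 [u1 u2 u3 ->]]]] [h1 [h2 [h3 [v1 v2 v3 ->]]]].
by exists (h1 *m g1), (h2 *m g2), (h3 *m g3); rewrite !unitmx_mul u1 u2 u3 v1 v2 v3 act_act.
Qed.

Lemma orbit_sym T S : orbit T S -> orbit S T.
Proof.
move=> [g1 [g2 [g3 [u1 u2 u3 ->]]]].
by exists (invmx g1), (invmx g2), (invmx g3); rewrite !unitmx_inv act_act !mulVmx// act1.
Qed.

Lemma closureT_image (A B : set tensor) (f : tensor -> tensor) T :
  (forall i j k, continuous (fun S => f S i j k)) ->
  (forall S, A S -> B (f S)) -> closure A T -> closure B (f T).
Proof.
move=> fc AB clT U /nbhs_ballP[e /= e0 eU].
have : \forall S \near T, ball (f T) e (f S).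
  have H i j k : \forall S \near T, ball (f T i j k) e (f S i j k).
    exact: (@near_ball C tensor (fun S => f S i j k) T e (fc i j k) e0).
  have : \forall S \near T, forall i j k, ball (f T i j k) e (f S i j k).
    pose near3 (I : finType) (P : I -> tensor -> Prop) :=
      @filter_forall tensor I P (nbhs T) (nbhs_filter T).
    apply: (near3 _ (fun i S => forall j k, ball (f T i j k) e (f S i j k))) => i.
    apply: (near3 _ (fun j S => forall k, ball (f T i j k) e (f S i j k))) => j.
    exact: (near3 _ (fun k S => ball (f T i j k) e (f S i j k)) (H i j)).
  by apply: filterS => S HS i j k; exact: HS.
move=> /clT[S [AS TS]]; exists (f S); split; [exact: AB | exact: eU].
Qed.

Lemma entry_act_continuous g1 g2 g3 i j k :
  continuous (fun T : tensor => act g1 g2 g3 T i j k).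
Proof.
rewrite /act; do 3 (apply: continuous_sum => ?); apply: continuous_mul.
  exact: cst_continuous.
exact: entry_continuous.
Qed.

Lemma degenerates_refl T : degenerates T T.
Proof. exact/subset_closure/orbit_refl. Qed.

Lemma degenerates_trans T S S' : degenerates T S -> degenerates S S' -> degenerates T S'.
Proof.
move=> TS; apply: (@closure_sub_closure tensor) => _ [g1 [g2 [g3 [u1 u2 u3 ->]]]].
apply: closureT_image TS; first exact: entry_act_continuous.
by move=> W TW; apply: orbit_trans TW _; exists g1, g2, g3.
Qed.

Lemma orbit_degenerates T S : orbit T S -> degenerates T S.
Proof. exact: subset_closure. Qed.

(** The elements of ['S_3] are not suited to computation; they are replaced by the triples of their
    values ([code]), on which [permn] and [zpermn] operate through [sel]. *)
Definition sel (A : Type) (n : nat) (x y z : A) : A :=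
  match n with 0 => x | 1 => y | _ => z end.

Definition perms6 : seq (nat * nat * nat) :=
  [:: (0, 1, 2); (0, 2, 1); (1, 0, 2); (1, 2, 0); (2, 0, 1); (2, 1, 0)]%N.

Definition permn (A : Type) (p : nat * nat * nat) (T : A -> A -> A -> C) i j k : C :=
  T (sel p.1.1 i j k) (sel p.1.2 i j k) (sel p.2 i j k).

Definition code s : nat * nat * nat := (val (s 0), val (s 1), val (s 2)).

Lemma permuteE s T : permute s T = permn (code s) T.
Proof.
have tE (i j k : 'I_5) (x : 'I_3) : tnth [tuple i; j; k] x = sel x i j k.
  by case: x => [[|[|[|//]]] ?].
by apply: tensorP => i j k; rewrite /permute !tE.
Qed.

Lemma code_perms6 s : code s \in perms6.
Proof.
have s01 : s 0 != s 1 by rewrite (inj_eq perm_inj).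
have s02 : s 0 != s 2 by rewrite (inj_eq perm_inj).
have s12 : s 1 != s 2 by rewrite (inj_eq perm_inj).
rewrite /code; move: s01 s02 s12.
by case: (s 0) => [[|[|[|//]]] ?]; case: (s 1) => [[|[|[|//]]] ?];
   case: (s 2) => [[|[|[|//]]] ?].
Qed.

Lemma perms6_code p : p \in perms6 -> exists s, code s = p.
Proof.
have t01 : tperm (0 : 'I_3) 1 2 = 2 by rewrite tpermD.
have t02 : tperm (0 : 'I_3) 2 1 = 1 by rewrite tpermD.
rewrite !inE => /or4P[/eqP->|/eqP->|/eqP->|/or3P[/eqP->|/eqP->|/eqP->]].
- by exists 1%g; rewrite /code !perm1.
- by exists (tperm (1 : 'I_3) 2); rewrite /code !permE.
- by exists (tperm (0 : 'I_3) 1); rewrite /code !permE.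
- exists (mulg (tperm (0 : 'I_3) 1) (tperm (0 : 'I_3) 2)).
  by rewrite /code !permM !(tpermL, tpermR, t01, t02).
- exists (mulg (tperm (0 : 'I_3) 2) (tperm (0 : 'I_3) 1)).
  by rewrite /code !permM !(tpermL, tpermR, t01, t02).
- by exists (tperm (0 : 'I_3) 2); rewrite /code !permE.
Qed.

(** The order is consistent with [permM], by which the product [t * s] applies [t] first. *)
Lemma permute_permute s t T : permute s (permute t T) = permute (t * s)%g T.
Proof.
have tE (i j k : 'I_5) (x : 'I_3) :
   tnth [tuple tnth [tuple i; j; k] (s 0); tnth [tuple i; j; k] (s 1);
     tnth [tuple i; j; k] (s 2)] x = tnth [tuple i; j; k] (s x).
  case: x => [[|[|[|//]]] p]; rewrite (tnth_nth i) /=; congr (tnth _ (s _)); exact/val_inj.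
by apply: tensorP => i j k; rewrite /permute !tE !permM.
Qed.

Lemma permute1 T : permute 1%g T = T.
Proof. by apply: tensorP => i j k; rewrite /permute !perm1. Qed.

Lemma permuteK s T : permute s^-1%g (permute s T) = T.
Proof. by rewrite permute_permute mulgV permute1. Qed.

Lemma tri_permn p T a b c : p \in perms6 ->
  tri (permn p T : tensor) a b c = tri T (sel p.1.1 a b c) (sel p.1.2 a b c) (sel p.2 a b c).
Proof.
move=> pP; symmetry.
apply: (tri_ext (F := fun a b c => tri T (sel p.1.1 a b c) (sel p.1.2 a b c) (sel p.2 a b c)));
move: pP; rewrite !inE => /or4P[/eqP->|/eqP->|/eqP->|/or3P[/eqP->|/eqP->|/eqP->]] *;
by rewrite /= ?(triP1, triP2, triP3, tri_dl).
Qed.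

Lemma permute_act s g1 g2 g3 T : exists h1 h2 h3,
  [/\ [\/ h1 = g1, h1 = g2 | h1 = g3], [\/ h2 = g1, h2 = g2 | h2 = g3],
      [\/ h3 = g1, h3 = g2 | h3 = g3] &
      permute s (act g1 g2 g3 T) = act h1 h2 h3 (permute s T)].
Proof.
have cP := code_perms6 s; rewrite !permuteE.
(* Slot 0 of [T] receives the index number x of the permuted tensor, so [g1] becomes the matrix of
   slot x, and likewise for [g2] and [g3]. *)
pose h n := let: (x, y, z) := code s in
  if x == n then g1 else if y == n then g2 else g3.
have hE n : [\/ h n = g1, h n = g2 | h n = g3].
  rewrite /h; case: (code s) => -[x y] z.
  by case: ifP => _; [apply: Or31 | case: ifP => _; [apply: Or32 | apply: Or33]].
exists (h 0%N), (h 1%N), (h 2%N); split => //; apply: tensorP => i j k.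
rewrite -[LHS]tri_dl -[RHS]tri_dl tri_permn// !tri_act tri_permn// /h.
by move: cP; rewrite !inE => /or4P[/eqP->|/eqP->|/eqP->|/or3P[/eqP->|/eqP->|/eqP->]].
Qed.

Lemma permute_orbit s T S : orbit T S -> orbit (permute s T) (permute s S).
Proof.
move=> [g1 [g2 [g3 [u1 u2 u3 ->]]]];
  have [h1 [h2 [h3 [e1 e2 e3 ->]]]] := permute_act s g1 g2 g3 T.
by exists h1, h2, h3; split => //; [case: e1 | case: e2 | case: e3] => ->.
Qed.

Lemma permute_degenerates s T S : degenerates T S -> degenerates (permute s T) (permute s S).
Proof.
apply: closureT_image => [i j k|W]; [exact: entry_continuous | exact: permute_orbit].
Qed.

Lemma degenerates_perm_refl T : degenerates_perm T T.
Proof. by exists 1%g; rewrite permute1; exact: degenerates_refl. Qed.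

Lemma degenerates_perm_trans T S S' :
  degenerates_perm T S -> degenerates_perm S S' -> degenerates_perm T S'.
Proof.
move=> [s TS] [t SS']; exists (s * t)%g; rewrite -permute_permute.
by apply: degenerates_trans SS'; apply: permute_degenerates.
Qed.

Lemma isomorphic_perm_degenerates T S : isomorphic_perm T S -> degenerates_perm T S.
Proof. by move=> [s TS]; exists s; exact: orbit_degenerates. Qed.

Lemma isomorphic_perm_sym T S : isomorphic_perm T S -> isomorphic_perm S T.
Proof.
move=> [s /orbit_sym TS]; exists s^-1%g; rewrite -[T](permuteK s); exact: permute_orbit.
Qed.

Lemma isomorphic_perm_refl T : isomorphic_perm T T.
Proof. by exists 1%g; rewrite permute1; exact: orbit_refl. Qed.

(* A one-parameter degeneration: the weight of the torus element [t] on the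
   entry (i, j, k) is [w1 i + w2 j + w3 k]. *)
Lemma toric_degeneration (D : C) (w1 w2 w3 : 'I_5 -> int) T S : D != 0 ->
    (forall i j k, let w := w1 i + w2 j + w3 k in
      [/\ w < 0 -> T i j k = 0, w = 0 -> T i j k = D * S i j k & w != 0 -> S i j k = 0]) ->
  degenerates T S.
Proof.
move=> D0 wP U /nbhs_ballP[e /= e0 eU].
pose M := 1 + \sum_i \sum_j \sum_k `|D^-1 * T i j k|.
have M_gt i j k : `|D^-1 * T i j k| < M.
  apply: (@le_lt_trans _ _ (\sum_i \sum_j \sum_k `|D^-1 * T i j k|)); last first.
    by rewrite /M ltrDr ltr01.
  rewrite (bigD1 i)//= (bigD1 j)//= (bigD1 k)//= -!addrA lerDl.
  by rewrite !addr_ge0// ?sumr_ge0// => *; rewrite ?sumr_ge0// => *; rewrite sumr_ge0.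
have M0 : 0 < M by apply: le_lt_trans (M_gt 0 0 0).
(* Then t is at most 1 and t * M < e: the entries of positive weight, bounded by t times an entry
   smaller than M, are closer to 0 than e. *)
pose t := e / (e + M).
have eM0 : 0 < e + M by rewrite addr_gt0.
have t0 : 0 < t by rewrite divr_gt0.
have t1 : t <= 1 by rewrite ler_pdivrMr// mul1r lerDl ltW.
have tn0 : t != 0 by rewrite gt_eqF.
pose dg (c : C) (w : 'I_5 -> int) : 'M[C]_5 := diag_mx (\row_i (c * t ^ w i)).
have dgu c w : c != 0 -> dg c w \in unitmx.
  move=> c0; rewrite unitmxE det_diag unitfE prodf_seq_neq0; apply/allP => i _ /=.
  by rewrite mxE mulf_neq0// expfz_neq0.
(* The scalar [D^-1] in the first factor makes the limit [S] itself and not [D] times [S]. *)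
exists (act (dg D^-1 w1) (dg 1 w2) (dg 1 w3) T); split.
  by exists (dg D^-1 w1), (dg 1 w2), (dg 1 w3); rewrite !dgu ?invr_eq0 ?oner_eq0.
apply: eU => i j k /=.
have dlE c w (l : 'I_5) : dl C l *m dg c w = (c * t ^ w l) *: dl C l.
  by rewrite -rowE row_diag_mx mxE.
have -> : act (dg D^-1 w1) (dg 1 w2) (dg 1 w3) T i j k =
    t ^ (w1 i + w2 j + w3 k) * (D^-1 * T i j k).
  rewrite -[LHS]tri_dl tri_act !dlE.
  have tri0 a b : tri T a b 0 = 0.
    by rewrite -[0 : 'rV_5]addr0 -{1}[0 : 'rV_5](scale0r (0 : 'rV_5)) triP3 mul0r add0r;
      rewrite /tri big1// => ? _; rewrite big1// => ? _; rewrite big1// => ? _;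
      rewrite mxE mulr0 mul0r.
  have trib0 a c : tri T a 0 c = 0.
    by rewrite /tri big1// => ? _; rewrite big1// => ? _; rewrite big1// => ? _;
      rewrite mxE mulr0 !mul0r.
  have tria0 b c : tri T 0 b c = 0.
    by rewrite /tri big1// => ? _; rewrite big1// => ? _; rewrite big1// => ? _;
      rewrite mxE !mul0r.
  rewrite -[_ *: dl C i]addr0 triP1 tria0 addr0 -[_ *: dl C j]addr0 triP2 trib0 addr0.
  rewrite -[_ *: dl C k]addr0 triP3 tri0 addr0 tri_dl !expfzDr//; ring.
have := wP i j k; set w := w1 i + _ + _ => -[wn w0 wp].
rewrite -ball_normE /=; case: (ltgtP w 0) => [w_lt0|w_gt0|w_eq0].
- by rewrite (wn w_lt0) (wp (ltr0_neq0 w_lt0)) !mulr0 subrr normr0.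
- rewrite (wp (lt0r_neq0 w_gt0)) sub0r normrN normrM.
  have tw : `|t ^ w| <= t.
    have t0' := ltW t0; case: w w_gt0 {wn w0 wp} => // -[//|n] _.
    by rewrite -exprnP ger0_norm ?exprn_ge0// exprS ler_piMr ?exprn_ge0 ?exprn_ile1.
  apply: le_lt_trans (ler_wpM2r (normr_ge0 _) tw) _.
  rewrite /t mulrAC ltr_pdivrMr// ltr_pM2l//.
  by apply: lt_trans (M_gt i j k) _; rewrite ltrDr.
by rewrite w_eq0 expr0z mul1r (w0 w_eq0) mulKf// subrr normr0.
Qed.

End Degeneration.

(** * Certificates of degeneration *)

Definition one4 : seq (bool * nat * nat) :=
  [:: (false, 1, 1); (false, 2, 2); (false, 3, 3); (false, 4, 4)]%N.
Definition one5 := rcons one4 (false, 5, 5)%N.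

(* [(b, r, c)] stands for [(-1) ^+ b *: E r c]. *)
Definition slices (u : label) : seq (seq (bool * nat * nat)) := (match u with
  | T1_1 => [:: one5; [:: (false, 2, 1); (false, 3, 2); (false, 4, 3); (false, 5, 4)];
    [:: (false, 3, 1); (false, 4, 2); (false, 5, 3)]; [:: (false, 4, 1); (false, 5, 2)];
    [:: (false, 5, 1)]]
  | T1_2 => [:: one5; [:: (false, 2, 1)]; [:: (false, 3, 1); (false, 4, 3); (false, 5, 4)];
    [:: (false, 4, 1); (false, 5, 3)]; [:: (false, 5, 1)]]
  | T1_3 => [:: one5; [:: (false, 2, 1); (false, 5, 2)]; [:: (false, 3, 1); (false, 4, 3);
    (false, 5, 4)]; [:: (false, 4, 1); (false, 5, 3)]; [:: (false, 5, 1)]]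
  | T1_4 => [:: one5; [:: (false, 2, 1); (false, 3, 2)]; [:: (false, 3, 1)]; [:: (false, 4, 1);
    (false, 5, 4)]; [:: (false, 5, 1)]]
  | T1_5 => [:: one5; [:: (false, 2, 1); (false, 5, 3)]; [:: (false, 3, 1); (false, 4, 3);
    (false, 5, 2)]; [:: (false, 4, 1)]; [:: (false, 5, 1)]]
  | T1_6 => [:: one5; [:: (false, 2, 1)]; [:: (false, 3, 1)]; [:: (false, 4, 1); (false, 5, 4)];
    [:: (false, 5, 1)]]
  | T1_7 => [:: one5; [:: (false, 2, 1)]; [:: (false, 3, 1); (false, 5, 4)]; [:: (false, 4, 1);
    (false, 5, 3)]; [:: (false, 5, 1)]]
  | T1_8 => [:: one5; [:: (false, 2, 1); (false, 5, 3)]; [:: (false, 3, 1); (false, 5, 2)];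
    [:: (false, 4, 1); (false, 5, 4)]; [:: (false, 5, 1)]]
  | T1_9 => [:: one5; [:: (false, 2, 1)]; [:: (false, 3, 1)]; [:: (false, 4, 1)]; [:: (false, 5,
    1)]]
  | T1_10 => [:: one5; [:: (false, 4, 2)]; [:: (false, 5, 2)]; [:: (false, 4, 3)]; [:: (false,
    5, 3)]]
  | T1_11 => [:: one5; [:: (false, 5, 1)]; [:: (false, 4, 1); (false, 5, 2)]; [:: (false, 4, 2);
    (false, 5, 3)]; [:: (false, 4, 3)]]
  | T1_12 => [:: one5; [:: (false, 4, 1); (false, 5, 3)]; [:: (false, 5, 1)]; [:: (false, 5,
    2)]; [:: (false, 4, 3)]]
  | T1_13 => [:: one5; [:: (false, 4, 1)]; [:: (false, 5, 1)]; [:: (false, 5, 2)]; [:: (false,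
    4, 3)]]
  | T1_14 => [:: one5; [:: (false, 4, 1)]; [:: (false, 5, 1)]; [:: (false, 5, 2)]; [:: (false,
    4, 2); (false, 5, 3)]]
  | T1_15 => [:: one5; [:: (false, 4, 1)]; [:: (false, 5, 1)]; [:: (false, 4, 2)]; [:: (false,
    4, 3)]]
  | T1_16 => [:: one5; [:: (false, 3, 1); (false, 5, 3)]; [:: (false, 5, 1)]; [:: (false, 4,
    1)]; [:: (false, 5, 2)]]
  | T1_17 => [:: one5; [:: (false, 3, 1); (false, 4, 2); (false, 5, 3)]; [:: (false, 5, 1)];
    [:: (false, 4, 1)]; [:: (false, 5, 2)]]
  | T1_18 => [:: one5; [:: (false, 3, 1); (false, 5, 3)]; [:: (false, 5, 1)]; [:: (false, 4,
    1)]; [:: (false, 4, 2)]]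
  | T1_19 => [:: one5; [:: (false, 3, 1); (false, 5, 3)]; [:: (false, 5, 1)]; [:: (false, 4, 1);
    (false, 5, 2)]; [:: (false, 4, 2)]]
  | T2_1 => [:: one5; [:: (false, 2, 1); (false, 3, 2)]; [:: (false, 3, 1)]; [:: (false, 5, 4)];
    [:: (false, 4, 4); (false, 5, 5)]]
  | T2_2 => [:: one5; [:: (false, 2, 1)]; [:: (false, 3, 1)]; [:: (false, 5, 4)]; [:: (false, 4,
    4); (false, 5, 5)]]
  | T2_3 => [:: one5; [:: (false, 2, 1); (false, 3, 2); (false, 4, 3)]; [:: (false, 3, 1);
    (false, 4, 2)]; [:: (false, 4, 1)]; [:: (false, 5, 5)]]
  | T2_4 => [:: one5; [:: (false, 2, 1)]; [:: (false, 3, 1); (false, 4, 3)]; [:: (false, 4, 1)];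
    [:: (false, 5, 5)]]
  | T2_5 => [:: one5; [:: (false, 2, 1); (false, 4, 3)]; [:: (false, 3, 1); (false, 4, 2)];
    [:: (false, 4, 1)]; [:: (false, 5, 5)]]
  | T2_6 => [:: one5; [:: (false, 2, 1)]; [:: (false, 3, 1)]; [:: (false, 4, 1)]; [:: (false, 5,
    5)]]
  | T2_7 => [:: one5; [:: (false, 3, 1); (true, 4, 2)]; [:: (false, 3, 2)]; [:: (false, 4, 1)];
    [:: (false, 5, 5)]]
  | T2_8 => [:: one5; [:: (false, 3, 1)]; [:: (false, 3, 2)]; [:: (false, 4, 1)]; [:: (false, 5,
    5)]]
  | T3_1 => [:: one5; [:: (false, 2, 1); (false, 3, 2)]; [:: (false, 3, 1)]; [:: (false, 4, 4)];
    [:: (false, 5, 5)]]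
  | T3_2 => [:: one5; [:: (false, 2, 1)]; [:: (false, 3, 1)]; [:: (false, 4, 4)]; [:: (false, 5,
    5)]]
  | T3_3 => [:: one5; [:: (false, 2, 1)]; [:: (false, 4, 3)]; [:: (false, 3, 3); (false, 4, 4)];
    [:: (false, 5, 5)]]
  | T4_1 => [:: one5; [:: (false, 2, 1)]; [:: (false, 3, 3)]; [:: (false, 4, 4)]; [:: (false, 5,
    5)]]
  | T5_1 => [:: one5; [:: (false, 2, 2)]; [:: (false, 3, 3)]; [:: (false, 4, 4)]; [:: (false, 5,
    5)]]
  | TO58 => [:: one4; [:: (false, 1, 3); (true, 2, 4)]; [:: (false, 1, 4)]; [:: (false, 2, 3)];
    [:: (false, 1, 5); (false, 2, 1); (true, 4, 3); (false, 5, 4)]]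
  | TO57 => [:: one4; [:: (false, 1, 3); (true, 2, 4)]; [:: (false, 1, 4)]; [:: (false, 2, 3)];
    [:: (false, 1, 5); (false, 5, 4)]]
  | TO56 => [:: one4; [:: (false, 1, 3)]; [:: (false, 1, 4)]; [:: (false, 2, 4)]; [:: (false, 1,
    5); (false, 2, 5); (false, 5, 4)]]
  | TO55 => [:: one4; [:: (false, 1, 3)]; [:: (false, 1, 4)]; [:: (false, 2, 4)]; [:: (false, 1,
    5); (false, 2, 3); (false, 5, 4)]]
  | TO54 => [:: one4; [:: (false, 1, 3)]; [:: (false, 1, 4)]; [:: (false, 2, 4)]; [:: (false, 1,
    5); (false, 5, 4)]]
  end)%N.

Definition zslice (l : seq (bool * nat * nat)) (i j : nat) : Z :=
  foldr (fun e z => (if (i.+1 == e.1.2) && (j.+1 == e.2)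
                     then (if e.1.1 then - 1 else 1) else 0) + z)%BZ 0%BZ l.

(** Nested lists are evaluated once and then only read. The nesting follows the order of the
    factors, namely slice, column, row, whereas [zslice] takes the row first. *)
Definition table (u : label) : seq (seq (seq Z)) :=
  [seq [seq [seq zslice (nth [::] (slices u) k) i j | i <- iota 0 5] | j <- iota 0 5]
  | k <- iota 0 5].

Definition lookup (t : seq (seq (seq Z))) : ztns :=
  fun i j k => nth 0%BZ (nth [::] (nth [::] t i) j) k.

Definition ztensor (u : label) : ztns := lookup (table u).

Definition zpermn (p : nat * nat * nat) (t : ztns) : ztns :=
  fun i j k => t (sel p.1.1 i j k) (sel p.1.2 i j k) (sel p.2 i j k).

Definition zsum (f : nat -> Z) : Z := (f 0%N + f 1%N + f 2%N + f 3%N + f 4%N)%BZ.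

Definition zentry2 (m : seq (seq Z)) (i j : nat) : Z := nth 0%BZ (nth [::] m i) j.

Definition zact (g1 g2 g3 : seq (seq Z)) (t : ztns) : ztns := fun i j k =>
  zsum (fun i' => zentry2 g1 i i' * zsum (fun j' => zentry2 g2 j j' *
    zsum (fun k' => zentry2 g3 k k' * t i' j' k')))%BZ.

Definition zunit (m : seq (seq Z)) : bool :=
  [&& size m == 5%N, all (fun r => size r == 5%N) m & rk 5%N m == 5%N].

Definition weight (w : seq Z * seq Z * seq Z) (i j k : nat) : Z :=
  (nth 0 w.1.1 i + nth 0 w.1.2 j + nth 0 w.2 k)%BZ.

(* Source, target, permutation, base changes, weights of the torus, and the factor
   by which the limit differs from the target. *)
Definition certificate : Type := label * label * (nat * nat * nat) *
  (seq (seq Z) * seq (seq Z) * seq (seq Z)) * (seq Z * seq Z * seq Z) * Z.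

Definition valid (c : certificate) : bool :=
  let: (u, v, p, (g1, g2, g3), w, D) := c in
  let t := lookup (table u) in let t' := lookup (table v) in
  [&& p \in perms6, zunit g1, zunit g2, zunit g3, ~~ Z.eqb D 0 &
    all (fun ijk : nat * nat * nat => let: (i, j, k) := ijk in
      let x := zact g1 g2 g3 (zpermn p t) i j k in
      match weight w i j k with
      | Z0 => Z.eqb x (D * t' i j k)
      | Zpos _ => Z.eqb (t' i j k) 0
      | Zneg _ => Z.eqb x 0 && Z.eqb (t' i j k) 0
      end) alltriples5].

Section ZTensors.
Variable R : realType.
Local Notation C := (Cplx R).
Local Notation act := (@Defs.act R).
Local Notation orbit := (@Defs.orbit R).

Lemma zK_if (b : bool) (x : Z) : zK C (if b then x else 0%BZ) = b%:R * zK C x.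
Proof. by case: b; rewrite ?mul1r ?mul0r ?zK0. Qed.

Lemma JE (i j : 'I_5) : @J R i j = zK C (zslice one4 i j).
Proof. by rewrite /J !mxE /= !zKD !zK_if zK1 zK0; ring. Qed.

Lemma scalar1E (i j : 'I_5) : (1%:M : 'M[C]_5) i j = zK C (zslice one5 i j).
Proof.
rewrite mxE /= !zKD !zK_if zK1 zK0 !mulr1 addr0 -!natrD; congr (_%:R).
by case: i => [[|[|[|[|[|//]]]]] ?]; case: j => [[|[|[|[|[|//]]]]] ?].
Qed.

Lemma ztensorE u (i j k : 'I_5) : ztensor u i j k = zslice (nth [::] (slices u) i) k j.
Proof.
rewrite /ztensor /lookup /table.
by do 3 (rewrite (nth_map 0%N) ?size_iota ?ltn_ord// nth_iota ?ltn_ord// add0n).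
Qed.

Lemma tensor_of_labelE u (i j k : 'I_5) :
  tensor_of_label R u i j k = zK C (ztensor u i j k).
Proof.
rewrite ztensorE.
case: u; rewrite /= /tensor_of (tnth_nth 0); case: i => [[|[|[|[|[|//]]]]] ?];
  rewrite [LHS]/= [nth _ _ _]/= ?(JE,
    scalar1E)// !mxE [zslice _ _ _]/= ?zKD ?zK_if ?zKN ?zK1 ?zK0; ring.
Qed.

End ZTensors.

Definition id5 : seq (seq Z) := [:: [:: 1; 0; 0; 0; 0]; [:: 0; 1; 0; 0; 0];
  [:: 0; 0; 1; 0; 0]; [:: 0; 0; 0; 1; 0]; [:: 0; 0; 0; 0; 1]]%BZ.

Definition certificates : seq certificate := [::
  (T1_1, T1_3, (0, 1, 2)%N, ([:: [:: 1; 0; 0; 0; 0]; [:: 1; (-1); 1; (-1); 1]; [:: 1; 1; 0; 0;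
    0]; [:: 1; 2; 1; 0; 0]; [:: 1; 3; 3; 1; 0]], [:: [:: 1; 0; 0; 0; 0]; [:: 1; (-1); 1; (-1);
    1]; [:: 1; 1; 0; 0; 0]; [:: 1; 2; 1; 0; 0]; [:: 1; 3; 3; 1; 0]], [:: [:: 1; (-1); 1; (-1);
    (-4)]; [:: 0; 0; 0; 0; 1]; [:: 0; 1; (-2); 3; 6]; [:: 0; 0; 1; (-3); (-4)]; [:: 0; 0; 0; 1;
    1]]), ([:: 0; 3; 2; 4; 6], [:: 0; 3; 2; 4; 6], [:: 0; (-3); (-2); (-4); (-6)]), 1);
  (T1_1, T1_11, (1, 0, 2)%N, ([:: [:: 1; 0; 0; 0; 0]; [:: 0; 0; 0; 0; 1]; [:: 0; 0; 0; 1; 0];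
    [:: 0; 0; 1; 0; 0]; [:: 0; 1; 0; 0; 0]], id5, id5), ([:: 0; (-2); (-1); 0; 1], [:: 0; (-1);
    (-2); (-1); (-2)], [:: 0; 1; 2; 1; 2]), 1);
  (T1_1, TO58, (0, 1, 2)%N, ([:: [:: 1; 0; 0; 0; 0]; [:: 0; 0; 0; 1; 0]; [:: 0; 0; 1; 0; 0];
    [:: 0; 0; 0; 0; (-1)]; [:: 0; (-1); 0; 0; 0]], [:: [:: 0; 0; 0; 1; 0]; [:: 0; 0; 0; 0;
    (-1)]; [:: 1; 0; 0; 0; 0]; [:: 0; 1; 0; 0; 0]; [:: 0; 0; (-1); 0; 0]], [:: [:: 0; 0; 0; 1;
    0]; [:: 0; 0; 0; 0; (-1)]; [:: 1; 0; 0; 0; 0]; [:: 0; 1; 0; 0; 0]; [:: 0; 0; (-1); 0; 0]]),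
    ([:: 0; (-1); 4; (-6); (-5)], [:: 0; (-5); 1; (-4); 5], [:: 0; 5; (-1); 4; 9]), 1);
  (T1_2, T1_5, (0, 1, 2)%N, ([:: [:: 1; 0; 0; 0; 0]; [:: 0; (-1); 0; 1; 0]; [:: 0; 0; 1; 0; 0];
    [:: 0; 1; 0; 0; 0]; [:: 0; 0; 0; 0; 1]], [:: [:: 1; 0; 0; 0; 0]; [:: 0; (-1); 0; 1; 0];
    [:: 0; 0; 1; 0; 0]; [:: 0; 1; 0; 0; 0]; [:: 0; 0; 0; 0; 1]], [:: [:: 1; 0; 0; 0; 0]; [:: 0;
    0; 0; 1; 0]; [:: 0; 0; 1; 0; 0]; [:: 0; 1; 0; 1; 0]; [:: 0; 0; 0; 0; 1]]), ([:: 0; 1; 6; 12;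
    7], [:: 0; 1; 6; 12; 7], [:: 0; (-1); (-6); (-12); (-7)]), 1);
  (T1_2, T1_12, (0, 2, 1)%N, ([:: [:: 1; 0; 0; 0; 0]; [:: 0; 0; 0; 1; 0]; [:: 0; 0; 0; 0; 1];
    [:: 0; 1; 0; 0; 0]; [:: 0; 0; 1; 0; 0]], [:: [:: 0; 0; 0; 0; 1]; [:: 0; 1; 0; 0; 0]; [:: 0;
    0; 0; 1; 0]; [:: 0; 0; 1; 0; 0]; [:: 1; 0; 0; 0; 0]], [:: [:: 0; 0; 0; 0; 1]; [:: 0; 1; 0;
    0; 0]; [:: 0; 0; 0; 1; 0]; [:: 0; 0; 1; 0; 0]; [:: 1; 0; 0; 0; 0]]), ([:: 0; 0; (-1); (-1);
    1], [:: 0; 0; (-1); 0; (-1)], [:: 0; 0; 1; 0; 1]), 1);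
  (T1_2, T1_18, (0, 2, 1)%N, ([:: [:: 1; 0; 0; 0; 0]; [:: 0; 0; 1; 0; 0]; [:: 0; 0; 0; 1; 0];
    [:: 0; 0; 0; 0; 1]; [:: 0; 1; 0; 0; 0]], [:: [:: 0; 0; 0; 0; 1]; [:: 0; 1; 0; 0; 0]; [:: 0;
    0; 0; 1; 0]; [:: 1; 0; 0; 0; 0]; [:: 1; 0; 1; 0; 0]], [:: [:: 0; 0; 0; 0; 1]; [:: 0; 1; 0;
    0; 0]; [:: 0; 0; 0; 1; 0]; [:: 1; 0; 0; 0; 0]; [:: 0; 0; 1; 0; 0]]), ([:: 0; 0; 0; (-1);
    (-2)], [:: 0; 1; 0; (-1); 0], [:: 0; (-1); 0; 1; 0]), 1);
  (T1_2, TO57, (1, 2, 0)%N, ([:: [:: 0; 0; 0; 0; 1]; [:: 0; 0; 1; 0; 0]; [:: 1; 0; 0; 0; 0];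
    [:: 0; 0; 0; (-1); 0]; [:: 0; 1; 0; 0; 0]], [:: [:: 0; 0; 0; 0; 1]; [:: 0; 0; 0; (-1); 0];
    [:: 0; 0; 1; 0; 0]; [:: 1; 0; 0; 0; 0]; [:: 0; 1; 0; 0; 0]], [:: [:: 1; 0; 0; 0; 0]; [:: 0;
    0; (-1); 0; 0]; [:: 0; 0; 0; 1; 0]; [:: 0; 0; 0; 0; 1]; [:: 0; 1; 0; 0; 0]]), ([:: 0; 0;
    (-3); 3; (-1)], [:: 0; 3; 0; 3; 1], [:: 0; (-3); 0; (-3); (-2)]), 1);
  (T1_3, T1_2, (0, 1, 2)%N, (id5, id5, id5), ([:: 0; 0; (-1); (-2); (-3)], [:: 0; 0; (-1); (-2);
    (-3)], [:: 0; 0; 1; 2; 3]), 1);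
  (T1_3, T1_4, (0, 1, 2)%N, ([:: [:: 1; 0; 0; 0; 0]; [:: 0; 1; 0; 0; 0]; [:: 0; 0; 0; 0; 1];
    [:: 0; 0; 1; 0; 0]; [:: 0; 0; 0; 1; 0]], [:: [:: 1; 0; 0; 0; 0]; [:: 0; 1; 0; 0; 0]; [:: 0;
    0; 0; 0; 1]; [:: 0; 0; 1; 0; 0]; [:: 0; 0; 0; 1; 0]], [:: [:: 1; 0; 0; 0; 0]; [:: 0; 1; 0;
    0; 0]; [:: 0; 0; 0; 0; 1]; [:: 0; 0; 1; 0; 0]; [:: 0; 0; 0; 1; 0]]), ([:: 0; (-1); (-2); 0;
    0], [:: 0; (-1); (-2); 0; 0], [:: 0; 1; 2; 0; 0]), 1);
  (T1_3, T1_8, (0, 1, 2)%N, ([:: [:: 1; 0; 0; 0; 0]; [:: 0; 0; 1; 0; 0]; [:: 0; 0; 0; 1; 0];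
    [:: 0; 1; 0; 0; 0]; [:: 0; 0; 0; 0; 1]], [:: [:: 1; 0; 0; 0; 0]; [:: 0; 0; 1; 0; 0]; [:: 0;
    0; 0; 1; 0]; [:: 0; 1; 0; 0; 0]; [:: 0; 0; 0; 0; 1]], [:: [:: 1; 0; 0; 0; 0]; [:: 0; 0; 1;
    0; 0]; [:: 0; 0; 0; 1; 0]; [:: 0; 1; 0; 0; 0]; [:: 0; 0; 0; 0; 1]]), ([:: 0; 0; (-2); (-1);
    (-2)], [:: 0; 0; (-2); (-1); (-2)], [:: 0; 0; 2; 1; 2]), 1);
  (T1_3, T1_19, (0, 1, 2)%N, ([:: [:: 1; 0; 0; 0; 0]; [:: 0; 1; 0; 0; 0]; [:: 0; 0; 0; 0; 1];
    [:: 0; 0; 0; 1; 0]; [:: 0; 0; 1; 0; 0]], [:: [:: 1; 0; 0; 0; 0]; [:: 0; 0; 1; 0; 0]; [:: 0;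
    1; 0; 0; 0]; [:: 0; 0; 0; 1; 0]; [:: 0; 0; 0; 0; 1]], [:: [:: 1; 0; 0; 0; 0]; [:: 0; 0; 1;
    0; 0]; [:: 0; 1; 0; 0; 0]; [:: 0; 0; 0; 1; 0]; [:: 0; 0; 0; 0; 1]]), ([:: 0; (-1); (-2);
    (-1); 0], [:: 0; (-1); (-1); (-1); (-2)], [:: 0; 1; 1; 1; 2]), 1);
  (T1_4, T1_5, (0, 1, 2)%N, ([:: [:: 1; 0; 0; 0; 0]; [:: 0; 1; 0; (-1); 0]; [:: 0; 1; 0; 1; 0];
    [:: 0; 0; 1; 0; 1]; [:: 0; 0; 1; 0; (-1)]], [:: [:: 1; 0; 0; 0; 0]; [:: 0; 1; 0; (-1); 0];
    [:: 0; 1; 0; 1; 0]; [:: 0; 0; 1; 0; 1]; [:: 0; 0; 1; 0; (-1)]], [:: [:: 2; 0; 0; 0; 0];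
    [:: 0; 1; 0; (-1); 0]; [:: 0; 1; 0; 1; 0]; [:: 0; 0; 1; 0; 1]; [:: 0; 0; 1; 0; (-1)]]),
    ([:: 0; 1; (-1); (-2); 0], [:: 0; 1; (-1); (-2); 0], [:: 0; (-1); 1; 2; 0]), 2);
  (T1_4, T1_18, (0, 1, 2)%N, ([:: [:: 1; 0; 0; 0; 0]; [:: 0; 0; 0; 1; 0]; [:: 0; 0; 0; 0; 1];
    [:: 0; 0; 1; 0; 0]; [:: 0; 1; 0; 0; 0]], [:: [:: 1; 0; 0; 0; 0]; [:: 0; 1; 0; 0; 0]; [:: 0;
    0; 0; 1; 0]; [:: 0; 0; 1; 0; 0]; [:: 0; 0; 0; 0; 1]], [:: [:: 1; 0; 0; 0; 0]; [:: 0; 1; 0;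
    0; 0]; [:: 0; 0; 0; 1; 0]; [:: 0; 0; 1; 0; 0]; [:: 0; 0; 0; 0; 1]]), ([:: 0; (-1); (-2);
    (-4); 0], [:: 0; (-4); (-1); (-4); (-2)], [:: 0; 4; 1; 4; 2]), 1);
  (T1_5, T1_7, (0, 1, 2)%N, ([:: [:: 1; 0; 0; 0; 0]; [:: 0; 0; 0; 1; 0]; [:: 0; 1; 0; 0; 0];
    [:: 0; 0; 1; 0; 0]; [:: 0; 0; 0; 0; 1]], [:: [:: 1; 0; 0; 0; 0]; [:: 0; 0; 0; 1; 0]; [:: 0;
    1; 0; 0; 0]; [:: 0; 0; 1; 0; 0]; [:: 0; 0; 0; 0; 1]], [:: [:: 1; 0; 0; 0; 0]; [:: 0; 0; 0;
    1; 0]; [:: 0; 1; 0; 0; 0]; [:: 0; 0; 1; 0; 0]; [:: 0; 0; 0; 0; 1]]), ([:: 0; (-4); (-1); 0;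
    (-1)], [:: 0; (-4); (-1); 0; (-1)], [:: 0; 4; 1; 0; 1]), 1);
  (T1_5, T1_17, (0, 2, 1)%N, ([:: [:: 1; 0; 0; 0; 0]; [:: 0; 1; 1; 0; 0]; [:: 0; 0; 0; 0; 1];
    [:: 0; 1; 0; 0; 0]; [:: 0; 0; 0; 1; 1]], [:: [:: 0; 0; 0; (-1); 1]; [:: 0; 0; 0; 1; 0];
    [:: 0; 1; 0; 0; 0]; [:: 0; 0; 1; 0; 0]; [:: 1; 0; 0; 0; 0]], [:: [:: 0; 0; 0; 0; 1]; [:: 0;
    0; 0; 1; 1]; [:: 0; 1; 0; 0; 0]; [:: 0; 0; 1; 1; 1]; [:: 1; 0; 0; 0; 0]]), ([:: 0; (-2);
    (-4); (-1); (-5)], [:: 0; 1; (-2); (-1); (-4)], [:: 0; (-1); 2; 1; 4]), 1);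
  (T1_6, T1_15, (0, 2, 1)%N, ([:: [:: 1; 0; 0; 0; 0]; [:: 0; 0; 0; 0; 1]; [:: 0; 0; 0; 1; 0];
    [:: 0; 1; 0; 0; 0]; [:: 0; 0; 1; 0; 0]], [:: [:: 0; 0; 0; 0; 1]; [:: 0; 1; 0; 0; 0]; [:: 0;
    0; 1; 0; 0]; [:: 1; 0; 0; 0; 0]; [:: 0; 0; 0; 1; 0]], [:: [:: 0; 0; 0; 0; 1]; [:: 0; 1; 0;
    0; 0]; [:: 0; 0; 1; 0; 0]; [:: 1; 0; 0; 0; 0]; [:: 0; 0; 0; 1; 0]]), ([:: 0; (-1); 4; (-3);
    (-3)], [:: 0; 2; 2; (-1); 4], [:: 0; (-2); (-2); 1; (-4)]), 1);
  (T1_6, T1_9, (0, 1, 2)%N, (id5, id5, id5), ([:: 0; (-2); (-1); 1; 0], [:: 0; (-2); (-1); 1;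
    0], [:: 0; 2; 1; (-1); 0]), 1);
  (T1_7, T1_6, (0, 1, 2)%N, ([:: [:: 1; 0; 0; 0; 0]; [:: 0; 0; 1; (-1); 0]; [:: 0; 1; 0; 0; 0];
    [:: 0; 0; 1; 1; 0]; [:: 0; 0; 0; 0; 2]], [:: [:: 1; 0; 0; 0; 0]; [:: 0; 0; 1; (-1); 0];
    [:: 0; 1; 0; 0; 0]; [:: 0; 0; 1; 1; 0]; [:: 0; 0; 0; 0; 2]], [:: [:: 2; 0; 0; 0; 0]; [:: 0;
    0; 1; (-1); 0]; [:: 0; 2; 0; 0; 0]; [:: 0; 0; 1; 1; 0]; [:: 0; 0; 0; 0; 1]]), ([:: 0; 3; 2;
    1; 2], [:: 0; 3; 2; 1; 2], [:: 0; (-3); (-2); (-1); (-2)]), 2);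
  (T1_7, T1_16, (0, 1, 2)%N, ([:: [:: 1; 0; 0; 0; 0]; [:: 0; 0; 1; 1; 0]; [:: 0; 0; 0; 0; 2];
    [:: 0; 1; 0; 0; 0]; [:: 0; 0; 1; (-1); 0]], [:: [:: 1; 0; 0; 0; 0]; [:: 0; 0; (-1); 1; 0];
    [:: 0; 0; 1; 1; 0]; [:: 0; 1; 0; 0; 0]; [:: 0; 0; 0; 0; 2]], [:: [:: 2; 0; 0; 0; 0]; [:: 0;
    0; (-1); 1; 0]; [:: 0; 0; 1; 1; 0]; [:: 0; 2; 0; 0; 0]; [:: 0; 0; 0; 0; 1]]), ([:: 0; (-1);
    (-2); (-2); 1], [:: 0; (-3); (-1); (-2); (-2)], [:: 0; 3; 1; 2; 2]), 2);
  (T1_8, T1_7, (0, 1, 2)%N, ([:: [:: 1; 0; 0; 0; 0]; [:: 0; 0; 0; 1; 0]; [:: 0; 1; 0; 0; 0];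
    [:: 0; 0; 1; 0; 0]; [:: 0; 0; 0; 0; 1]], [:: [:: 1; 0; 0; 0; 0]; [:: 0; 0; 0; 1; 0]; [:: 0;
    1; 0; 0; 0]; [:: 0; 0; 1; 0; 0]; [:: 0; 0; 0; 0; 1]], [:: [:: 1; 0; 0; 0; 0]; [:: 0; 0; 0;
    1; 0]; [:: 0; 1; 0; 0; 0]; [:: 0; 0; 1; 0; 0]; [:: 0; 0; 0; 0; 1]]), ([:: 0; (-1); (-3);
    (-2); (-5)], [:: 0; (-1); (-3); (-2); (-5)], [:: 0; 1; 3; 2; 5]), 1);
  (T1_11, T1_12, (0, 1, 2)%N, ([:: [:: 1; 0; 0; 0; 0]; [:: 0; 0; 0; 1; 0]; [:: 0; 0; 1; 0; 0];
    [:: 0; 1; 0; 0; 0]; [:: 0; 0; 0; 0; 1]], [:: [:: 0; 1; 0; 0; 0]; [:: 1; 0; 0; 0; 0]; [:: 0;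
    0; 1; 0; 0]; [:: 0; 0; 0; 1; 0]; [:: 0; 0; 0; 0; 1]], [:: [:: 0; 1; 0; 0; 0]; [:: 1; 0; 0;
    0; 0]; [:: 0; 0; 1; 0; 0]; [:: 0; 0; 0; 1; 0]; [:: 0; 0; 0; 0; 1]]), ([:: 0; 1; 3; 2; (-1)],
    [:: 0; 1; 2; 1; 3], [:: 0; (-1); (-2); (-1); (-3)]), 1);
  (T1_12, T1_13, (0, 1, 2)%N, (id5, id5, id5), ([:: 0; 1; 0; (-4); (-4)], [:: 0; 4; 5; 1; 0],
    [:: 0; (-4); (-5); (-1); 0]), 1);
  (T1_13, T1_14, (0, 1, 2)%N, ([:: [:: 1; 0; 0; 0; 0]; [:: 0; 1; (-1); 0; 0]; [:: 0; 0; 1; 0;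
    0]; [:: 0; 0; 0; 1; 0]; [:: 0; 0; 0; (-1); 1]], [:: [:: 1; 0; 0; 0; 0]; [:: 0; 1; 1; 0; 0];
    [:: 0; 0; 1; 0; 0]; [:: 0; 0; 0; 1; (-1)]; [:: 0; 0; 0; 0; 1]], [:: [:: 1; 0; 0; 0; 0];
    [:: 0; 1; 0; 0; 0]; [:: 0; (-1); 1; 0; 0]; [:: 0; 0; 0; 1; 0]; [:: 0; 0; 0; 1; 1]]), ([:: 0;
    (-1); 1; 3; 1], [:: 0; (-2); 0; (-1); 1], [:: 0; 2; 0; 1; (-1)]), 1);
  (T1_14, T1_15, (0, 1, 2)%N, ([:: [:: 1; 0; 0; 0; 0]; [:: 0; 0; 1; 0; 0]; [:: 0; 1; 0; 0; 0];
    [:: 0; 0; 0; 0; 1]; [:: 0; 0; 0; 1; 0]], [:: [:: 1; 0; 0; 0; 0]; [:: 0; 0; 1; 0; 0]; [:: 0;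
    1; 0; 0; 0]; [:: 0; 0; 0; 0; 1]; [:: 0; 0; 0; 1; 0]], [:: [:: 1; 0; 0; 0; 0]; [:: 0; 0; 1;
    0; 0]; [:: 0; 1; 0; 0; 0]; [:: 0; 0; 0; 0; 1]; [:: 0; 0; 0; 1; 0]]), ([:: 0; (-4); (-4); 0;
    (-3)], [:: 0; (-4); (-1); (-4); (-4)], [:: 0; 4; 1; 4; 4]), 1);
  (T1_14, T1_10, (0, 2, 1)%N, ([:: [:: 1; 0; 0; 0; 0]; [:: 0; 0; 1; 0; 0]; [:: 0; 0; 0; 1; 0];
    [:: 0; 1; 0; 0; 0]; [:: 0; 0; 0; 0; 1]], [:: [:: 0; 0; 1; 0; 0]; [:: 0; 0; 0; 0; 1]; [:: 0;
    0; 0; 1; 0]; [:: 1; 0; 0; 0; 0]; [:: 0; 1; 0; 0; 0]], [:: [:: 0; 0; 1; 0; 0]; [:: 0; 0; 0;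
    0; 1]; [:: 0; 0; 0; 1; 0]; [:: 1; 0; 0; 0; 0]; [:: 0; 1; 0; 0; 0]]), ([:: 0; (-6); (-5);
    (-3); (-2)], [:: 0; 5; 2; (-1); 0], [:: 0; (-5); (-2); 1; 0]), 1);
  (T1_16, T1_15, (0, 1, 2)%N, ([:: [:: 1; 0; 0; 0; 0]; [:: 0; 0; 1; 0; 0]; [:: 0; 0; 0; 1; 0];
    [:: 0; 1; 0; 0; 0]; [:: 0; 0; 0; 0; 1]], [:: [:: 1; 0; 0; 0; 0]; [:: 0; 0; 1; 0; 0]; [:: 0;
    1; 0; 0; 0]; [:: 0; 0; 0; 0; 1]; [:: 0; 0; 0; 1; 0]], [:: [:: 1; 0; 0; 0; 0]; [:: 0; 0; 1;
    0; 0]; [:: 0; 1; 0; 0; 0]; [:: 0; 0; 0; 0; 1]; [:: 0; 0; 0; 1; 0]]), ([:: 0; 0; (-6); 5; 4],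
    [:: 0; (-5); (-4); 0; (-6)], [:: 0; 5; 4; 0; 6]), 1);
  (T1_16, TO54, (1, 0, 2)%N, ([:: [:: 1; 0; 0; 0; 0]; [:: 0; 0; 1; 0; 0]; [:: 0; 0; 0; 0; 1];
    [:: 0; 0; 0; 1; 0]; [:: 0; 1; 0; 0; 0]], [:: [:: 0; 0; 1; 0; 0]; [:: 0; 0; 0; 1; 0]; [:: 0;
    1; 0; 0; 0]; [:: 1; 0; 0; 0; 0]; [:: 0; 0; 0; 0; 1]], [:: [:: 0; 0; 0; 0; 1]; [:: 0; 0; 0;
    1; 0]; [:: 0; 0; 1; 0; 0]; [:: 1; 0; 0; 0; 0]; [:: 0; 1; 0; 0; 0]]), ([:: 0; 1; (-1); (-4);
    (-2)], [:: 0; (-3); (-1); 1; 2], [:: 0; 3; 1; (-1); 1]), 1);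
  (T1_17, T1_16, (0, 1, 2)%N, (id5, id5, id5), ([:: 0; 2; 4; 1; 4], [:: 0; 0; 2; 1; 4], [:: 0;
    0; (-2); (-1); (-4)]), 1);
  (T1_17, T1_14, (0, 1, 2)%N, ([:: [:: 1; 0; 0; 0; 0]; [:: 0; 0; 0; 1; 0]; [:: 0; 0; 1; 0; 0];
    [:: 0; 0; 0; 0; 1]; [:: 0; 1; 0; 0; 0]], id5, id5), ([:: 0; (-6); (-1); 6; 1], [:: 0; (-7);
    (-2); (-6); (-1)], [:: 0; 7; 2; 6; 1]), 1);
  (T1_17, TO55, (2, 0, 1)%N, ([:: [:: 1; 0; 0; 0; 0]; [:: 0; 0; 0; 1; 0]; [:: 0; 0; 0; 0; 1];
    [:: 0; 0; 1; 0; 0]; [:: 0; 1; 0; 0; 0]], [:: [:: 1; 0; 0; 0; 0]; [:: 0; 0; 1; 0; 0]; [:: 0;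
    0; 0; 1; 0]; [:: 0; 0; 0; 0; 1]; [:: 0; 1; 0; 0; 0]], [:: [:: 1; 0; 0; 0; 0]; [:: 0; 1; 0;
    0; 0]; [:: 0; 0; 0; 1; 0]; [:: 0; 0; 1; 0; 0]; [:: 0; 0; 0; 0; 1]]), ([:: 0; (-2); (-3);
    (-1); 0], [:: 0; 2; 2; 3; 0], [:: 0; (-2); (-2); (-3); (-3)]), 1);
  (T1_18, T1_17, (0, 1, 2)%N, ([:: [:: 1; 0; 0; 0; 0]; [:: 0; 1; 0; 0; (-1)]; [:: 0; 0; 0; 1;
    0]; [:: 0; 0; 1; (-1); 0]; [:: 0; 0; 0; 0; 1]], [:: [:: 1; 0; 0; 0; 0]; [:: 0; 1; 1; 0; 0];
    [:: 0; 0; 1; 0; 0]; [:: 0; 0; 0; (-1); 1]; [:: 0; 0; 0; 1; 0]], [:: [:: 1; 0; 0; 0; 0];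
    [:: 0; 1; 0; 0; 0]; [:: 0; (-1); 1; 0; 0]; [:: 0; 0; 0; 0; 1]; [:: 0; 0; 0; 1; 1]]), ([:: 0;
    1; 2; 0; 3], [:: 0; (-1); 1; 0; 2], [:: 0; 1; (-1); 0; (-2)]), 1);
  (T1_18, T1_13, (0, 1, 2)%N, ([:: [:: 1; 0; 0; 0; 0]; [:: 0; 0; 1; 0; 0]; [:: 0; 0; 0; 1; 0];
    [:: 0; 0; 0; 0; 1]; [:: 0; 1; 0; 0; 0]], [:: [:: 1; 0; 0; 0; 0]; [:: 0; 1; 0; 0; 0]; [:: 0;
    0; 1; 0; 0]; [:: 0; 0; 0; 0; 1]; [:: 0; 0; 0; 1; 0]], [:: [:: 1; 0; 0; 0; 0]; [:: 0; 1; 0;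
    0; 0]; [:: 0; 0; 1; 0; 0]; [:: 0; 0; 0; 0; 1]; [:: 0; 0; 0; 1; 0]]), ([:: 0; (-3); 2; 4;
    (-1)], [:: 0; (-2); (-2); (-3); 2], [:: 0; 2; 2; 3; (-2)]), 1);
  (T1_18, TO56, (1, 0, 2)%N, ([:: [:: 1; 0; 0; 0; 0]; [:: 0; 0; 1; 0; 0]; [:: 0; 0; 0; 0; 1];
    [:: 0; 0; 0; 1; (-1)]; [:: 0; 1; 0; 0; 0]], [:: [:: 0; 0; 1; 0; 0]; [:: 0; 0; (-1); 1; 0];
    [:: 0; 1; 0; 0; 0]; [:: 1; 0; 0; 0; 0]; [:: 0; 0; 0; 0; 1]], [:: [:: 0; 0; 0; 1; 1]; [:: 0;
    0; 0; 1; 0]; [:: 0; 0; 1; 0; 0]; [:: 1; 0; 0; 0; 0]; [:: 0; 1; 0; 0; 0]]), ([:: 0; 0; (-2);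
    (-2); (-3)], [:: 0; 0; 0; 2; 3], [:: 0; 0; 0; (-2); 1]), 1);
  (T1_19, T1_18, (0, 1, 2)%N, (id5, id5, id5), ([:: 0; 2; 4; 5; 4], [:: 0; 1; 2; 5; 4], [:: 0;
    (-1); (-2); (-5); (-4)]), 1);
  (T1_19, T1_12, (0, 1, 2)%N, ([:: [:: 1; 0; 0; 0; 0]; [:: 0; 0; 0; 1; 0]; [:: 0; 0; 1; 0; 0];
    [:: 0; 1; 0; 0; 0]; [:: 0; 0; 0; 0; 1]], [:: [:: 1; 0; 0; 0; 0]; [:: 0; 0; 1; 0; 0]; [:: 0;
    1; 0; 0; 0]; [:: 0; 0; 0; 1; 0]; [:: 0; 0; 0; 0; 1]], [:: [:: 1; 0; 0; 0; 0]; [:: 0; 0; 1;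
    0; 0]; [:: 0; 1; 0; 0; 0]; [:: 0; 0; 0; 1; 0]; [:: 0; 0; 0; 0; 1]]), ([:: 0; (-2); (-4);
    (-1); 0], [:: 0; (-3); (-2); (-2); (-4)], [:: 0; 3; 2; 2; 4]), 1);
  (T1_19, TO57, (0, 1, 2)%N, ([:: [:: 1; 0; 0; 0; 0]; [:: 0; 0; 0; 1; 0]; [:: 0; 0; 1; 0; 0];
    [:: 0; 0; 0; 0; (-1)]; [:: 0; 1; 0; 0; 0]], [:: [:: 0; 0; 0; 0; 1]; [:: 0; 0; 0; (-1); 0];
    [:: 0; 1; 0; 0; 0]; [:: 1; 0; 0; 0; 0]; [:: 0; 0; 1; 0; 0]], [:: [:: 0; 0; 0; 0; 1]; [:: 0;
    0; 0; (-1); 0]; [:: 0; 1; 0; 0; 0]; [:: 1; 0; 0; 0; 0]; [:: 0; 0; 1; 0; 0]]), ([:: 0; 0; 3;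
    (-3); 1], [:: 0; (-3); 0; (-3); (-1)], [:: 0; 3; 0; 3; 2]), 1);
  (T2_1, T1_1, (0, 1, 2)%N, ([:: [:: 1; 0; 0; 0; 0]; [:: 0; 1; 0; 1; 1]; [:: 0; 0; 1; 2; 1];
    [:: 0; 0; 0; 3; 1]; [:: 0; 0; 0; 4; 1]], [:: [:: 1; 0; 0; 1; 0]; [:: 0; 1; 0; 1; 1]; [:: 0;
    0; 1; 1; 2]; [:: 0; 0; 0; 1; 3]; [:: 0; 0; 0; 1; 4]], [:: [:: 1; 0; 0; 0; 0]; [:: 0; 1; 0;
    0; 0]; [:: 0; 0; 1; 0; 0]; [:: (-4); (-3); (-2); 4; (-1)]; [:: 3; 2; 1; (-3); 1]]), ([:: 0;
    1; 2; 3; 4], [:: 0; 1; 2; 3; 4], [:: 0; (-1); (-2); (-3); (-4)]), 1);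
  (T2_1, T2_2, (0, 1, 2)%N, (id5, id5, id5), ([:: 0; 1; 0; (-3); 0], [:: 0; 1; 0; (-1); (-4)],
    [:: 0; (-1); 0; 1; 4]), 1);
  (T2_2, T1_2, (0, 1, 2)%N, ([:: [:: 1; 0; 0; 0; 0]; [:: 0; 1; 0; 0; 0]; [:: 0; 0; 1; 1; 1];
    [:: 0; 0; 0; 2; 1]; [:: 0; 0; 0; 3; 1]], [:: [:: 1; 0; 0; 1; 0]; [:: 0; 1; 0; 0; 0]; [:: 0;
    0; 1; 1; 1]; [:: 0; 0; 0; 1; 2]; [:: 0; 0; 0; 1; 3]], [:: [:: 1; 0; 0; 0; 0]; [:: 0; 1; 0;
    0; 0]; [:: 0; 0; 1; 0; 0]; [:: (-3); 0; (-2); 3; (-1)]; [:: 2; 0; 1; (-2); 1]]), ([:: 0; 5;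
    2; 4; 6], [:: 0; 5; 2; 4; 6], [:: 0; (-5); (-2); (-4); (-6)]), 1);
  (T2_3, T2_5, (0, 1, 2)%N, ([:: [:: 1; 0; 0; 0; 0]; [:: 0; 0; 1; 0; 0]; [:: 0; 1; 0; 0; 0];
    [:: 0; 0; 0; 1; 0]; [:: 0; 0; 0; 0; 1]], [:: [:: 1; 0; 0; 0; 0]; [:: 0; 0; 1; 0; 0]; [:: 0;
    1; 0; 0; 0]; [:: 0; 0; 0; 1; 0]; [:: 0; 0; 0; 0; 1]], [:: [:: 1; 0; 0; 0; 0]; [:: 0; 0; 1;
    0; 0]; [:: 0; 1; 0; 0; 0]; [:: 0; 0; 0; 1; 0]; [:: 0; 0; 0; 0; 1]]), ([:: 0; (-5); (-2);
    (-7); 0], [:: 0; (-5); (-2); (-7); (-2)], [:: 0; 5; 2; 7; 2]), 1);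
  (T2_3, T1_1, (0, 1, 2)%N, ([:: [:: 1; 0; 0; 0; 0]; [:: 0; 1; 0; 0; 1]; [:: 0; 0; 1; 0; 1];
    [:: 0; 0; 0; 1; 1]; [:: 0; 0; 0; 0; 1]], [:: [:: 1; 0; 0; 0; 1]; [:: 0; 1; 0; 0; 1]; [:: 0;
    0; 1; 0; 1]; [:: 0; 0; 0; 1; 1]; [:: 0; 0; 0; 0; 1]], [:: [:: 1; 0; 0; 0; 0]; [:: 0; 1; 0;
    0; 0]; [:: 0; 0; 1; 0; 0]; [:: 0; 0; 0; 1; 0]; [:: (-1); (-1); (-1); (-1); 1]]), ([:: 0; 1;
    2; 3; 4], [:: 0; 1; 2; 3; 4], [:: 0; (-1); (-2); (-3); (-4)]), 1);
  (T2_3, T2_7, (0, 1, 2)%N, ([:: [:: 1; 0; 0; 0; 0]; [:: 0; 0; 1; 0; 0]; [:: 0; (-1); 0; 0; 0];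
    [:: 0; 0; 0; 1; 0]; [:: 0; 0; 0; 0; 1]], [:: [:: 1; 0; 0; 0; 0]; [:: 0; (-1); 0; 0; 0];
    [:: 0; 0; 1; 0; 0]; [:: 0; 0; 0; 1; 0]; [:: 0; 0; 0; 0; 1]], [:: [:: 1; 0; 0; 0; 0]; [:: 0;
    (-1); 0; 0; 0]; [:: 0; 0; 1; 0; 0]; [:: 0; 0; 0; 1; 0]; [:: 0; 0; 0; 0; 1]]), ([:: 0; 0; 3;
    (-3); 0], [:: 0; (-3); 0; (-3); (-2)], [:: 0; 3; 0; 3; 2]), 1);
  (T2_4, T1_2, (0, 1, 2)%N, ([:: [:: 1; 0; 0; 0; 0]; [:: 0; 1; 0; 0; 0]; [:: 0; 0; 1; 0; 1];
    [:: 0; 0; 0; 1; 1]; [:: 0; 0; 0; 0; 1]], [:: [:: 1; 0; 0; 0; 1]; [:: 0; 1; 0; 0; 0]; [:: 0;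
    0; 1; 0; 1]; [:: 0; 0; 0; 1; 1]; [:: 0; 0; 0; 0; 1]], [:: [:: 1; 0; 0; 0; 0]; [:: 0; 1; 0;
    0; 0]; [:: 0; 0; 1; 0; 0]; [:: 0; 0; 0; 1; 0]; [:: (-1); 0; (-1); (-1); 1]]), ([:: 0; 5; 2;
    4; 6], [:: 0; 5; 2; 4; 6], [:: 0; (-5); (-2); (-4); (-6)]), 1);
  (T2_4, T1_4, (1, 0, 2)%N, ([:: [:: 1; (-1); 0; 0; 1]; [:: 0; (-1); 0; 0; 1]; [:: 0; 1; 0; 0;
    0]; [:: 0; 0; 1; 0; 0]; [:: 0; 0; 0; 1; 0]], [:: [:: 1; 0; 0; 0; 0]; [:: 0; (-1); 0; 0; 1];
    [:: 0; 1; 0; 0; 0]; [:: 0; 0; 1; 0; 0]; [:: 0; 0; 0; 1; 0]], [:: [:: 1; 0; 0; 0; 0];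
    [:: (-1); 0; 0; 0; 1]; [:: 0; 1; 0; 0; 1]; [:: 0; 0; 1; 0; 0]; [:: 0; 0; 0; 1; 0]]), ([:: 0;
    1; 2; 2; 4], [:: 0; 1; 2; 2; 4], [:: 0; (-1); (-2); (-2); (-4)]), 1);
  (T2_4, T2_6, (0, 1, 2)%N, (id5, id5, id5), ([:: 0; 0; 2; 1; 0], [:: 0; 0; 2; 1; 0], [:: 0; 0;
    (-2); (-1); 0]), 1);
  (T2_4, T2_8, (0, 1, 2)%N, ([:: [:: 1; 0; 0; 0; 0]; [:: 0; 0; 0; 1; 0]; [:: 0; 0; 1; 0; 0];
    [:: 0; 1; 0; 0; 0]; [:: 0; 0; 0; 0; 1]], [:: [:: 1; 0; 0; 0; 0]; [:: 0; 0; 1; 0; 0]; [:: 0;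
    0; 0; 1; 0]; [:: 0; 1; 0; 0; 0]; [:: 0; 0; 0; 0; 1]], [:: [:: 1; 0; 0; 0; 0]; [:: 0; 0; 1;
    0; 0]; [:: 0; 0; 0; 1; 0]; [:: 0; 1; 0; 0; 0]; [:: 0; 0; 0; 0; 1]]), ([:: 0; 5; 4; 1; 0],
    [:: 0; 1; 5; 1; 6], [:: 0; (-1); (-5); (-1); (-6)]), 1);
  (T2_5, T2_4, (0, 1, 2)%N, ([:: [:: 1; 0; 0; 0; 0]; [:: 0; 1; (-1); 0; 0]; [:: 0; 1; 1; 0; 0];
    [:: 0; 0; 0; 2; 0]; [:: 0; 0; 0; 0; 1]], [:: [:: 1; 0; 0; 0; 0]; [:: 0; 1; (-1); 0; 0];
    [:: 0; 1; 1; 0; 0]; [:: 0; 0; 0; 2; 0]; [:: 0; 0; 0; 0; 1]], [:: [:: 2; 0; 0; 0; 0]; [:: 0;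
    1; (-1); 0; 0]; [:: 0; 1; 1; 0; 0]; [:: 0; 0; 0; 1; 0]; [:: 0; 0; 0; 0; 2]]), ([:: 0; 3; 1;
    2; 0], [:: 0; 3; 1; 2; 2], [:: 0; (-3); (-1); (-2); (-2)]), 2);
  (T2_5, T1_3, (0, 1, 2)%N, ([:: [:: 1; 0; 0; 0; 0]; [:: 0; 1; 1; 0; 0]; [:: 0; 1; (-1); 0; 1];
    [:: 0; 0; 0; (-2); 1]; [:: 0; 0; 0; 0; 1]], [:: [:: 1; 0; 0; 0; 1]; [:: 0; 1; 1; 0; 0];
    [:: 0; 1; (-1); 0; 1]; [:: 0; 0; 0; (-2); 1]; [:: 0; 0; 0; 0; 1]], [:: [:: 2; 0; 0; 0; 0];
    [:: 0; 1; 1; 0; 0]; [:: 0; 1; (-1); 0; 0]; [:: 0; 0; 0; (-1); 0]; [:: (-2); (-1); 1; 1;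
    2]]), ([:: 0; 3; 2; 4; 6], [:: 0; 3; 2; 4; 6], [:: 0; (-3); (-2); (-4); (-6)]), 2);
  (T2_6, T1_6, (1, 0, 2)%N, ([:: [:: 1; 0; 0; (-1); 1]; [:: 0; 1; 0; 0; 0]; [:: 0; 0; 1; 0; 0];
    [:: 0; 0; 0; (-1); 1]; [:: 0; 0; 0; 1; 0]], [:: [:: 1; 0; 0; 0; 0]; [:: 0; 1; 0; 0; 0];
    [:: 0; 0; 1; 0; 0]; [:: 0; 0; 0; (-1); 1]; [:: 0; 0; 0; 1; 0]], [:: [:: 1; 0; 0; 0; 0];
    [:: 0; 1; 0; 0; 0]; [:: 0; 0; 1; 0; 0]; [:: (-1); 0; 0; 0; 1]; [:: 0; 0; 0; 1; 1]]), ([:: 0;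
    9; 4; 4; 8], [:: 0; 9; 4; 4; 8], [:: 0; (-9); (-4); (-4); (-8)]), 1);
  (T2_7, T2_8, (0, 1, 2)%N, ([:: [:: 1; 0; 0; 0; 0]; [:: 0; 1; 0; 0; 0]; [:: 0; 0; 0; 1; 0];
    [:: 0; 0; (-1); 0; 0]; [:: 0; 0; 0; 0; 1]], [:: [:: 0; 1; 0; 0; 0]; [:: (-1); 0; 0; 0; 0];
    [:: 0; 0; 0; (-1); 0]; [:: 0; 0; (-1); 0; 0]; [:: 0; 0; 0; 0; 1]], [:: [:: 0; 1; 0; 0; 0];
    [:: (-1); 0; 0; 0; 0]; [:: 0; 0; 0; (-1); 0]; [:: 0; 0; (-1); 0; 0]; [:: 0; 0; 0; 0; 1]]),
    ([:: 0; (-1); (-4); (-3); 0], [:: 0; 3; (-1); (-3); 2], [:: 0; (-3); 1; 3; (-2)]), 1);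
  (T2_7, T1_19, (0, 1, 2)%N, ([:: [:: 1; 0; 0; 0; 0]; [:: 0; 0; (-1); 0; 1]; [:: 0; 0; 1; 0; 0];
    [:: 0; 1; 0; 0; 0]; [:: 0; 0; 0; (-1); 0]], [:: [:: 0; 1; (-1); 0; 1]; [:: 1; 0; 0; 0; 0];
    [:: 0; 0; (-1); 0; 1]; [:: 0; 0; 0; (-1); 0]; [:: 0; 0; 1; 0; 0]], [:: [:: 0; 1; 0; 0; 0];
    [:: 1; 0; 0; 0; 0]; [:: 0; (-1); 0; 0; 1]; [:: 0; 0; 0; (-1); 0]; [:: 0; 0; 1; 0; 1]]),
    ([:: 0; 2; 4; 3; 2], [:: 0; 1; 2; 3; 4], [:: 0; (-1); (-2); (-3); (-4)]), 1);
  (T2_8, T1_18, (0, 1, 2)%N, ([:: [:: 1; 0; 0; 0; 0]; [:: 0; 0; 0; (-1); 1]; [:: 0; 0; 0; 1; 0];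
    [:: 0; 1; 0; 0; 0]; [:: 0; 0; 1; 0; 0]], [:: [:: 1; 0; 0; (-1); 1]; [:: 0; 1; 0; 0; 0];
    [:: 0; 0; 0; (-1); 1]; [:: 0; 0; 1; 0; 0]; [:: 0; 0; 0; 1; 0]], [:: [:: 1; 0; 0; 0; 0];
    [:: 0; 1; 0; 0; 0]; [:: (-1); 0; 0; 0; 1]; [:: 0; 0; 1; 0; 0]; [:: 0; 0; 0; 1; 1]]), ([:: 0;
    2; 4; 2; 3], [:: 0; (-1); 2; 2; 4], [:: 0; 1; (-2); (-2); (-4)]), 1);
  (T3_1, T2_1, (0, 1, 2)%N, ([:: [:: 1; 0; 0; 0; 0]; [:: 0; 1; 0; 0; 0]; [:: 0; 0; 1; 0; 0];
    [:: 0; 0; 0; 1; 0]; [:: 0; 0; 0; 1; 1]], [:: [:: 1; 0; 0; 0; 0]; [:: 0; 1; 0; 0; 0]; [:: 0;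
    0; 1; 0; 0]; [:: 0; 0; 0; 1; 1]; [:: 0; 0; 0; 1; 0]], [:: [:: 1; 0; 0; 0; 0]; [:: 0; 1; 0;
    0; 0]; [:: 0; 0; 1; 0; 0]; [:: 0; 0; 0; 0; 1]; [:: 0; 0; 0; 1; (-1)]]), ([:: 0; (-1); (-2);
    2; 0], [:: 0; (-1); (-2); (-5); (-3)], [:: 0; 1; 2; 5; 3]), 1);
  (T3_1, T2_3, (0, 1, 2)%N, ([:: [:: 1; 0; 0; 0; 0]; [:: 0; 1; 0; 1; 0]; [:: 0; 0; 1; 1; 0];
    [:: 0; 0; 0; 1; 0]; [:: 0; 0; 0; 0; 1]], [:: [:: 1; 0; 0; 1; 0]; [:: 0; 1; 0; 1; 0]; [:: 0;
    0; 1; 1; 0]; [:: 0; 0; 0; 1; 0]; [:: 0; 0; 0; 0; 1]], [:: [:: 1; 0; 0; 0; 0]; [:: 0; 1; 0;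
    0; 0]; [:: 0; 0; 1; 0; 0]; [:: (-1); (-1); (-1); 1; 0]; [:: 0; 0; 0; 0; 1]]), ([:: 0; 2; 4;
    6; 0], [:: 0; 2; 4; 6; 5], [:: 0; (-2); (-4); (-6); (-5)]), 1);
  (T3_1, T3_2, (0, 1, 2)%N, ([:: [:: 1; 0; 0; 0; 0]; [:: 0; 0; 1; 0; 0]; [:: 0; 1; 0; 0; 0];
    [:: 0; 0; 0; 0; 1]; [:: 0; 0; 0; 1; 0]], [:: [:: 1; 0; 0; 0; 0]; [:: 0; 0; 1; 0; 0]; [:: 0;
    1; 0; 0; 0]; [:: 0; 0; 0; 0; 1]; [:: 0; 0; 0; 1; 0]], [:: [:: 1; 0; 0; 0; 0]; [:: 0; 0; 1;
    0; 0]; [:: 0; 1; 0; 0; 0]; [:: 0; 0; 0; 0; 1]; [:: 0; 0; 0; 1; 0]]), ([:: 0; (-3); (-1); 0;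
    0], [:: 0; (-3); (-1); 0; 3], [:: 0; 3; 1; 0; (-3)]), 1);
  (T3_2, T2_2, (0, 1, 2)%N, ([:: [:: 1; 0; 0; 0; 0]; [:: 0; 1; 0; 0; 0]; [:: 0; 0; 1; 0; 0];
    [:: 0; 0; 0; 0; 1]; [:: 0; 0; 0; 1; 1]], [:: [:: 1; 0; 0; 0; 0]; [:: 0; 1; 0; 0; 0]; [:: 0;
    0; 1; 0; 0]; [:: 0; 0; 0; (-1); 1]; [:: 0; 0; 0; 1; 0]], [:: [:: 1; 0; 0; 0; 0]; [:: 0; 1;
    0; 0; 0]; [:: 0; 0; 1; 0; 0]; [:: 0; 0; 0; 0; 1]; [:: 0; 0; 0; 1; 1]]), ([:: 0; (-4); (-3);
    1; 0], [:: 0; (-4); (-3); (-4); (-3)], [:: 0; 4; 3; 4; 3]), 1);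
  (T3_2, T2_4, (0, 1, 2)%N, ([:: [:: 1; 0; 0; 0; 0]; [:: 0; 1; 0; 0; 0]; [:: 0; 0; (-1); 0; 1];
    [:: 0; 0; 1; 0; 0]; [:: 0; 0; 0; 1; 0]], [:: [:: 1; 0; (-1); 0; 1]; [:: 0; 1; 0; 0; 0];
    [:: 0; 0; (-1); 0; 1]; [:: 0; 0; 1; 0; 0]; [:: 0; 0; 0; 1; 0]], [:: [:: 1; 0; 0; 0; 0];
    [:: 0; 1; 0; 0; 0]; [:: (-1); 0; 0; 0; 1]; [:: 0; 0; 1; 0; 1]; [:: 0; 0; 0; 1; 0]]), ([:: 0;
    (-3); 1; 2; 0], [:: 0; (-3); 1; 2; 1], [:: 0; 3; (-1); (-2); (-1)]), 1);
  (T3_3, T2_1, (0, 1, 2)%N, ([:: [:: 1; 0; 0; 0; 0]; [:: 0; 1; 0; 0; 1]; [:: 0; 0; 0; 0; 1];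
    [:: 0; 0; 1; 0; 0]; [:: 0; 0; 0; 1; 0]], [:: [:: 1; 0; 0; 0; 1]; [:: 0; 1; 0; 0; 1]; [:: 0;
    0; 0; 0; 1]; [:: 0; 0; 1; 0; 0]; [:: 0; 0; 0; 1; 0]], [:: [:: 1; 0; 0; 0; 0]; [:: 0; 1; 0;
    0; 0]; [:: (-1); (-1); 0; 0; 1]; [:: 0; 0; 1; 0; 0]; [:: 0; 0; 0; 1; 0]]), ([:: 0; 2; 4; 0;
    0], [:: 0; 2; 4; 3; 3], [:: 0; (-2); (-4); (-3); (-3)]), 1);
  (T3_3, T2_3, (0, 1, 2)%N, ([:: [:: 1; 0; 0; 0; 0]; [:: 0; 1; 1; 1; 0]; [:: 0; 0; 2; 1; 0];
    [:: 0; 0; 3; 1; 0]; [:: 0; 0; 0; 0; 1]], [:: [:: 1; 0; 1; 0; 0]; [:: 0; 1; 1; 1; 0]; [:: 0;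
    0; 1; 2; 0]; [:: 0; 0; 1; 3; 0]; [:: 0; 0; 0; 0; 1]], [:: [:: 1; 0; 0; 0; 0]; [:: 0; 1; 0;
    0; 0]; [:: (-3); (-2); 3; (-1); 0]; [:: 2; 1; (-2); 1; 0]; [:: 0; 0; 0; 0; 1]]), ([:: 0; 2;
    4; 6; 0], [:: 0; 2; 4; 6; 5], [:: 0; (-2); (-4); (-6); (-5)]), 1);
  (T4_1, T3_3, (0, 1, 2)%N, ([:: [:: 1; 0; 0; 0; 0]; [:: 0; 1; 0; 0; 0]; [:: 0; 0; 0; 0; 1];
    [:: 0; 0; 0; 1; 1]; [:: 0; 0; 1; 0; 0]], [:: [:: 1; 0; 0; 0; 0]; [:: 0; 1; 0; 0; 0]; [:: 0;
    0; 0; (-1); 1]; [:: 0; 0; 0; 1; 0]; [:: 0; 0; 1; 0; 0]], [:: [:: 1; 0; 0; 0; 0]; [:: 0; 1;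
    0; 0; 0]; [:: 0; 0; 0; 0; 1]; [:: 0; 0; 0; 1; 1]; [:: 0; 0; 1; 0; 0]]), ([:: 0; (-2); 2; 0;
    0], [:: 0; (-2); (-3); (-1); 0], [:: 0; 2; 3; 1; 0]), 1);
  (T4_1, T3_1, (0, 1, 2)%N, ([:: [:: 1; 0; 0; 0; 0]; [:: 0; (-1); 0; 0; 1]; [:: 0; 1; 0; 0; 0];
    [:: 0; 0; 0; 1; 0]; [:: 0; 0; 1; 0; 0]], [:: [:: 1; (-1); 0; 0; 1]; [:: 0; (-1); 0; 0; 1];
    [:: 0; 1; 0; 0; 0]; [:: 0; 0; 0; 1; 0]; [:: 0; 0; 1; 0; 0]], [:: [:: 1; 0; 0; 0; 0];
    [:: (-1); 0; 0; 0; 1]; [:: 0; 1; 0; 0; 1]; [:: 0; 0; 0; 1; 0]; [:: 0; 0; 1; 0; 0]]), ([:: 0;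
    2; 4; 0; 0], [:: 0; 2; 4; 2; 3], [:: 0; (-2); (-4); (-2); (-3)]), 1);
  (T5_1, T4_1, (0, 1, 2)%N, ([:: [:: 1; 0; 0; 0; 0]; [:: 0; 0; 0; 0; 1]; [:: 0; 1; 0; 0; 0];
    [:: 0; 0; 0; 1; 0]; [:: 0; 0; 1; 0; 0]], [:: [:: 1; 0; 0; 0; 1]; [:: 0; 0; 0; 0; 1]; [:: 0;
    1; 0; 0; 0]; [:: 0; 0; 0; 1; 0]; [:: 0; 0; 1; 0; 0]], [:: [:: 1; 0; 0; 0; 0]; [:: (-1); 0;
    0; 0; 1]; [:: 0; 1; 0; 0; 0]; [:: 0; 0; 0; 1; 0]; [:: 0; 0; 1; 0; 0]]), ([:: 0; 1; 0; 0; 0],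
    [:: 0; 1; (-4); (-4); 0], [:: 0; (-1); 4; 4; 0]), 1);
  (TO58, TO57, (0, 1, 2)%N, ([:: [:: 0; 0; 0; 0; 1]; [:: 0; 1; 0; 0; 0]; [:: 0; 0; 0; 1; 0];
    [:: 0; 0; 1; 0; 0]; [:: 1; 0; 0; 0; 0]], [:: [:: 1; 0; 0; 0; 0]; [:: 0; 0; 0; 0; (-1)];
    [:: 0; 0; 0; (-1); 0]; [:: 0; 0; 1; 0; 0]; [:: 0; 1; 0; 0; 0]], [:: [:: 0; 1; 0; 0; 0];
    [:: (-1); 0; 0; 0; 0]; [:: 0; 0; 0; 0; (-1)]; [:: 0; 0; 0; (-1); 0]; [:: 0; 0; 1; 0; 0]]),
    ([:: 0; 2; 5; (-1); 3], [:: 0; (-3); (-2); (-5); (-3)], [:: 0; 3; 2; 5; 2]), 1);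
  (TO57, TO56, (1, 0, 2)%N, ([:: [:: 0; 0; 0; 1; 0]; [:: 0; 0; 0; 0; 1]; [:: 1; 0; 0; 0; 0];
    [:: (-1); 1; 0; 0; 0]; [:: 0; 0; (-1); 0; 0]], [:: [:: 0; 0; 1; 0; 0]; [:: 0; (-1); (-1); 0;
    0]; [:: 0; 0; 0; 0; 1]; [:: 1; 0; 0; 0; 0]; [:: 0; 0; 0; (-1); 0]], [:: [:: 1; 1; 0; 0; 0];
    [:: 0; 1; 0; 0; 0]; [:: 0; 0; 0; 0; 1]; [:: 0; 0; 0; 1; 0]; [:: 0; 0; (-1); 0; 0]]), ([:: 0;
    (-1); 1; 1; 5], [:: 0; 0; 1; (-1); (-5)], [:: 0; 0; (-1); 1; (-4)]), 1);
  (TO56, TO55, (2, 1, 0)%N, ([:: [:: 1; 0; 0; 0; 0]; [:: 0; 0; 1; 0; 0]; [:: 0; 0; 0; 1; 0];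
    [:: 0; 0; 0; 0; 1]; [:: 0; 1; 0; 0; 0]], [:: [:: 1; 0; 0; 0; 0]; [:: 0; 0; 0; 0; 1]; [:: 0;
    0; 1; 0; 1]; [:: 0; 0; 0; 1; 0]; [:: 0; 1; 0; 0; 0]], [:: [:: 1; 0; 0; 0; 0]; [:: 0; (-1);
    0; 0; 1]; [:: 0; 1; 0; 0; 0]; [:: 0; 0; 1; 0; 0]; [:: 0; 0; 0; 1; 0]]), ([:: 0; (-2); 2; 7;
    3], [:: 0; 5; 2; (-2); (-3)], [:: 0; (-5); (-2); 2; (-1)]), 1);
  (TO55, TO54, (0, 1, 2)%N, (id5, id5, id5), ([:: 0; 0; 0; (-2); (-1)], [:: 0; (-2); 0; 0; 1],
    [:: 0; 2; 0; 0; 1]), 1)]%BZ.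

Lemma certificates_valid : all valid certificates.
Proof. by vm_compute. Qed.

(** * The graph *)

Section Certificates.
Variable R : realType.
Local Notation C := (Cplx R).
Local Notation act := (@Defs.act R).
Local Notation orbit := (@Defs.orbit R).

Definition zmx (m : seq (seq Z)) : 'M[C]_5 := \matrix_(i, j) zK C (zentry2 m i j).

Lemma zmx_unit m : zunit m -> zmx m \in unitmx.
Proof.
move=> /and3P[/eqP sm am /eqP rm]; have [d [B [dr _ BP]]] := @rkP C 5%N m am.
have d0 : d = 0%N by move: dr; rewrite rm; lia.
(* [rkP] describes the vectors orthogonal to all the rows of [m], that is, the left kernel of the
   transpose. *)
rewrite -unitmx_tr -row_free_unit -kermx_eq0; apply/eqP/row_matrixP => i; rewrite row0.
apply/eqP; rewrite -submx0.
apply: (submx_trans (B := B)); last by subst d; rewrite (flatmx0 B) sub0mx.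
rewrite -BP; apply/(all_nthP [::]) => k; rewrite sm => k5; apply/eqP.
have := congr1 (fun M : 'M[C]_5 => M i (Ordinal k5)) (mulmx_ker (zmx m)^T); rewrite !mxE => <-.
by apply: eq_bigr => j _; rewrite !mxE mulrC.
Qed.

Lemma zK_zsum f : zK C (zsum f) = \sum_(i < 5) zK C (f i).
Proof. by rewrite /zsum !zKD !big_ord_recl big_ord0 addr0 !addrA. Qed.

Lemma zactE g1 g2 g3 (T : tensor R) (t : ztns) : (forall i j k : 'I_5,
  T i j k = zK C (t i j k)) ->
  forall i j k : 'I_5,
    act (zmx g1) (zmx g2) (zmx g3) T i j k = zK C (zact g1 g2 g3 t i j k).
Proof.
move=> Tt i j k; rewrite /act /zact zK_zsum; apply: eq_bigr => i' _.
rewrite zKM zK_zsum mulr_sumr; apply: eq_bigr => j' _.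
rewrite zKM zK_zsum mulrA mulr_sumr; apply: eq_bigr => k' _.
by rewrite zKM !mxE Tt !mulrA.
Qed.

Lemma permn_label p u (i j k : 'I_5) : p \in perms6 ->
  permn p (tensor_of_label R u) i j k = zK C (zpermn p (ztensor u) i j k).
Proof.
rewrite /permn /zpermn tensor_of_labelE.
by rewrite !inE => /or4P[/eqP->|/eqP->|/eqP->|/or3P[/eqP->|/eqP->|/eqP->]].
Qed.

Definition source (c : certificate) : label := c.1.1.1.1.1.
Definition target (c : certificate) : label := c.1.1.1.1.2.

Lemma valid_degenerates c : valid c ->
  degenerates_perm (tensor_of_label R (source c)) (tensor_of_label R (target c)).
Proof.
case: c => [[[[[u v] p] [[g1 g2] g3]] w] D]; rewrite -[source _]/u -[target _]/v /valid.
move=> /and5P[pP u1 u2 u3 /andP[D0 /allP wP]].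
have [s sp] := perms6_code pP; exists s.
apply: degenerates_trans (orbit_degenerates _) _.
  exists (zmx g1), (zmx g2), (zmx g3); split;
    [exact: zmx_unit | exact: zmx_unit | exact: zmx_unit|].
  by [].
apply: (@toric_degeneration R (zK C D) (fun i => int_of_Z (nth Z0 w.1.1 i))
  (fun j => int_of_Z (nth Z0 w.1.2 j)) (fun k => int_of_Z (nth Z0 w.2 k))).
  by rewrite zK_eq0.
move=> i j k /=.
have -> : act (zmx g1) (zmx g2) (zmx g3) (permute s (tensor_of_label R u)) i j k =
    zK C (zact g1 g2 g3 (zpermn p (ztensor u)) i j k).
  by apply: zactE => *; rewrite permuteE sp permn_label.
have := wP _ (mem_alltriples5 i j k); rewrite -/(ztensor u) -/(ztensor v).
rewrite tensor_of_labelE; set x := zact _ _ _ _ _ _ _.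
have -> : int_of_Z (nth Z0 w.1.1 i) + int_of_Z (nth Z0 w.1.2 j) + int_of_Z (nth Z0 w.2 k) =
   int_of_Z (weight w i j k) by rewrite /weight; lia.
case: (weight w i j k) => [/Z.eqb_spec ->|q /Z.eqb_spec ->|q /andP[/Z.eqb_spec -> /Z.eqb_spec
  ->]].
- by rewrite zKM; split.
- by rewrite zK0; split => //; lia.
by rewrite zK0; split => //; lia.
Qed.

Lemma certificates_complete u v : arrow u v ->
  has (fun c => (source c == u) && (target c == v)) certificates.
Proof. by case: u; case: v. Qed.

Lemma arrow_degenerates u v : arrow u v ->
  degenerates_perm (tensor_of_label R u) (tensor_of_label R v).
Proof.
move=> /certificates_complete/hasP[c /(allP certificates_valid) cv /andP[/eqP <- /eqP <-]].
exact: valid_degenerates.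
Qed.

End Certificates.

(** That 14 rounds are enough is what [reachable_closed] checks: the lists obtained are stable under
    [successors]. *)
Definition reachable (u : label) : seq label :=
  iter 14 (fun s => undup (s ++ flatten [seq successors v | v <- s])) [:: u].

Lemma reachable_closed : all (fun u => let s := reachable u in (u \in s) &&
  all (fun v => all (fun w => w \in s) (successors v)) s) labels.
Proof. by vm_compute. Qed.

Lemma labelsP u : u \in labels. Proof. by case: u. Qed.

Lemma connect_arrowE u v : connect arrow u v = (v \in reachable u).
Proof.
have /andP[uu /allP uc] := allP reachable_closed u (labelsP u).
apply/idP/idP => [/connectP[p up ->]|].
  have closed x q : x \in reachable u -> path arrow x q -> last x q \in reachable u.
    elim: q x => //= w q IH x xu /andP[xw]; apply: IH.
    exact: (allP (uc x xu)).
  exact: closed up.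
rewrite /reachable; elim: 14%N v => [|n IH] v; first by rewrite /= inE => /eqP ->.
rewrite iterS mem_undup mem_cat => /orP[/IH //|/flatten_mapP[w /IH uw wv]].
exact: connect_trans uw (connect1 wv).
Qed.

(* A value, and not a function, so that the computations below evaluate it only once. *)
Definition reach_table : seq (seq bool) :=
  [seq (let s := reachable u in [seq v \in s | v <- labels]) | u <- labels].

Definition reach (t : seq (seq bool)) (u v : label) : bool :=
  nth false (nth [::] t (label_index u)) (label_index v).

Lemma reachE u v : reach reach_table u v = connect arrow u v.
Proof.
have nthK w : nth T1_1 labels (label_index w) = w by case: w.
have ltK w : (label_index w < size labels)%N by case: w.
by rewrite connect_arrowE /reach /reach_table !(nth_map T1_1) ?ltK// !nthK.
Qed.

Definition obstructed : seq (label * label) := [::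
  (T1_4, T1_12); (T1_4, TO57); (T1_5, T1_13); (T1_5, TO56); (T1_8, T1_10);
  (T1_8, TO55); (T1_9, T1_15); (T1_10, T1_15); (T1_11, T1_9); (T1_11, TO54);
  (T2_1, T2_6); (T2_1, T2_8); (T2_2, T1_4); (T2_3, T2_2); (T2_5, T1_11);
  (T2_5, T2_7); (T2_5, TO58); (T2_6, T1_10); (T2_6, TO54); (T2_7, T1_9);
  (T2_7, T1_11); (T2_7, TO58); (T2_8, T1_12); (T2_8, TO57); (T3_1, T3_3);
  (T3_2, T1_8); (T3_2, T1_11); (T3_2, T1_19); (T3_2, TO58); (T3_3, T3_2);
  (T4_1, T5_1); (TO58, T1_9); (TO58, T1_10); (TO58, T1_15)].

Lemma obstructed_all : let t := reach_table in
  all (fun u => all (fun v => reach t u v ||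
    has (fun ab => reach t ab.1 u && reach t v ab.2) obstructed) labels) labels.
Proof. by vm_compute. Qed.

Lemma reach_antisym : let t := reach_table in
  all (fun u => all (fun v => (u == v) || ~~ (reach t u v && reach t v u)) labels) labels.
Proof. by vm_compute. Qed.

(** The graph is the Hasse diagram of its own reachability order; in particular no arrow is implied
    by the others. *)
Lemma arrow_cover : let t := reach_table in
  all (fun u => all (fun v => arrow u v == [&& u != v, reach t u v &
    all (fun w => reach t u w && reach t w v ==> (w == u) || (w == v)) labels])
  labels) labels.
Proof. by vm_compute. Qed.

Lemma card_arrow : #|[pred uv : label * label | arrow uv.1 uv.2]| = 66%N.
Proof.
rewrite -sum1_card (eq_bigl (fun uv : label * label => xpredT uv.1 && arrow uv.1 uv.2)) //.
rewrite -(pair_big_dep xpredT (fun u v => arrow u v) (fun _ _ => 1%N)) /=.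
have E (F : label -> nat) : \sum_u F u = \sum_(u <- labels) F u.
  by rewrite (big_uniq _ (_ : uniq labels))//; apply: eq_bigl => u; rewrite labelsP.
rewrite E; under eq_bigr => u _ do rewrite big_mkcond E.
by rewrite unlock.
Qed.

(** * Obstructions by ranks *)

Section RankObstructions.
Variable R : realType.
Local Notation C := (Cplx R).
Local Notation tensor := (tensor R).
Local Notation act := (@Defs.act R).
Local Notation orbit := (@Defs.orbit R).
Implicit Types (T S : tensor).

Lemma tri_continuous (a b c : 'rV[C]_5) : continuous (fun T : tensor => tri T a b c).
Proof.
rewrite /tri; do 3 (apply: continuous_sum => ?); apply: continuous_mul.
  exact: cst_continuous.
exact: entry_continuous.
Qed.

Lemma symform_continuous (X : topologicalType) s (phi : X -> 'rV[C]_5 -> 'rV[C]_5 -> C) x c1 c2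
  c3 :
  (forall c y, continuous (fun t => phi t c y)) ->
  continuous (fun t => symform s (phi t) x c1 c2 c3).
Proof.
move=> pc; rewrite /symform; apply: continuous_add.
  by do 2 (apply: continuous_add; last exact: pc); exact: pc.
apply: continuous_mul; first exact: cst_continuous.
by do 2 (apply: continuous_add; last exact: pc); exact: pc.
Qed.

Lemma rank_E3_degenerates T S : degenerates T S ->
  (\rank (sysmx (E3 S)) <= \rank (sysmx (E3 T)))%N.
Proof.
apply: (@closure_rank_le C tensor (orbit T) _ _ (fun S => sysmx (E3 S))).
  move=> i j; under eq_fun do rewrite mxE.
  apply: symform_continuous => c y; exact: tri_continuous.
move=> _ [g1 [g2 [g3 [u1 u2 u3 ->]]]].
by apply: rank_E3_act (tri_act g1 g2 g3 T).
Qed.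

Lemma rank_E2_degenerates T S : degenerates T S ->
  (\rank (sysmx (E2 S)) <= \rank (sysmx (E2 T)))%N.
Proof.
apply: (@closure_rank_le C tensor (orbit T) _ _ (fun S => sysmx (E2 S))).
  move=> i j; under eq_fun do rewrite mxE.
  apply: symform_continuous => c y; rewrite /phi2.
  have m2 a b d a' b' d' : continuous (fun T : tensor => tri T a b d * tri T a' b' d').
    by apply: continuous_mul; exact: tri_continuous.
  do 3 (apply: continuous_add; last by [apply: continuous_opp; exact: m2 | exact: m2]).
  exact: m2.
move=> _ [g1 [g2 [g3 [u1 u2 u3 ->]]]].
by apply: rank_E2_act (tri_act g1 g2 g3 T).
Qed.

Definition rank_inv (b : bool) (t : ztns) : nat := rk 125%N (if b then rows2 t else rows3 t).

Lemma rank_inv_degenerates b T S (t s : ztns) :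
    (forall i j k : 'I_5, T i j k = zK C (t i j k)) ->
    (forall i j k : 'I_5, S i j k = zK C (s i j k)) ->
  degenerates T S -> (rank_inv b s <= rank_inv b t)%N.
Proof.
move=> Tt Ss TS; rewrite /rank_inv; case: b.
  by have := rank_E2_degenerates TS; rewrite (rank_E2 Tt) (rank_E2 Ss).
by have := rank_E3_degenerates TS; rewrite (rank_E3 Tt) (rank_E3 Ss).
Qed.

End RankObstructions.

(* The entry [(p0, p1, p2, n)] of [u] stands for the value [n] of [rank_inv] at the
   tensor of [u] permuted by [(p0, p1, p2)]. *)
Definition rank_values (b : bool) :
  seq (label * seq (nat * nat * nat * nat)) := (if b then [::
  (T1_4, [:: (1, 2, 0, 43); (2, 1, 0, 43)]);
  (T1_5, [:: (0, 1, 2, 43); (1, 2, 0, 43); (2, 0, 1, 43)]);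
  (T1_8, [:: (0, 1, 2, 41); (1, 2, 0, 41); (2, 0, 1, 41)]);
  (T1_10, [:: (0, 1, 2, 42); (1, 0, 2, 42)]);
  (T1_11, [:: (2, 0, 1, 45); (2, 1, 0, 45)]);
  (T1_12, [:: (2, 0, 1, 44)]);
  (T2_5, [:: (0, 1, 2, 44); (1, 2, 0, 44); (2, 0, 1, 44)]);
  (T2_7, [:: (2, 0, 1, 45); (2, 1, 0, 45)]);
  (TO58, [:: (0, 1, 2, 45); (0, 2, 1, 45)]);
  (TO57, [:: (0, 1, 2, 44)]);
  (TO56, [:: (0, 1, 2, 44); (1, 0, 2, 44)]);
  (TO55, [:: (0, 2, 1, 42); (2, 0, 1, 42)])]
  else [::
  (T1_4, [:: (0, 1, 2, 70); (0, 2, 1, 75); (1, 0, 2, 70); (2, 1, 0, 75)]);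
  (T1_5, [:: (0, 1, 2, 70); (1, 0, 2, 70)]);
  (T1_8, [:: (0, 1, 2, 75); (0, 2, 1, 75); (2, 0, 1, 75)]);
  (T1_9, [:: (0, 1, 2, 49); (1, 0, 2, 49); (1, 2, 0, 75); (2, 1, 0, 75)]);
  (T1_10, [:: (0, 1, 2, 65); (0, 2, 1, 65); (2, 0, 1, 75); (2, 1, 0, 75)]);
  (T1_11, [:: (0, 1, 2, 75); (0, 2, 1, 71); (1, 0, 2, 70); (1, 2, 0, 61); (2, 0, 1, 75)]);
  (T1_12, [:: (0, 1, 2, 74); (2, 1, 0, 75)]);
  (T1_13, [:: (2, 0, 1, 75)]);
  (T1_15, [:: (0, 1, 2, 70); (1, 2, 0, 61); (2, 0, 1, 75); (2, 1, 0, 75)]);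
  (T1_19, [:: (0, 1, 2, 74); (0, 2, 1, 74); (2, 0, 1, 75)]);
  (T2_2, [:: (0, 1, 2, 70); (1, 0, 2, 70)]);
  (T2_6, [:: (0, 1, 2, 61); (1, 0, 2, 61)]);
  (T2_7, [:: (0, 1, 2, 74); (0, 2, 1, 74); (1, 0, 2, 70); (1, 2, 0, 70)]);
  (T2_8, [:: (0, 1, 2, 70); (0, 2, 1, 70); (1, 0, 2, 70); (1, 2, 0, 70)]);
  (T3_2, [:: (0, 1, 2, 70); (1, 0, 2, 70)]);
  (TO58, [:: (0, 2, 1, 74); (1, 0, 2, 74); (2, 1, 0, 74)]);
  (TO57, [:: (0, 1, 2, 74); (0, 2, 1, 74)]);
  (TO54, [:: (0, 1, 2, 70); (0, 2, 1, 70); (1, 0, 2, 70); (1, 2, 0, 70); (2, 0, 1, 70);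
    (2, 1, 0, 70)])])%N.

Lemma rank_values_valid : all (fun b => all (fun ul => let t := table ul.1 in
  all (fun f => (f.1 \in perms6) && (rank_inv b (zpermn f.1 (lookup t)) == f.2)) ul.2)
  (rank_values b)) [:: true; false].
Proof. vm_cast_no_check (erefl true). Qed.

Definition values_of (b : bool) (u : label) : seq (nat * nat * nat * nat) :=
  flatten [seq ul.2 | ul <- rank_values b & ul.1 == u].

Lemma values_ofP b u p r : (p, r) \in values_of b u ->
  p \in perms6 /\ rank_inv b (zpermn p (ztensor u)) = r.
Proof.
move=> /flatten_mapP[[u' l]]; rewrite mem_filter => /andP[/eqP/= -> ul] pl.
have bb : b \in [:: true; false] by case: b {ul}.
have /andP[pP /eqP] := allP (allP (allP rank_values_valid b bb) _ ul) _ pl.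
by split.
Qed.

(** A degeneration of [u] permuted by s to [v] may be permuted by any p = [f.1]. The source is then
    [u] permuted by the triple in the test (the product of s and p, as in [codeM]), and its
    invariant must not be smaller than that of the target. *)
Definition separated (u v : label) (s : nat * nat * nat) : bool :=
  has (fun b => has (fun f => has (fun g =>
    (g.1 == (sel s.1.1 f.1.1.1 f.1.1.2 f.1.2, sel s.1.2 f.1.1.1 f.1.1.2 f.1.2,
             sel s.2 f.1.1.1 f.1.1.2 f.1.2))
    && (g.2 < f.2)%N) (values_of b u)) (values_of b v)) [:: true; false].

Lemma permute_label (R : realType) s u (i j k : 'I_5) :
  permute s (tensor_of_label R u) i j k = zK (Cplx R) (zpermn (code s) (ztensor u) i j k).
Proof. by rewrite permuteE permn_label ?code_perms6. Qed.

Lemma codeM s t : code (s * t)%g =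
  (sel (val (s 0)) (code t).1.1 (code t).1.2 (code t).2,
   sel (val (s 1)) (code t).1.1 (code t).1.2 (code t).2,
   sel (val (s 2)) (code t).1.1 (code t).1.2 (code t).2).
Proof.
have E (x : 'I_3) : val (t x) = sel (val x) (code t).1.1 (code t).1.2 (code t).2.
  case: x => [[|[|[|//]]] p] /=; congr (val (t _)); exact/val_inj.
by rewrite {1}/code !permM !E.
Qed.

Lemma separated_not_degenerates (R : realType) u v s : separated u v (code s) ->
  ~ degenerates (permute s (tensor_of_label R u)) (tensor_of_label R v).
Proof.
case/hasP => b _ /hasP[[p r] /values_ofP[pP pr] /hasP[[q r'] /values_ofP[_ qr]]].
move=> /andP[/eqP qE lt] dg; have [t tp] := perms6_code pP.
have := rank_inv_degenerates b (@permute_label R (s * t)%g u) (@permute_label R t v).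
rewrite -permute_permute => /(_ (@permute_degenerates R t _ _ dg)).
rewrite tp pr (_ : code (s * t)%g = q) ?qr; first by rewrite leqNgt lt.
by rewrite codeM tp; move: qE => /= ->.
Qed.

(** * Compactness *)

Section Compactness.

(** The projection along a compact factor is a closed map: if at x every y of [Q] violates some
    equation, then by compactness this holds for all y at once on a neighbourhood of x. *)
Lemma closure_exists (K : numFieldType) (X Y : topologicalType) (I : Type)
    (A : set X) (Q : set Y) (F : I -> X * Y -> K) (x : X) :
    compact Q -> (forall i, continuous (F i)) ->
    (forall x', A x' -> exists2 y, Q y & forall i, F i (x', y) = 0) ->
    closure A x ->
  exists2 y, Q y & forall i, F i (x, y) = 0.
Proof.
move=> /compact_near_coveringP cQ Fc AQ clx; apply: contrapT => nx.
have : \forall x' \near x, forall y, Q y -> exists i, F i (x', y) != 0.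
  apply: (cQ X (nbhs x) (fun x' y => exists i, F i (x', y) != 0)) => y Qy.
  have [i Fi] : exists i, F i (x, y) != 0.
    apply: contrapT => H; apply: nx; exists y => // i.
    by apply: contrapT => /eqP Fi; apply: H; exists i.
  have op : open (F i @^-1` [set z | z != 0]).
    apply: open_comp => [z _|]; first exact: Fc.
    rewrite (_ : [set z | z != 0] = ~` [set 0]); last first.
      by apply/seteqP; split => z /= /eqP.
    by apply: closed_openC; apply: accessible_closed_set1;
      exact/hausdorff_accessible/(@norm_hausdorff _ K^o).
  have [[U V] /= [xU yV] UV] := open_nbhs_nbhs (conj op (Fi : (F i @^-1` [set z | z != 0]) (x,
    y))).
  by exists (V, U) => //= -[y' x'] /= [Vy' Ux']; exists i; exact: (UV (x', y')).
move=> /clx[x' [/AQ[y Qy F0] H]]; have [l] := H y Qy.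
by rewrite F0 eqxx.
Qed.

Variable R : realType.
Local Notation C := (Cplx R).

(** A square and not a disc, because it is the continuous image of a product of two segments. *)
Definition square : set C := [set z | `|complex.Re z| <= 1 /\ `|complex.Im z| <= 1].

Lemma square_compact : compact square.
Proof.
pose f (p : R * R) : C := (p.1 +i* p.2)%C.
have fc : continuous f.
  move=> p; apply/cvgrPdist_lt => /= e e0.
  have e2 : 0 < complex.Re e.
    by case: e e0 => a b; rewrite ltcE /= => /andP[].
  have eE : e = (complex.Re e)%:C%C.
    by case: e e0 {e2} => a b; rewrite ltcE /= => /andP[/eqP -> _].
  have h0 : 0 < complex.Re e / 2%:R by rewrite divr_gt0.
  near=> q.
  have q1 : `|p.1 - q.1| < complex.Re e / 2%:R.
    near: q; exact: (@cvgr_dist_lt _ R^o _ _ _ (fun q : R * R => q.1) p.1 cvg_fst _ h0).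
  have q2 : `|p.2 - q.2| < complex.Re e / 2%:R.
    near: q; exact: (@cvgr_dist_lt _ R^o _ _ _ (fun q : R * R => q.2) p.2 cvg_snd _ h0).
  rewrite eE normc_def ltcR; apply: (@le_lt_trans _ _ (`|p.1 - q.1| + `|p.2 - q.2|)); last lra.
  rewrite -[leRHS]ger0_norm ?addr_ge0// -sqrtr_sqr ler_wsqrtr//= -(real_normK (num_real (p.1 -
    q.1))).
  rewrite -(real_normK (num_real (p.2 - q.2))) sqrrD.
  by rewrite -addrA lerD2l lerDr mulrn_wge0// mulr_ge0.
have -> : square = f @` ([set` `[-1, 1]%R] `*` [set` `[-1, 1]%R]).
  apply/seteqP; split => [[a b]|_ [[a b] [/= a1 b1] <-]] /=.
    rewrite /square /= !ler_norml => -[a1 b1]; exists (a, b) => //.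
  by move: a1 b1; rewrite /square /= !ler_norml !in_itv /= => -> ->.
apply: continuous_compact; first exact: continuous_subspaceT.
by apply: compact_setX; exact: segment_compact.
Unshelve. all: by end_near.
Qed.

Lemma normc_le1_square (z : C) : `|z| <= 1 -> square z.
Proof.
move=> z1; split; first by rewrite -lecR; exact: le_trans (normc_ge_Re z) z1.
(* Multiplication by -i turns the imaginary part into the real part. *)
have zi : `|z * (0 +i* -1)%C| <= 1.
  by rewrite normrM (_ : `|(0 +i* -1)%C| = 1) ?mulr1// normc_def /= expr0n sqrrN expr1n add0r
    sqrtr1.
rewrite -lecR; apply: le_trans zi; apply: le_trans (normc_ge_Re _).
by case: z {z1} => a b /=; rewrite mulr0 mulrN1 opprK add0r.
Qed.

Lemma max_norm n (v : 'rV[C]_n) : v != 0 ->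
  exists2 i, v 0 i != 0 & forall j, `|v 0 j / v 0 i| <= 1.
Proof.
move=> /rV0Pn[i0 vi0].
have [i _ iP] := @arg_maxP _ R 'I_n i0 xpredT (fun i => complex.Re `|v 0 i|) erefl.
have le_i j : `|v 0 j| <= `|v 0 i|.
  by have := iP j erefl; rewrite !normc_def /= lecR.
have vi : v 0 i != 0 by rewrite -normr_gt0; apply: lt_le_trans (le_i i0); rewrite normr_gt0.
by exists i => // j; rewrite normrM normfV ler_pdivrMr ?normr_gt0// mul1r.
Qed.

(* The tuples of nonzero rows, each up to scaling, form a compact space. *)
Lemma closure_projective (X : topologicalType) n d (A : set X) (I : Type)
    (F : I -> X -> ('I_n -> 'rV[C]_d) -> C) (x : X) :
    (forall l, continuous (fun p : X * 'rV[C]_(n * d) => F l p.1 (fun j => row j (vec_mx p.2))))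
      ->
    (forall l x' L (s : 'I_n -> C), (forall j, s j != 0) -> F l x' L = 0 ->
       F l x' (fun j => s j *: L j) = 0) ->
    (forall x', A x' -> exists2 L, (forall j, L j != 0) & forall l, F l x' L = 0) ->
    closure A x ->
  exists2 L, (forall j, L j != 0) & forall l, F l x L = 0.
Proof.
move=> Fc FZ AF clx.
pose Q := [set v : 'rV[C]_(n * d) | forall k, square (v ord0 k)].
(* A nonzero row divided by an entry of largest modulus has its entries in the square and one of
   them equal to 1. The product expresses the latter as a single closed equation, which keeps the
   row nonzero in the limit. *)
pose G (l : 'I_n + I) (p : X * 'rV[C]_(n * d)) : C := match l with
  | inl j => \prod_(k < d) (vec_mx p.2 j k - 1)
  | inr l => F l p.1 (fun j => row j (vec_mx p.2)) end.
have cQ : compact Q by apply: (@rV_compact C (n * d)%N (fun=> square)) => _;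
  exact: square_compact.
have Gc l : continuous (G l).
  case: l => [j|l]; last exact: Fc.
  apply: continuous_prod => k.
  have -> : (fun p : X * 'rV[C]_(n * d) => vec_mx p.2 j k - 1 : C) = fun p => p.2 0 (mxvec_index
    j k) - 1.
    by apply/funext => q; rewrite mxE.
  apply: continuous_add; last exact: cst_continuous.
  move=> p; apply: (@cvg_comp _ _ _ snd (fun v : 'rV[C]_(n * d) => v 0 (mxvec_index j k)));
    first exact: cvg_snd.
  exact: coord_continuous.
have [x' /AF[L L0 FL]|v Qv Gv] := @closure_exists C X 'rV[C]_(n * d) _ A Q G x cQ Gc _ clx.
  have [j|k kP] := choice (P := fun j k => L j 0 k != 0 /\ forall i, `|L j 0 i / L j 0 k| <= 1).
    by have [k] := max_norm (L0 j); exists k.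
  exists (mxvec (\matrix_(j, i) (L j 0 i / L j 0 (k j)))).
    move=> m; apply: normc_le1_square; case/mxvec_indexP: m => j i.
    by rewrite mxvecE mxE; exact: (kP j).2.
  case=> [j|l] /=; rewrite mxvecK.
    by rewrite (bigD1 (k j))//= mxE divff ?subrr ?mul0r ?(kP j).1.
  rewrite (_ : (fun _ => _) = fun j => (L j 0 (k j))^-1 *: L j); first apply: FZ => // j.
    by rewrite invr_eq0 (kP j).1.
  by apply/funext => j; apply/rowP => i; rewrite !mxE mulrC.
exists (fun j => row j (vec_mx v)) => [j|l]; last exact: (Gv (inr l)).
apply/negP => /eqP vj; have /eqP/prodf_eq0[k _] := Gv (inl j).
have /rowP/(_ k) := vj; rewrite mxE [in RHS]mxE => ->.
by rewrite sub0r oppr_eq0 oner_eq0.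
Qed.
End Compactness.

(** * Obstructions by products of linear forms *)

Section LinearForms.
Variable K : numFieldType.

Lemma poly_nonroot (p : {poly K}) : p != 0 -> exists x, p.[x] != 0.
Proof.
move=> p0; apply: contrapT => H.
have rt x : root p x by apply: contrapT => /negP Hx; apply: H; exists x.
have := @max_poly_roots _ p [seq i%:R | i <- iota 0 (size p)] p0.
rewrite size_map size_iota ltnn => E; suff : false by []; apply: E; first by apply/allP => x _.
by rewrite map_inj_uniq ?iota_uniq// => i j /eqP; rewrite eqr_nat => /eqP.
Qed.

Lemma horner_ext (p q : {poly K}) : (forall x, p.[x] = q.[x]) -> p = q.
Proof.
move=> pq; apply: contrapT => /eqP; rewrite -subr_eq0 => /poly_nonroot[x].
by rewrite hornerD hornerN pq subrr eqxx.
Qed.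

Definition dotp (l x : 'rV[K]_5) : K := \sum_i l 0 i * x 0 i.

Lemma dotpZl s l x : dotp (s *: l) x = s * dotp l x.
Proof. by rewrite /dotp mulr_sumr; apply: eq_bigr => i _; rewrite mxE mulrA. Qed.

Lemma dotp_line l x y t : dotp l (x + t *: y) = dotp l x + t * dotp l y.
Proof.
rewrite /dotp mulr_sumr -big_split; apply: eq_bigr => i _ /=; rewrite !mxE; ring.
Qed.

Definition formprod (ms : seq nat) (L : 'I_(size ms) -> 'rV[K]_5) x : K :=
  \prod_(j < size ms) dotp (L j) x ^+ nth 0%N ms j.

Lemma formprodZ ms L (s : 'I_(size ms) -> K) x :
  formprod (fun j => s j *: L j) x = (\prod_j s j ^+ nth 0%N ms j) * formprod L x.
Proof.
by rewrite /formprod -big_split; apply: eq_bigr => j _; rewrite dotpZl exprMn.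
Qed.

(** On the curve (1, t, ..., t^4) a nonzero linear form is a nonzero polynomial in t, so a value of
    t that is not a root of the product gives the point. *)
Lemma formprod_neq0 ms (L : 'I_(size ms) -> 'rV[K]_5) :
  (forall j, L j != 0) -> exists x, formprod L x != 0.
Proof.
move=> L0; have rE l t : (rVpoly l).[t] = dotp l (\row_i t ^+ i).
  by rewrite /rVpoly horner_poly; apply: eq_bigr => i _; rewrite valK mxE.
have [|t tP] := @poly_nonroot (\prod_j rVpoly (L j) ^+ nth 0%N ms j).
  apply/prodf_neq0 => j _; apply: expf_neq0; apply: contra (L0 j) => /eqP Lj.
  by rewrite -[L j]rVpolyK Lj linear0.
exists (\row_i t ^+ i); rewrite /formprod; apply/prodf_neq0 => j _.
move: tP; rewrite horner_prod => /prodf_neq0/(_ j isT).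
by rewrite horner_exp rE.
Qed.

Definition splits (ms : seq nat) (f : 'rV[K]_5 -> K) :=
  exists c L, forall x, f x = c * formprod (ms := ms) L x.

(* On a line, a product of linear forms has the multiplicities of its factors
   as root multiplicities. *)
Lemma splits_line ms f x y c (rs : seq K) : splits ms f -> c != 0 ->
    (forall t, f (x + t *: y) = c * \prod_(r <- rs) (t - r)) ->
  exists rho : 'I_(size ms) -> K -> bool,
    (forall j r r', rho j r -> rho j r' -> r = r') /\
    forall r, count_mem r rs = (\sum_(j < size ms) nth 0 ms j * rho j r)%N.
Proof.
move=> [d [L fE]] c0 fl.
pose P j : {poly K} := (dotp (L j) x)%:P + dotp (L j) y *: 'X.
have PE j t : (P j).[t] = dotp (L j) (x + t *: y).
  by rewrite dotp_line /P hornerD hornerC hornerZ hornerX mulrC.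
pose W := \prod_j P j ^+ nth 0%N ms j.
have DE : c *: \prod_(r <- rs) ('X - r%:P) = d *: W.
  apply: horner_ext => t; rewrite !hornerZ horner_prod.
  under eq_bigr do rewrite hornerXsubC.
  rewrite -fl fE /formprod horner_prod; congr (_ * _).
  by apply: eq_bigr => j _; rewrite horner_exp PE.
have q0 : \prod_(r <- rs) ('X - r%:P) != 0 by rewrite monic_neq0 ?monic_prod_XsubC.
have dW0 : d *: W != 0 by rewrite -DE scaler_eq0 negb_or c0.
have [d0 W0] : d != 0 /\ W != 0 by move: dW0; rewrite scaler_eq0 negb_or => /andP.
have mupZ (a : K) (p : {poly K}) r : a != 0 -> mup r (a *: p) = mup r p.
  by move=> a0; rewrite -mul_polyC mupMr// rootC.
have mupX r (p : {poly K}) n : p != 0 -> mup r (p ^+ n) = (n * mup r p)%N.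
  move=> p0; elim: n => [|n IH]; first by rewrite expr0 mupNroot// root1.
  by rewrite exprS mupM ?expf_neq0// IH mulSn.
have P0 (j : 'I_(size ms)) : (0 < nth 0%N ms j)%N -> P j != 0.
  move=> m0; move: W0 => /prodf_neq0/(_ j isT); apply: contra => /eqP ->.
  by rewrite expr0n eqn0Ngt m0.
(* On the line each factor is a polynomial of degree at most 1: it has at most one root, and none if
   it is a nonzero constant. *)
exists (fun j r => (P j != 0) && root (P j) r); split.
  move=> j r r' /andP[Pj rt] /andP[_ rt']; apply: contrapT => /eqP rr'.
  have := @max_poly_roots _ (P j) [:: r; r'] Pj; rewrite /= rt rt' inE rr' => /(_ isT isT).
  rewrite ltnNge => /negP; apply; rewrite /P addrC.
  by rewrite -mul_polyC size_MXaddC; case: ifP => // _; rewrite ltnS; exact: size_polyC_leq1.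
move=> r; rewrite -mu_prod_XsubC -(mupZ c)// DE mupZ//.
have : W != 0 by []. 
rewrite /W; elim: (index_enum _) => [|j s IH]; first by rewrite !big_nil mupNroot// root1.
rewrite !big_cons mulf_eq0 negb_or => /andP[Pj /[dup] /IH <- s0]; rewrite mupM//; congr (_ + _)%N.
case: (posnP (nth 0%N ms j)) => [->|m0]; first by rewrite expr0 mupNroot ?root1.
rewrite mupX ?P0//=; congr (_ * _)%N; case rt: (root (P j) r) => /=; last by rewrite mupNroot ?rt.
have /factor_theorem[q qE] := rt; have q0' : q != 0.
  by apply: contra (P0 _ m0) => /eqP q0'; rewrite qE q0' mul0r.
have : (size (P j) <= 2)%N.
  by rewrite /P addrC -mul_polyC size_MXaddC; case: ifP => // _; rewrite ltnS;
    exact: size_polyC_leq1.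
rewrite qE size_Mmonic ?monicXsubC// size_XsubC addn2 /= ltnS => /size1_polyC qc.
rewrite [q]qc mul_polyC mupZ; last by apply: contra q0' => /eqP qc0; rewrite qc qc0.
by rewrite (@mup_XsubCX _ 1) eqxx.
Qed.
End LinearForms.

Section FormContinuity.
Variables (K : numFieldType) (X : topologicalType).

Lemma continuous_exp (Z : topologicalType) n (f : Z -> K) : continuous f -> continuous (fun x =>
  f x ^+ n).
Proof.
move=> fc; elim: n => [|n IH].
  by under eq_fun do rewrite expr0; exact: cst_continuous.
by under eq_fun do rewrite exprS; exact: continuous_mul.
Qed.

Lemma continuous_fst (Y : topologicalType) (f : X -> K) : continuous f ->
  continuous (fun p : X * Y => f p.1).
Proof. by move=> fc p; apply: (@cvg_comp _ _ _ fst f); [exact: cvg_fst | exact: fc]. Qed.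

Lemma continuous_snd_entry n (k : 'I_n) : continuous (fun p : X * 'rV[K]_n => p.2 0 k).
Proof.
move=> p; apply: (@cvg_comp _ _ _ snd (fun v : 'rV[K]_n => v 0 k)); first exact: cvg_snd.
exact: coord_continuous.
Qed.

Lemma formprod_continuous ms v :
  continuous (fun p : X * 'rV[K]_(size ms * 5) =>
    formprod (ms := ms) (fun j => row j (vec_mx p.2)) v).
Proof.
apply: continuous_prod => j.
apply: (@continuous_exp (X * 'rV[K]_(size ms * 5))%type _ (fun p => dotp (row j (vec_mx p.2)) v)).
apply: continuous_sum => k; apply: continuous_mul; last exact: cst_continuous.
rewrite (_ : (fun _ => _) = fun p : X * 'rV[K]_(size ms * 5) => p.2 0 (mxvec_index j k)).
  exact: continuous_snd_entry.
by apply/funext => q; rewrite !mxE.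
Qed.

Lemma continuous_cross (Z : topologicalType) (f g f' g' : Z -> K) :
    continuous f -> continuous g -> continuous f' -> continuous g' ->
  continuous (fun x => f x * g x - f' x * g' x).
Proof.
by move=> *; apply: continuous_add; last apply: continuous_opp; apply: continuous_mul.
Qed.
End FormContinuity.

Section SplitClosure.
Variables (R : realType) (X : topologicalType).
Local Notation C := (Cplx R).

Lemma closure_splits ms (A : set X) (f : X -> 'rV[C]_5 -> C) x : 0%N \notin ms ->
    (forall y, continuous (fun x => f x y)) ->
    (forall x', A x' -> splits ms (f x')) -> closure A x -> (exists y, f x y != 0) ->
  splits ms (f x).
Proof.
move=> ms0 fc As clx [y0 fy0].
have ms_gt0 (j : 'I_(size ms)) : (0 < nth 0%N ms j)%N.
  by rewrite lt0n; apply: contra ms0 => /eqP <-; rewrite mem_nth.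
(* Proportionality to the product of the forms is written by cross products, which eliminates the
   unbounded scalar [c] and leaves equations homogeneous in each form. *)
pose F (u : 'rV[C]_5 * 'rV[C]_5) x (L : 'I_(size ms) -> 'rV[C]_5) : C :=
  f x u.1 * formprod L u.2 - f x u.2 * formprod L u.1.
have sc (v : 'rV[C]_5) := @formprod_continuous C X ms v.
have fc' v : continuous (fun p : X * 'rV[C]_(size ms * 5) => f p.1 v).
  exact: (@continuous_fst C X _ (fun x => f x v) (fc v)).
have [l||x' /As[c [L fE]]|L L0 FL] := @closure_projective R X (size ms) 5 A _ F x _ _ _ clx.
- exact: (@continuous_cross C (X * 'rV[C]_(size ms * 5))%type _ _ _ _ (fc' l.1) (sc l.2) (fc'
  l.2) (sc l.1)).
- move=> l x' L s s0 FL; rewrite /F !formprodZ; set q := \prod_j _.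
  by rewrite mulrCA [f x' l.2 * _]mulrCA -mulrBr [X in _ * X]FL mulr0.
(* If one of the forms vanishes, so does the function, since all multiplicities are positive; any
   nonzero forms then satisfy the equations. *)
- have [/forallP L0|] := boolP [forall j, L j != 0].
    by exists L => // -[v w]; rewrite /F /= !fE; ring.
  rewrite negb_forall => /existsP[j /negPn/eqP Lj]; exists (fun=> const_mx 1) => [_|[v w]].
    by apply/rV0Pn; exists 0; rewrite mxE oner_eq0.
  have f0 u : f x' u = 0.
    rewrite fE /formprod (bigD1 j)//= Lj /dotp big1 ?expr0n ?eqn0Ngt ?ms_gt0 ?mul0r ?mulr0//.
    by move=> k _; rewrite mxE mul0r.
  by rewrite /F /= !f0 !mul0r subrr.
have [y1 Ly1] := formprod_neq0 L0.
exists (f x y1 / formprod L y1), L => y; have /eqP := FL (y, y1).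
rewrite /F /= subr_eq0 => /eqP E; apply: (mulIf Ly1); rewrite E.
by rewrite mulrAC divfK.
Qed.
End SplitClosure.

(** * Determinants of slices and of bordered slices *)

Section Bordered.
Variables (K : numFieldType) (r : nat).
Implicit Types (T : tns K) (x : 'rV[K]_5).

Definition slice T x : 'M[K]_5 := \matrix_(j, k) tri T x (dl K j) (dl K k).

(* For r = 1 the determinant is, up to sign, the value at the pair (A, B) of the
   adjugate of the slice. *)
Definition bdet (B : 'M[K]_(5, r)) (A : 'M[K]_(r, 5)) T x : K :=
  \det (block_mx (slice T x) B A 0).

Lemma tri_slice T x b c : tri T x b c = (b *m slice T x *m c^T) 0 0.
Proof.
apply/eqP; rewrite -subr_eq0; apply/eqP.
apply: (linear_eq0 (F := fun b => tri T x b c - (b *m slice T x *m c^T) 0 0)) => [s d d'|j].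
  by rewrite triP2 !mulmxDl -!scalemxAl !mxE; ring.
apply: (linear_eq0 (F := fun c => tri T x (dl K j) c - (dl K j *m slice T x *m c^T) 0 0)) => [s
  d d'|k].
  by rewrite triP3 linearP/= mulmxDr -scalemxAr !mxE; ring.
by rewrite trmx_delta -rowE -colE !mxE subrr.
Qed.

(** A slice of [T'] is a slice of [T] multiplied by [g2] on the left and by the transpose of [g3] on
    the right; extended by 1 to the bordered matrix, these factors are compensated on the borders by
    their inverses. *)
Lemma bdet_act T T' g1 g2 g3 B A x : g2 \in unitmx -> g3 \in unitmx ->
    (forall a b c, tri T' a b c = tri T (a *m g1) (b *m g2) (c *m g3)) ->
  bdet B A T' x = \det g2 * \det g3 * bdet (invmx g2 *m B) (A *m invmx g3^T) T (x *m g1).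
Proof.
move=> u2 u3 TT'; have sE : slice T' x = g2 *m slice T (x *m g1) *m g3^T.
  apply/matrixP => j k; rewrite mxE TT' tri_slice trmx_mul trmx_delta !mulmxA -colE.
  by rewrite -!mulmxA -rowE mxE mxE.
rewrite /bdet; have -> : block_mx (slice T' x) B A 0 = block_mx g2 0 0 1%:M *m
    block_mx (slice T (x *m g1)) (invmx g2 *m B) (A *m invmx g3^T) 0 *m
    block_mx g3^T 0 0 1%:M :> 'M[K]_(5 + r).
  rewrite !(mulmx_block, mulmx0, mul0mx, mulmx1, mul1mx, addr0, add0r).
  by rewrite mulKVmx// mulmxKV ?unitmx_tr// sE.
by rewrite !det_mulmx !det_ublock !det1 !mulr1 det_tr; ring.
Qed.
End Bordered.

Section BorderedTensor.
Variables (R : realType) (r : nat).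
Local Notation C := (Cplx R).
Local Notation tensor := (tensor R).

Lemma bdet_continuous (B : 'M[C]_(5, r)) A x : continuous (fun T : tensor => bdet B A T x).
Proof.
apply: continuous_det => i j.
case: (split_ordP i) => i' ->; case: (split_ordP j) => j' ->.
- by under eq_fun do rewrite block_mxEul mxE; exact: tri_continuous.
- by under eq_fun do rewrite block_mxEur; exact: cst_continuous.
- by under eq_fun do rewrite block_mxEdl; exact: cst_continuous.
by under eq_fun do rewrite block_mxEdr; exact: cst_continuous.
Qed.

Lemma bdet_degenerates ms (T S : tensor) : 0%N \notin ms ->
    (forall (B : 'M[C]_(5, r)) A, splits ms (bdet B A T)) -> degenerates T S ->
  forall (B : 'M[C]_(5, r)) A, (exists x, bdet B A S x != 0) -> splits ms (bdet B A S).
Proof.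
move=> ms0 Ts TS B A; apply: closure_splits TS => // [y|_ [g1 [g2 [g3 [u1 u2 u3 ->]]]]].
  exact: bdet_continuous.
have [c [L fE]] := Ts (invmx g2 *m B) (A *m invmx g3^T).
exists (\det g2 * \det g3 * c), (fun j => L j *m g1^T) => x.
rewrite (bdet_act _ _ _ u2 u3 (@tri_act R g1 g2 g3 T)) fE mulrA; congr (_ * _).
apply: eq_bigr => j _; congr (_ ^+ _); rewrite /dotp.
transitivity ((L j *m (x *m g1)^T) 0 0); first by rewrite mxE; apply: eq_bigr => i _;
  rewrite [in RHS]mxE.
by rewrite trmx_mul mulmxA mxE; apply: eq_bigr => i _; congr (_ * _); rewrite mxE.
Qed.
End BorderedTensor.

(** * Polynomials with integer coefficients, by computation *)

Definition pol := seq (Z * seq nat).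

Fixpoint pins (t : Z * seq nat) (p : pol) : pol :=
  if p is u :: p' then
    if t.2 == u.2 then ((t.1 + u.1)%BZ, u.2) :: p' else u :: pins t p'
  else [:: t].

Definition padd (p q : pol) : pol := foldr pins q p.

(** A monomial is the list of its variables, repeated according to their exponents. Sorting makes
    equal monomials identical, so that [pins] merges them; zero coefficients may remain, whence
    [pzero]. *)
Definition pmul (p q : pol) : pol :=
  foldr (fun t a => foldr (fun u => pins ((t.1 * u.1)%BZ, sort leq (t.2 ++ u.2))) a q) [::] p.

Arguments padd : simpl never.
Arguments pmul : simpl never.

Definition pconst (c : Z) : pol := [:: (c, [::])].
Definition pvar (n : nat) : pol := [:: (1%BZ, [:: n])].
Definition pzero (p : pol) : bool := all (fun t => Z.eqb t.1 0) p.

(** Laplace expansion along the first row; an entry that is the empty list spares the computation of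
    its minor, which matters for such sparse matrices. *)
Fixpoint detp (n : nat) (f : nat -> nat -> pol) : pol :=
  if n isn't n'.+1 then pconst 1 else
  foldr (fun j a => if f 0%N j is [::] then a else
    padd (pmul (pmul (pconst (if odd j then -1 else 1)%BZ) (f 0%N j))
               (detp n' (fun i k => f i.+1 (bump j k)))) a) [::] (iota 0 n).

Section Evaluation.
Variable K : numFieldType.
Implicit Types (e : nat -> K) (p q : pol).

Definition peval e p : K := \sum_(t <- p) zK K t.1 * \prod_(i <- t.2) e i.

Lemma peval_nil e : peval e [::] = 0.
Proof. by rewrite /peval big_nil. Qed.

Lemma peval_cons e t p : peval e (t :: p) = zK K t.1 * \prod_(i <- t.2) e i + peval e p.
Proof. by rewrite /peval big_cons. Qed.

Lemma peval_pins e t p : peval e (pins t p) = zK K t.1 * \prod_(i <- t.2) e i + peval e p.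
Proof.
elim: p => [|u p IH] /=; first by rewrite peval_cons.
by case: eqP => [->|_]; rewrite !peval_cons /= ?zKD ?IH; ring.
Qed.

Lemma peval_padd e p q : peval e (padd p q) = peval e p + peval e q.
Proof.
elim: p => [|t p IH]; first by rewrite peval_nil add0r.
by rewrite -[padd _ _]/(pins t (padd p q)) peval_pins peval_cons -addrA IH.
Qed.

Lemma peval_pmul e p q : peval e (pmul p q) = peval e p * peval e q.
Proof.
elim: p => [|t p IH]; first by rewrite !peval_nil mul0r.
rewrite -[pmul (t :: p) q]/(foldr (fun u => pins ((t.1 * u.1)%BZ,
  sort leq (t.2 ++ u.2))) (pmul p q) q) peval_cons mulrDl -IH.
move: (pmul p q) => a {IH}; elim: q => [|u q IH] /=; first by rewrite peval_nil mulr0 add0r.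
rewrite peval_pins IH peval_cons /= zKM (perm_big _ (permEl (perm_sort _ _))) big_cat /=.
ring.
Qed.

Lemma peval_const e c : peval e (pconst c) = zK K c.
Proof. by rewrite peval_cons peval_nil big_nil mulr1 addr0. Qed.

Lemma peval_var e n : peval e (pvar n) = e n.
Proof. by rewrite peval_cons peval_nil big_seq1 zK1 mul1r addr0. Qed.

Lemma peval_pzero e p : pzero p -> peval e p = 0.
Proof.
move=> /allP p0; rewrite /peval big_seq big1// => t /p0/Z.eqb_spec ->.
by rewrite zK0 mul0r.
Qed.

Lemma peval_detp e n f :
  peval e (detp n f) = \det (\matrix_(i < n, j < n) peval e (f i j)).
Proof.
elim: n f => [|n IH] f; first by rewrite det_mx00 peval_const.
rewrite (expand_det_row _ ord0).
have foldE l : peval e (foldr (fun j a => if f 0%N j is [::] then a else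
    padd (pmul (pmul (pconst (if odd j then -1 else 1)%BZ) (f 0%N j))
               (detp n (fun i k => f i.+1 (bump j k)))) a) [::] l) =
    \sum_(j <- l) peval e (f 0%N j) * ((-1) ^+ j *
      \det (\matrix_(i < n, k < n) peval e (f i.+1 (bump j k)))).
  elim: l => [|j l IHl]; first by rewrite big_nil peval_nil.
  rewrite big_cons -IHl /=; case E: (f 0%N j) => [|t p]; first by rewrite peval_nil mul0r add0r.
  rewrite peval_padd !peval_pmul peval_const IH -signr_odd.
  have zKm1 : zK K (-1)%BZ = -1 by rewrite -[(-1)%BZ]/(Z.opp 1) zKN zK1.
  by case: (odd j) => /=; rewrite ?zKm1 ?zK1 ?expr1 ?expr0; ring.
rewrite [LHS]foldE -/(index_iota 0 n.+1) big_mkord; apply: eq_bigr => j _.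
rewrite mxE /cofactor add0n; congr (_ * (_ * \det _)).
by apply/matrixP => i k; rewrite !mxE.
Qed.

(** [X] gives the coordinates of the point at 0 to 4, the entries of the column border at 5 to 9 and
    those of the row border at 10 to 14. The single numbering serves borders of size at most 1. *)
Definition bentry (t : ztns) (X : nat -> pol) (i j : nat) : pol :=
  if (i < 5)%N then
    if (j < 5)%N then foldr (fun k a => if Z.eqb (t k i j) 0 then a else
      padd (pmul (pconst (t k i j)) (X k)) a) [::] (iota 0 5)
    else X (5 + i)%N
  else if (j < 5)%N then X (10 + j)%N else [::].

Lemma peval_bentry e r (t : ztns) (X : nat -> pol) (T : tns K) (x : 'rV[K]_5) (B : 'M[K]_(5,
  r)) (A : 'M[K]_(r, 5)) :
    (forall i j k : 'I_5, T i j k = zK K (t i j k)) ->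
    (forall k : 'I_5, x 0 k = peval e (X k)) ->
    (forall (i : 'I_5) j, B i j = peval e (X (5 + nat_of_ord i)%N)) ->
    (forall j (i : 'I_5), A j i = peval e (X (10 + nat_of_ord i)%N)) ->
  peval e (detp (5 + r) (bentry t X)) = bdet B A T x.
Proof.
move=> Tt xX BX AX; rewrite peval_detp; congr (\det _); apply/matrixP => i j; rewrite mxE /bentry.
case: (split_ordP i) => i' ->; case: (split_ordP j) => j' ->.
- rewrite block_mxEul mxE.
  have foldE l : peval e (foldr (fun k a => if Z.eqb (t k i' j') 0 then a else
      padd (pmul (pconst (t k i' j')) (X k)) a) [::] l) =
      \sum_(k <- l) peval e (X k) * zK K (t k i' j').
    elim: l => [|k l IH]; first by rewrite big_nil peval_nil.
    rewrite big_cons -IH /=; case: Z.eqb_spec => [->|_]; first by rewrite zK0 mulr0 add0r.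
    by rewrite peval_padd peval_pmul peval_const mulrC.
  rewrite foldE -/(index_iota 0 5) big_mkord /tri; apply: eq_bigr => k _.
  rewrite -Tt -xX -(sum_dl (fun j0 => x 0 k * T k j0 j') i').
  apply: eq_bigr => j0 _; rewrite -(sum_dl (fun k0 => x 0 k * T k j0 k0) j') mulr_sumr.
  by apply: eq_bigr => k0 _; ring.
- by rewrite block_mxEur.
- by rewrite block_mxEdl.
by rewrite block_mxEdr mxE peval_nil.
Qed.

Fixpoint pexp (p : pol) (n : nat) : pol := if n is m.+1 then pmul p (pexp p m) else pconst 1.

Lemma peval_pexp e p n : peval e (pexp p n) = peval e p ^+ n.
Proof.
by elim: n => [|n IH]; rewrite ?expr0 ?exprS /= ?peval_const// peval_pmul IH.
Qed.

Definition psum (l : seq pol) : pol := foldr padd [::] l.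

Lemma peval_psum e l : peval e (psum l) = \sum_(p <- l) peval e p.
Proof.
by elim: l => [|p l IH]; rewrite ?big_nil ?peval_nil// big_cons /= peval_padd IH.
Qed.

Definition pprod (l : seq pol) : pol := foldr pmul (pconst 1) l.

Lemma peval_pprod e l : peval e (pprod l) = \prod_(p <- l) peval e p.
Proof.
by elim: l => [|p l IH]; rewrite ?big_nil ?peval_const// big_cons /= peval_pmul IH.
Qed.

Definition peq (p q : pol) : bool := pzero (padd p (pmul (pconst (-1)) q)).

Lemma peval_peq e p q : peq p q -> peval e p = peval e q.
Proof.
move/(peval_pzero e); rewrite peval_padd peval_pmul peval_const.
rewrite -[(-1)%BZ]/(Z.opp 1) zKN zK1 mulN1r => /eqP.
by rewrite subr_eq0 => /eqP.
Qed.

Lemma peval_ext e e' p : all (fun t => all (leq 5) t.2) p ->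
  (forall n, (5 <= n)%N -> e n = e' n) -> peval e p = peval e' p.
Proof.
move=> /allP p5 ee'; rewrite /peval !big_seq; apply: eq_bigr => t /p5/allP t5.
by congr (_ * _); rewrite !big_seq; apply: eq_bigr => i /t5/ee'.
Qed.
End Evaluation.

(* A linear form is the list of its coefficients, which are polynomials in the
   entries of the borders. *)
Definition pform (l : seq pol) : pol := psum [seq pmul (pvar k) (nth [::] l k) | k <- iota 0 5].

(* Label, permutations and size of the border; scalar, multiplicities and linear
   forms of the product. *)
Definition split_data := ((label * seq (nat * nat * nat) * nat) * (Z * seq nat * seq (seq
  pol)))%type.

(** The coefficients of the forms may involve only variables from 5 on, those of the borders: once
    the borders are fixed, the factors are linear in the point. *)
Definition split_valid (d : split_data) : bool :=
  let: ((u, ps, r), (c, ms, forms)) := d in let t := table u in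
  [&& (r <= 1)%N, 0%N \notin ms, all (all (all (fun m => all (leq 5) m.2))) forms &
   all (fun p => (p \in perms6) && peq (detp (5 + r) (bentry (zpermn p (lookup t)) pvar))
    (pmul (pconst c) (pprod [seq pexp (pform (nth [::] forms j)) (nth 0%N ms j) | j <- iota 0
      (size ms)]))) ps].

(* Label, permutation and size of the border; base point, direction, scalar and
   roots on the line. *)
Definition line_data := ((label * (nat * nat * nat) * nat) * (seq Z * seq Z * Z * seq Z))%type.

(* The point of parameter t is x + t y; the entries of x of index at least 5
   are those of the borders. *)
Definition line_point (x y : seq Z) (n : nat) : pol :=
  padd (pconst (nth 0%BZ x n))
    (if (n < 5)%N then pmul (pconst (nth 0%BZ y n)) (pvar 0) else [::]).

Definition line_valid (d : line_data) : bool :=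
  let: ((v, q, r), (x, y, c, rs)) := d in
  [&& q \in perms6, ~~ Z.eqb c 0 &
   let t := table v in peq (detp (5 + r) (bentry (zpermn q (lookup t)) (line_point x y)))
    (pmul (pconst c) (pprod [seq padd (pvar 0) (pconst (- s)) | s <- rs]))].

(* Whether linear factors of multiplicities [ms], some of them without root on the
   line, can account for roots of multiplicities [cnts]. *)
Fixpoint fits (ms cnts : seq nat) : bool :=
  if ms is m :: ms' then
    fits ms' cnts || has (fun i => (m <= nth 0 cnts i)%N && fits ms' (set_nth 0%N cnts i (nth
      0%N cnts i - m)%N))
      (iota 0 (size cnts))
  else all (eq_op 0%N) cnts.

Lemma fitsP ms cnts (rho : nat -> nat -> bool) :
    (forall j i i', (i < size cnts)%N -> (i' < size cnts)%N -> rho j i -> rho j i' -> i = i') ->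
    (forall i, (i < size cnts)%N -> nth 0%N cnts i = (\sum_(j < size ms) nth 0 ms j * rho j
      i)%N) ->
  fits ms cnts.
Proof.
elim: ms cnts rho => [|m ms IH] cnts rho inj_rho cE /=.
  by apply/(all_nthP 0%N) => i /cE ->; rewrite big_ord0.
have cE' i : (i < size cnts)%N ->
    nth 0%N cnts i = (m * rho 0 i + \sum_(j < size ms) nth 0 ms j * rho j.+1 i)%N.
  by move=> /cE ->; rewrite big_ord_recl.
(* Either the first factor has its root at one of the counted places, and its multiplicity is
   removed there, or it has none and is dropped. *)
have [/hasP[l]|no] := boolP (has (rho 0%N) (iota 0 (size cnts))).
  rewrite mem_iota /= => ilt ri; apply/orP; right; apply/hasP; exists l;
    rewrite ?mem_iota// cE'// ri muln1 leq_addr /=.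
  have {1}-> : (m + \sum_(j < size ms) nth 0 ms j * rho j.+1 l)%N = nth 0%N cnts l.
    by rewrite cE' // ri muln1.
  have sz : size (set_nth 0%N cnts l (nth 0%N cnts l - m)%N) = size cnts.
    by rewrite size_set_nth; apply/maxn_idPr.
  apply: (IH _ (fun j => rho j.+1)) => [j k k'|k]; rewrite sz; first exact: inj_rho.
  move=> klt; rewrite nth_set_nth /=; case: eqP => [->|ki].
    by rewrite cE' // ri muln1 addKn.
  rewrite cE' // [rho _ _](_ : _ = false) ?muln0//.
  by apply/negP => rk; apply: ki; apply: (inj_rho 0%N).
apply/orP; left; apply: (IH _ (fun j => rho j.+1)) => [j|i ilt]; first exact: inj_rho.
rewrite cE' // [rho _ _](_ : _ = false) ?muln0//; apply: negbTE; apply: contra no => ri.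
by apply/hasP; exists i; rewrite ?mem_iota.
Qed.

(** Border size 0 gives the determinants of the slices in the three directions, two permutations at
    a time since transposing a slice does not change its determinant. In the last two entries, with
    border size 1, the bordered determinant is up to sign the square of a coordinate times one form
    depending on the column border and one on the row border. *)
Definition splittings : seq split_data := let z := [::] : pol in let o := pconst 1 in [::
  ((T2_1, [:: (0, 1, 2); (0, 2, 1)]%N, 0%N), (1, [:: 3; 2]%N,
    [:: [:: o]; [:: o; z; z; z; o]]));
  ((T2_1, [:: (1, 0, 2); (2, 0, 1)]%N, 0%N), (-1, [:: 3; 2]%N,
    [:: [:: o]; [:: z; z; z; o]]));
  ((T2_1, [:: (1, 2, 0); (2, 1, 0)]%N, 0%N), (-1, [:: 3; 2]%N,
    [:: [:: z; z; o]; [:: z; z; z; z; o]]));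
  ((T2_3, [:: (0, 1, 2); (0, 2, 1)]%N, 0%N), (1, [:: 4; 1]%N,
    [:: [:: o]; [:: o; z; z; z; o]]));
  ((T2_3, [:: (1, 0, 2); (2, 0, 1)]%N, 0%N), (1, [:: 4; 1]%N,
    [:: [:: o]; [:: z; z; z; z; o]]));
  ((T2_3, [:: (1, 2, 0); (2, 1, 0)]%N, 0%N), (1, [:: 4; 1]%N,
    [:: [:: z; z; z; o]; [:: z; z; z; z; o]]));
  ((T3_3, [:: (0, 1, 2); (0, 2, 1)]%N, 0%N), (1, [:: 1; 2; 2]%N,
    [:: [:: o; z; z; z; o]; [:: o]; [:: o; z; z; o]]));
  ((T3_3, [:: (1, 0, 2); (2, 0, 1)]%N, 0%N), (-1, [:: 1; 2; 2]%N,
    [:: [:: z; z; z; z; o]; [:: o]; [:: z; z; o]]));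
  ((T3_3, [:: (1, 2, 0); (2, 1, 0)]%N, 0%N), (-1, [:: 1; 2; 2]%N,
    [:: [:: z; z; z; z; o]; [:: z; o]; [:: z; z; z; o]]));
  ((T3_1, [:: (0, 1, 2); (0, 2, 1)]%N, 0%N), (1, [:: 1; 1; 3]%N,
    [:: [:: o; z; z; o]; [:: o; z; z; z; o]; [:: o]]));
  ((T3_1, [:: (1, 0, 2); (2, 0, 1)]%N, 0%N), (1, [:: 1; 1; 3]%N,
    [:: [:: z; z; z; o]; [:: z; z; z; z; o]; [:: o]]));
  ((T3_1, [:: (1, 2, 0); (2, 1, 0)]%N, 0%N), (-1, [:: 1; 1; 3]%N,
    [:: [:: z; z; z; o]; [:: z; z; z; z; o]; [:: z; z; o]]));
  ((T4_1, [:: (0, 1, 2); (0, 2, 1)]%N, 0%N), (1, [:: 1; 1; 1; 2]%N,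
    [:: [:: o; z; o]; [:: o; z; z; o]; [:: o; z; z; z; o]; [:: o]]));
  ((T4_1, [:: (1, 0, 2); (2, 0, 1)]%N, 0%N), (1, [:: 1; 1; 1; 2]%N,
    [:: [:: z; z; o]; [:: z; z; z; o]; [:: z; z; z; z; o]; [:: o]]));
  ((T4_1, [:: (1, 2, 0); (2, 1, 0)]%N, 0%N), (-1, [:: 1; 1; 1; 2]%N,
    [:: [:: z; z; o]; [:: z; z; z; o]; [:: z; z; z; z; o]; [:: z; o]]));
  ((T2_2, [:: (1, 2, 0); (2, 1, 0)]%N, 1%N), (1, [:: 2; 1; 1]%N,
    [:: [:: z; z; z; z; o]; [:: z; [:: (1, [:: 7%N])]; [:: (-1, [:: 6%N])]]; [:: z;
      [:: (1, [:: 12%N])]; [:: (-1, [:: 11%N])]]]));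
  ((T1_5, [:: (1, 2, 0); (2, 1, 0)]%N, 1%N), (-1, [:: 2; 1; 1]%N,
    [:: [:: z; z; z; z; o]; [:: z; z; z; [:: (1, [:: 9%N])]; [:: (-1, [:: 8%N])]]; [:: z; z; z;
      [:: (1, [:: 14%N])]; [:: (-1, [:: 13%N])]]]))]%BZ.

(** Missing coordinates of a direction are 0. The last two lines have three simple roots, which
    multiplicities 2, 1, 1 cannot produce: the double factor would have no root there, and the two
    others account for at most two. *)
Definition lines : seq line_data := [::
  ((T2_6, (0, 1, 2)%N, 0%N), ([:: 0; 0; 0; 0; 1], [:: 1], 1, [:: 0; 0; 0; 0; (-1)]));
  ((T2_8, (0, 1, 2)%N, 0%N), ([:: 0; 0; 0; 0; 1], [:: 1], 1, [:: 0; 0; 0; 0; (-1)]));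
  ((T2_2, (0, 1, 2)%N, 0%N), ([:: 0; 0; 0; 0; 1], [:: 1], 1, [:: 0; 0; 0; (-1); (-1)]));
  ((T3_2, (0, 1, 2)%N, 0%N), ([:: 0; 0; 0; 1; 2], [:: 1], 1, [:: 0; 0; 0; (-1); (-2)]));
  ((T3_3, (0, 1, 2)%N, 0%N), ([:: 0; 0; 0; 1; 2], [:: 1], 1, [:: 0; 0; (-1); (-1); (-2)]));
  ((T5_1, (0, 1, 2)%N, 0%N), ([:: 0; 1; 2; 3; 4], [:: 1], 1, [:: 0; (-1); (-2); (-3); (-4)]));
  ((T1_4, (1, 2, 0)%N, 1%N), ([:: 0; 0; 0; 0; 1; 0; 0; 1; 0; 1; 0; 0; 2; 0; 1], [:: 0; 0;
    1], 1, [:: 0; 1; 2]));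
  ((T1_13, (1, 2, 0)%N, 1%N), ([:: 0; 0; 0; 0; 1; 0; 1; 1; 0; 0; 0; 0; 0; 2; 1], [:: 0; 0; 0;
    1], 1, [:: 0; 1; 2]))]%BZ.

Lemma splittings_valid : all split_valid splittings.
Proof. vm_cast_no_check (erefl true). Qed.

Lemma lines_valid : all line_valid lines.
Proof. vm_cast_no_check (erefl true). Qed.

(** * Soundness of the factorisation data *)

Section Soundness.
Variable R : realType.
Local Notation C := (Cplx R).
Local Notation tensor := (tensor R).

Lemma zK_inj : injective (zK C).
Proof.
by move=> a b /eqP; rewrite -subr_eq0 -zKB zK_eq0 => /Z.eqb_spec; lia.
Qed.

Lemma permute_table s u (i j k : 'I_5) : permute s (tensor_of_label R u) i j k =
  zK C (zpermn (code s) (lookup (table u)) i j k).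
Proof. exact: permute_label. Qed.

Lemma split_validP u ps r c ms forms s : split_valid ((u, ps, r), (c, ms, forms)) ->
    code s \in ps ->
  forall (B : 'M[C]_(5, r)) A, splits ms (bdet B A (permute s (tensor_of_label R u))).
Proof.
move=> /and4P[r1 _ f5 /allP dP] /dP/andP[_ dE] B A.
(* As r is at most 1, the sum over j is the only entry of the border, or 0 when there is no border;
   this treats both sizes uniformly. *)
pose env (x : 'rV[C]_5) (n : nat) : C := if (n < 5)%N then x 0 (inord n) else
  if (n < 10)%N then \sum_(j < r) B (inord (n - 5)) j else \sum_(j < r) A j (inord (n - 10)).
have io n : iota 0 n = index_iota 0 n by rewrite /index_iota subn0.
have r_eq (j j' : 'I_r) : j = j' by apply/val_inj; move: (ltn_ord j) (ltn_ord j') r1 => /=; lia.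
have sum_r (F : 'I_r -> C) j : F j = \sum_j F j.
  by rewrite (bigD1 j)//= big1 ?addr0// => j' /eqP; rewrite (r_eq j' j).
exists (zK C c), (fun j => \row_k peval (env 0) (nth [::] (nth [::] forms j) k)) => x /=.
rewrite -(@peval_bentry C (env x) r (zpermn (code s) (lookup (table u))) pvar).
- rewrite (peval_peq _ dE) peval_pmul peval_const; congr (_ * _).
  rewrite peval_pprod big_map io big_mkord; apply: eq_bigr => j _.
  rewrite peval_pexp; congr (_ ^+ _); rewrite peval_psum big_map io big_mkord.
  apply: eq_bigr => k _; rewrite peval_pmul peval_var mxE mulrC /env ltn_ord inord_val;
    congr (_ * _).
  apply: peval_ext => [|n n5]; last by rewrite ltnNge n5.
  case: (ltnP j (size forms)) => [jf|/(nth_default [::])->]; last by rewrite nth_nil.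
  have /allP fj := allP f5 _ (mem_nth [::] jf).
  case: (ltnP k (size (nth [::] forms j))) => [kf|/(nth_default [::])->//].
  exact: fj _ (mem_nth [::] kf).
- exact: permute_table.
- by move=> k; rewrite peval_var /env ltn_ord inord_val.
- move=> k j; have k5 : (5 + k < 5)%N = false by lia.
  have k10 : (5 + k < 10)%N = true by have := ltn_ord k; lia.
  by rewrite peval_var /env k5 k10 addKn inord_val (sum_r (fun j => B k j) j).
move=> j k; have k5 : (10 + k < 5)%N = false by lia.
have k10 : (10 + k < 10)%N = false by lia.
by rewrite peval_var /env k5 k10 addKn inord_val (sum_r (fun j => A j k) j).
Qed.

Lemma line_validP v q r x y c rs s : line_valid ((v, q, r), (x, y, c, rs)) -> code s = q ->
  exists (B : 'M[C]_(5, r)) A a b, forall t,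
    bdet B A (permute s (tensor_of_label R v)) (a + t *: b) =
    zK C c * \prod_(r <- [seq zK C r | r <- rs]) (t - r).
Proof.
move=> /and3P[_ _ dE] sq.
exists (\matrix_(i, j) zK C (nth 0%BZ x (5 + i))), (\matrix_(j, i) zK C (nth 0%BZ x (10 + i))).
exists (\row_k zK C (nth 0%BZ x k)), (\row_k zK C (nth 0%BZ y k)) => t.
rewrite -(@peval_bentry C (fun=> t) r (zpermn q (lookup (table v))) (line_point x y)).
- rewrite (peval_peq _ dE) peval_pmul peval_const peval_pprod !big_map; congr (_ * _).
  by apply: eq_bigr => a _; rewrite peval_padd peval_var peval_const zKN.
- by rewrite -sq; exact: permute_table.
- by move=> k; rewrite !mxE /line_point ltn_ord peval_padd peval_pmul !peval_const peval_var
  mulrC.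
- move=> i j; rewrite mxE /line_point (_ : (5 + i < 5)%N = false); last lia.
  by rewrite peval_padd peval_const peval_nil addr0.
move=> j i; rewrite mxE /line_point (_ : (10 + i < 5)%N = false); last lia.
by rewrite peval_padd peval_const peval_nil addr0.
Qed.

Definition root_counts (rs : seq Z) : seq nat := [seq count_mem r rs | r <- undup rs].

Lemma unsplit_not_degenerates u ps r c ms forms v q x y c' rs s s' :
    split_valid ((u, ps, r), (c, ms, forms)) -> line_valid ((v, q, r), (x, y, c', rs)) ->
    code s \in ps -> code s' = q -> ~~ fits ms (root_counts rs) ->
  ~ degenerates (permute s (tensor_of_label R u)) (permute s' (tensor_of_label R v)).
Proof.
move=> du dv sp sq /negP nf dg; apply: nf.
have [B [A [a [b fE]]]] := line_validP dv sq.
have c0 : zK C c' != 0 by case/and3P: dv => _ c0 _; rewrite zK_eq0.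
have ms0 : 0%N \notin ms by case/and4P: du.
have [t tP] : exists t, bdet B A (permute s' (tensor_of_label R v)) (a + t *: b) != 0.
  have [|t] := @poly_nonroot C (\prod_(r <- [seq zK C r | r <- rs]) ('X - r%:P)).
    by rewrite monic_neq0 ?monic_prod_XsubC.
  rewrite horner_prod; under eq_bigr do rewrite hornerXsubC.
  by exists t; rewrite fE mulf_neq0.
have sv := bdet_degenerates ms0 (split_validP du sp) dg (ex_intro (fun x => bdet B A (permute s'
  (tensor_of_label R v)) x != 0) _ tP).
have [rho [rho1 rhoE]] := splits_line sv c0 fE.
pose zr i := zK C (nth 0%BZ (undup rs) i).
have sz : size (root_counts rs) = size (undup rs) by rewrite size_map.
apply: (@fitsP _ _ (fun j i => if insub j is Some j' then rho j' (zr i) else false)).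
  move=> j i i'; rewrite sz; case: insub => // j' lt lt' r1 r2.
  apply/eqP; rewrite -(nth_uniq 0%BZ lt lt' (undup_uniq rs)); apply/eqP.
  by apply: zK_inj; apply: rho1 r1 r2.
move=> i; rewrite sz => lt; rewrite (nth_map 0%BZ)//.
transitivity (count_mem (zr i) [seq zK C r | r <- rs]).
  by rewrite count_map; apply: eq_count => z /=; rewrite (inj_eq zK_inj).
by rewrite rhoE; apply: eq_bigr => j _; rewrite valK.
Qed.
End Soundness.

Definition compose (s q : nat * nat * nat) : nat * nat * nat :=
  (sel s.1.1 q.1.1 q.1.2 q.2, sel s.1.2 q.1.1 q.1.2 q.2, sel s.2 q.1.1 q.1.2 q.2).

Definition split_separated (u v : label) (s : nat * nat * nat) : bool :=
  has (fun d => has (fun e =>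
    [&& d.1.1.1 == u, e.1.1.1 == v, d.1.2 == e.1.2, compose s e.1.1.2 \in d.1.1.2 &
        ~~ fits d.2.1.2 (root_counts e.2.2)]) lines) splittings.

Lemma split_separated_not_degenerates (R : realType) u v s :
  split_separated u v (code s) ->
  ~ degenerates (permute s (tensor_of_label R u)) (tensor_of_label R v).
Proof.
case/hasP => -[[[u' ps] r] [[c ms] forms]] /(allP splittings_valid) du.
case/hasP => -[[[v' q] r'] [[[x y] c'] rs]] /(allP lines_valid) dv.
rewrite -[(_, _).1.1.1]/u' -[(v', q, r', (x, y, c', rs)).1.1.1]/v'.
move=> /and5P[/eqP uE /eqP vE /eqP/= rE ps_s nf] dg; subst u' v' r'.
have qP : q \in perms6 by case/and3P: dv.
have [t tq] := perms6_code qP.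
apply: (unsplit_not_degenerates (s := (s * t)%g) du dv _ tq nf); first by rewrite codeM tq.
by rewrite -permute_permute; exact: (@permute_degenerates R t _ _ dg).
Qed.

Lemma obstructed_separated : all (fun ab => all (fun s =>
    [|| separated ab.1 ab.2 s, split_separated ab.1 ab.2 s |
        (ab == (T1_5, T1_13)) && (s \in [:: (0, 2, 1); (2, 0, 1)]%N)]) perms6) obstructed.
Proof. vm_cast_no_check (erefl true). Qed.

(** * The pair T1_5, T1_13 *)

Section Wedge.
Variable K : numFieldType.
Local Notation rV := 'rV[K]_5.
Implicit Types (T : tns K) (X : 'M[K]_5) (x y z w c : rV).

Definition omega T X c z w : K := tri T (z *m X) w c.

(** When T(X y, y, .) = 0, [omega T X c] is an alternating form on B^*, and this is its contraction
    with the trivector of y, z, w. *)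
Definition cyclic T X c y z w : rV :=
  omega T X c z w *: y + omega T X c w y *: z + omega T X c y z *: w.

Definition wedge3 (f g h : rV -> K) c1 c2 c3 : K :=
  f c1 * (g c2 * h c3 - g c3 * h c2) - f c2 * (g c1 * h c3 - g c3 * h c1)
  + f c3 * (g c1 * h c2 - g c2 * h c1).

(* The two families of equations, in the order A, B, C of the factors, say that
   T(X y, y, .) = 0 and that T(x, Y), T(x', Y), T(X y', y'') are linearly
   dependent in C for Y = cyclic T X c y z w. *)
Definition eqn : Type := (rV * rV * rV) + (rV * (rV * rV * rV) * (rV * rV) * (rV * rV) * (rV *
  rV * rV)).

Definition eqn_val (l : eqn) T X : K :=
  match l with
  | inl (y, y', c) => tri T (y *m X) y' c + tri T (y' *m X) y c
  | inr (c, (y, z, w), (x, x'), (y', y''), (c1, c2, c3)) =>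
    let Y := cyclic T X c y z w in
    wedge3 (tri T x Y) (tri T x' Y) (tri T (y' *m X) y'') c1 c2 c3
  end.

Lemma triZ1 T s a b c : tri T (s *: a) b c = s * tri T a b c.
Proof.
have tri0 : tri T 0 b c = 0.
  by rewrite /tri big1// => i _; rewrite big1// => j _; rewrite big1// => k _; rewrite mxE !mul0r.
by rewrite -[s *: a]addr0 triP1 tri0 addr0.
Qed.

Lemma triZ2 T s a b c : tri T a (s *: b) c = s * tri T a b c.
Proof.
have tri0 : tri T a 0 c = 0.
  by rewrite /tri big1// => i _; rewrite big1// => j _; rewrite big1// => k _;
    rewrite mxE mulr0 !mul0r.
by rewrite -[s *: b]addr0 triP2 tri0 addr0.
Qed.

Lemma triZ3 T s a b c : tri T a b (s *: c) = s * tri T a b c.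
Proof.
have tri0 : tri T a b 0 = 0.
  by rewrite /tri big1// => i _; rewrite big1// => j _; rewrite big1// => k _;
    rewrite mxE mulr0 mul0r.
by rewrite -[s *: c]addr0 triP3 tri0 addr0.
Qed.

(** The equations are homogeneous in [X], of degree 1 and 3: in the second family [cyclic] is linear
    in [X] and enters twice, and [X] itself enters once. *)
Lemma eqn_valZ l T X s : eqn_val l T X = 0 -> eqn_val l T (s *: X) = 0.
Proof.
case: l => [[[y y'] c]|[[[[c [[y z] w]] [x x']] [y' y'']] [[c1 c2] c3]]] /= e.
  by rewrite -!scalemxAr !triZ1 -mulrDr e mulr0.
have -> : cyclic T (s *: X) c y z w = s *: cyclic T X c y z w.
  by rewrite /cyclic /omega -!scalemxAr !triZ1 !scalerDr !scalerA.
have -> : wedge3 (tri T x (s *: cyclic T X c y z w)) (tri T x' (s *: cyclic T X c y z w))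
    (tri T (y' *m (s *: X)) y'') c1 c2 c3 =
  s ^+ 3 * wedge3 (tri T x (cyclic T X c y z w)) (tri T x' (cyclic T X c y z w))
    (tri T (y' *m X) y'') c1 c2 c3.
  by rewrite /wedge3 -scalemxAr !triZ1 !triZ2; ring.
by rewrite e mulr0.
Qed.

(** A map from B^* to A^* is conjugated by [g2] and the inverse of [g1]. Then [omega] takes the same
    values at the moved arguments, and [cyclic], a vector of B^*, is carried by [g2]. *)
Lemma eqn_val_act T T' g1 g2 g3 X : g1 \in unitmx ->
    (forall a b c, tri T' a b c = tri T (a *m g1) (b *m g2) (c *m g3)) ->
    (forall l, eqn_val l T X = 0) ->
  forall l, eqn_val l T' (g2 *m X *m invmx g1) = 0.
Proof.
move=> u1 TT' T0; have XE y b c : tri T' (y *m (g2 *m X *m invmx g1)) b c =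
    tri T (y *m g2 *m X) (b *m g2) (c *m g3) by rewrite TT' !mulmxA mulmxKV.
case=> [[[y y'] c]|[[[[c [[y z] w]] [x x']] [y' y'']] [[c1 c2] c3]]] /=.
  by rewrite !XE; exact: (T0 (inl (_, _, _))).
have cE : cyclic T' (g2 *m X *m invmx g1) c y z w *m g2 =
    cyclic T X (c *m g3) (y *m g2) (z *m g2) (w *m g2).
  by rewrite /cyclic /omega !XE !mulmxDl -!scalemxAl.
rewrite /wedge3 !XE !TT' cE.
exact: (T0 (inr (_, (_, _, _), (_, _), (_, _), (_, _, _)))).
Qed.

Lemma tri_continuous3 (Z : topologicalType) (T : Z -> tns K) (a b c : Z -> rV) :
    (forall i j k, continuous (fun p => T p i j k)) ->
    (forall i, continuous (fun p => a p 0 i)) -> (forall i, continuous (fun p => b p 0 i)) ->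
    (forall i, continuous (fun p => c p 0 i)) ->
  continuous (fun p => tri (T p) (a p) (b p) (c p)).
Proof.
move=> Tc ac bc cc; rewrite /tri; do 3 (apply: continuous_sum => ?).
apply: continuous_mul => //; apply: continuous_mul => //; exact: continuous_mul.
Qed.

Lemma eqn_val_continuous (Z : topologicalType) (T : Z -> tns K) (X : Z -> 'M[K]_5) l :
    (forall i j k, continuous (fun p => T p i j k)) ->
    (forall i j, continuous (fun p => X p i j)) ->
  continuous (fun p => eqn_val l (T p) (X p)).
Proof.
move=> Tc Xc.
have cst (y : rV) i : continuous (fun _ : Z => y 0 i) by exact: cst_continuous.
have yX (y : rV) i : continuous (fun p => (y *m X p) 0 i).
  under eq_fun do rewrite mxE; apply: continuous_sum => j.
  by apply: continuous_mul => //; exact: cst_continuous.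
case: l => [[[y y'] c]|[[[[c [[y z] w]] [x x']] [y' y'']] [[c1 c2] c3]]] /=.
  by apply: continuous_add; apply: tri_continuous3.
have Yc i : continuous (fun p => cyclic (T p) (X p) c y z w 0 i).
  under eq_fun do rewrite !mxE.
  have om (v v' : rV) i' (u : rV) : continuous (fun p => omega (T p) (X p) c v v' * u 0 i').
    by apply: continuous_mul; [exact: tri_continuous3 | exact: cst_continuous].
  by do 2 (apply: continuous_add; last exact: om); exact: om.
rewrite /wedge3.
have t1 (v c' : rV) : continuous (fun p => tri (T p) v (cyclic (T p) (X p) c y z w) c').
  exact: tri_continuous3.
have t2 (c' : rV) : continuous (fun p => tri (T p) (y' *m X p) y'' c').
  exact: tri_continuous3.
have m (f g h k l : Z -> K) : continuous f -> continuous g -> continuous h -> continuous k ->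
    continuous l -> continuous (fun p => f p * (g p * h p - k p * l p)).
  move=> *; apply: continuous_mul => //; apply: continuous_add; last apply: continuous_opp;
  exact: continuous_mul.
apply: continuous_add; last exact: m.
apply: continuous_add; last apply: continuous_opp; exact: m.
Qed.
End Wedge.

Lemma eqn_degenerates (R : realType) (T S : tensor R) :
    (exists2 X : 'M[Cplx R]_5, X != 0 & forall l, eqn_val l T X = 0) -> degenerates T S ->
  exists2 X : 'M[Cplx R]_5, X != 0 & forall l, eqn_val l S X = 0.
Proof.
move=> [X X0 XT] TS.
pose F (l : eqn (Cplx R)) (S : tensor R) (L : 'I_1 -> 'rV[Cplx R]_(5 * 5)) : Cplx R :=
  eqn_val l S (vec_mx (L 0)).
have [l|l S' L s s0|_ [g1 [g2 [g3 [u1 u2 u3 ->]]]]|L L0 LS] :=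
    @closure_projective R (tensor R) 1 (5 * 5) (@Defs.orbit R T) _ F S _ _ _ TS.
- apply: (@eqn_val_continuous (Cplx R) (tensor R * 'rV[Cplx R]_(1 * (5 * 5)))%type
    (fun p => p.1) (fun p => vec_mx (row 0 (vec_mx p.2)))) => [i j k|i j].
    exact: (@continuous_fst (Cplx R) (tensor R) _ _ (@entry_continuous R i j k)).
  rewrite (_ : (fun _ => _) = fun p : tensor R * 'rV[Cplx R]_(1 * (5 * 5)) =>
      p.2 0 (mxvec_index 0 (mxvec_index i j))); first exact: continuous_snd_entry.
  by apply/funext => q; rewrite !mxE.
- by rewrite /F linearZ /=; exact: eqn_valZ.
- exists (fun=> mxvec (g2 *m X *m invmx g1)) => [_|l].
    apply: contra X0 => /eqP e; have := congr1 vec_mx e; rewrite mxvecK linear0 => {}e.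
    by rewrite -[X](mulKmx u2) -[g2 *m X](mulmxK (_ : invmx g1 \in unitmx)) ?unitmx_inv// e
      mul0mx mulmx0.
  by rewrite /F mxvecK; apply: eqn_val_act (tri_act _ _ _ _) XT _.
exists (vec_mx (L 0)); last exact: LS.
by apply: contra (L0 0) => /eqP e; rewrite -[L 0]vec_mxK e linear0.
Qed.

Definition ptri (t : ztns) : pol :=
  [seq (t u.1.1 u.1.2 u.2, [:: u.1.1; 5 + u.1.2; 10 + u.2]%N) | u <- alltriples5].

Section Special.
Variable C : numFieldType.
Implicit Types (a b c x y z w : 'rV[C]_5).

Definition crd a (n : nat) : C := a 0 (inord n).

Definition crds a b c (n : nat) : C :=
  nth 0 ([seq crd a i | i <- iota 0 5] ++ [seq crd b i | i <- iota 0 5]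
    ++ [seq crd c i | i <- iota 0 5]) n.

(** Turns an integer table into a sparse polynomial in the 15 coordinates, from which the explicit
    trilinear forms below are obtained by computation. *)
Lemma tri_ptri (T : tns C) (t : ztns) a b c :
    (forall i j k : 'I_5, T i j k = zK C (t i j k)) ->
  tri T a b c = peval (crds a b c) [seq m <- ptri t | ~~ Z.eqb m.1 0].
Proof.
move=> Tt; rewrite /peval big_filter big_mkcond /ptri big_map /alltriples5 big_allpairs_dep.
rewrite /allpairs5 big_allpairs_dep /tri -[iota 0 5]/(index_iota 0 5) big_mkord.
apply: eq_bigr => i _; rewrite big_mkord; apply: eq_bigr => j _; rewrite big_mkord.
apply: eq_bigr => k _; rewrite Tt /= -(zK_eq0 C); case: eqP => [->|_] /=; first by rewrite mulr0.
rewrite !big_cons big_nil mulr1.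
have -> : crds a b c i = crd a i by case: i => [[|[|[|[|[|//]]]]] ?].
have -> : crds a b c (5 + j)%N = crd b j by case: j => [[|[|[|[|[|//]]]]] ?].
have -> : crds a b c (10 + k)%N = crd c k by case: k => [[|[|[|[|[|//]]]]] ?].
by rewrite /crd !inord_val; ring.
Qed.

Lemma crd_cyclic (T : tns C) X c y z w n : crd (cyclic T X c y z w) n =
  omega T X c z w * crd y n + omega T X c w y * crd z n + omega T X c y z * crd w n.
Proof. by rewrite /crd !mxE. Qed.

Section Source.
Variables (T : tns C) (p : nat * nat * nat).
Hypothesis Tp : forall i j k : 'I_5, T i j k = zK C (zpermn p (lookup (table T1_5)) i j k).
Hypothesis pP : p \in [:: (0, 2, 1); (2, 0, 1)]%N.

Lemma tri_T1_5 a b c : tri T a b c =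
  crd a 0 * (crd b 0 * crd c 0 + crd b 1 * crd c 1 + crd b 2 * crd c 2 + crd b 3 * crd c 3
             + crd b 4 * crd c 4)
  + crd a 1 * (crd b 1 * crd c 0 + crd b 4 * crd c 2)
  + crd a 2 * (crd b 2 * crd c 0 + crd b 3 * crd c 2 + crd b 4 * crd c 1)
  + (crd a 3 * crd b 3 + crd a 4 * crd b 4) * crd c 0.
Proof.
rewrite (tri_ptri _ _ _ Tp).
(* [T1_5] is symmetric in its first two factors, so the two remaining permutations yield the same
   tensor. *)
have -> : [seq m <- ptri (zpermn p (lookup (table T1_5))) | ~~ Z.eqb m.1 0] =
  [seq m <- ptri (zpermn (0, 2, 1)%N (lookup (table T1_5))) | ~~ Z.eqb m.1 0].
  by move: pP; rewrite !inE => /orP[] /eqP ->; vm_compute.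
set l := [seq _ <- _ | _]; vm_compute in l; rewrite /l /peval !big_cons !big_nil /=.
by rewrite zK1 /crds /=; ring.
Qed.

(** The map X for the permuted [T1_5]: with it T(z X, w, c) = (z4 w3 - z3 w4) c0, an alternating
    form of rank 2 in z, w times the coordinate c0. *)
Definition skew34 : 'M[C]_5 := \matrix_(i, j)
  (if (i == 4 :> nat) && (j == 3 :> nat) then 1
   else if (i == 3 :> nat) && (j == 4 :> nat) then -1 else 0).

Lemma crd_skew34 y n : (n < 5)%N -> crd (y *m skew34) n =
  if n == 3%N then crd y 4 else if n == 4%N then - crd y 3 else 0.
Proof.
move=> n5; rewrite /crd mxE (eq_bigr (fun k : 'I_5 => crd y k * (if (k == 4 :> nat) && (n ==
  3%N) then 1
   else if (k == 3 :> nat) && (n == 4%N) then -1 else 0))); last first.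
  by move=> k _; rewrite mxE inordK// /crd inord_val.
rewrite -(big_mkord xpredT (fun k => crd y k * (if (k == 4%N) && (n == 3%N) then 1
   else if (k == 3%N) && (n == 4%N) then -1 else 0))) unlock /=.
by case: n n5 => [|[|[|[|[|//]]]]] _ /=; rewrite /crd; ring.
Qed.

Lemma T1_5_skew l : eqn_val l T skew34 = 0.
Proof.
case: l => [[[y y'] c]|[[[[c [[y z] w]] [x x']] [y' y'']] [[c1 c2] c3]]];
  rewrite [eqn_val _ _ _]/=.
  by rewrite !tri_T1_5 !crd_skew34//=; ring.
have tE v v' d : tri T (v *m skew34) v' d =
   (crd v 4 * crd v' 3 - crd v 3 * crd v' 4) * crd d 0.
  by rewrite tri_T1_5 !crd_skew34//=; ring.
have cE n : crd (cyclic T skew34 c y z w) n =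
   ((crd z 4 * crd w 3 - crd z 3 * crd w 4) * crd y n
   + (crd w 4 * crd y 3 - crd w 3 * crd y 4) * crd z n
   + (crd y 4 * crd z 3 - crd y 3 * crd z 4) * crd w n) * crd c 0.
  by rewrite crd_cyclic /omega !tE; ring.
(* The contraction of a trivector by a 2-form of rank 2 lies in the kernel of that form, here the
   vectors whose coordinates 3 and 4 vanish. *)
have Y3 : crd (cyclic T skew34 c y z w) 3 = 0.
  by rewrite cE; ring.
have Y4 : crd (cyclic T skew34 c y z w) 4 = 0.
  by rewrite cE; ring.
(* Modulo c0, the forms T(x, Y, .) and T(x', Y, .) are both multiples of Y1 c1 + Y2 c2, and the
   third form is a multiple of c0: the three are dependent. *)
rewrite /wedge3 !tE !tri_T1_5 Y3 Y4; set Y := cyclic _ _ _ _ _ _.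
move: (crd Y 0) (crd Y 1) (crd Y 2) => Y0 Y1 Y2; ring.
Qed.

End Source.

Definition basis (n : nat) : 'rV[C]_5 := dl C (inord n).

Lemma crd_basis m n : (m < 5)%N -> (n < 5)%N -> crd (basis m) n = (m == n)%:R.
Proof. by move=> m5 n5; rewrite /crd /basis mxE eqxx -(inj_eq val_inj) /= !inordK// eq_sym. Qed.

Section Target.
Variable T : tns C.
Hypothesis Tt : forall i j k : 'I_5, T i j k = zK C (lookup (table T1_13) i j k).

Lemma tri_T1_13 a b c : tri T a b c =
  crd a 0 * (crd b 0 * crd c 0 + crd b 1 * crd c 1 + crd b 2 * crd c 2 + crd b 3 * crd c 3
             + crd b 4 * crd c 4)
  + (crd a 1 * crd b 0 + crd a 4 * crd b 2) * crd c 3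
  + (crd a 2 * crd b 0 + crd a 3 * crd b 1) * crd c 4.
Proof.
rewrite (tri_ptri _ _ _ Tt).
set l := [seq _ <- _ | _]; vm_compute in l; rewrite /l /peval !big_cons !big_nil /=.
by rewrite zK1 /crds /=; ring.
Qed.

Lemma T1_13_rigid (X : 'M[C]_5) :
  (forall l, eqn_val l T X = 0) -> X = 0.
Proof.
move=> XT; pose m i j := crd (basis i *m X) j.
have bl i i' k : (i < 5)%N -> (i' < 5)%N -> (k < 5)%N ->
    tri T (basis i *m X) (basis i') (basis k) =
    m i 0%N * (i' == k)%:R + ((i' == 0%N)%:R * m i 1%N + (i' == 2%N)%:R * m i 4%N) * (k == 3%N)%:R
    + ((i' == 0%N)%:R * m i 2%N + (i' == 1%N)%:R * m i 3%N) * (k == 4%N)%:R.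
  move=> i5 i5' k5; rewrite tri_T1_13 /m !crd_basis//.
  by case: k k5 => [|[|[|[|[|//]]]]] _ /=; case: i' i5' => [|[|[|[|[|//]]]]] _ /=; ring.
have lin i i' k : (i < 5)%N -> (i' < 5)%N -> (k < 5)%N ->
    m i 0%N * (i' == k)%:R + ((i' == 0%N)%:R * m i 1%N + (i' == 2%N)%:R * m i 4%N) * (k == 3%N)%:R
    + ((i' == 0%N)%:R * m i 2%N + (i' == 1%N)%:R * m i 3%N) * (k == 4%N)%:R
    + (m i' 0%N * (i == k)%:R + ((i == 0%N)%:R * m i' 1%N + (i == 2%N)%:R * m i' 4%N) * (k ==
      3%N)%:R
    + ((i == 0%N)%:R * m i' 2%N + (i == 1%N)%:R * m i' 3%N) * (k == 4%N)%:R) = 0.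
  by move=> i5 i5' k5; rewrite -!bl//; exact: (XT (inl (basis i, basis i', basis k))).
have dbl (k : C) : k + k = 0 -> k = 0.
  by move/eqP; rewrite -mulr2n mulrn_eq0 => /eqP.
have simp := (mulr1, mul1r, mulr0, mul0r, addr0, add0r, subr0, sub0r, oppr0).
(* The linear equations kill all the entries of [X] except (2, 1) and (1, 2), together with (0, 4)
   and (0, 3), which are their opposites. *)
have m10 : m 1%N 0%N = 0.
  by have := lin 1%N 0%N 0%N isT isT isT; rewrite /= !simp.
have m00 : m 0%N 0%N = 0.
  by have := lin 0%N 1%N 1%N isT isT isT; rewrite /= !simp.
have m20 : m 2%N 0%N = 0.
  by have := lin 2%N 1%N 1%N isT isT isT; rewrite /= !simp.
have m30 : m 3%N 0%N = 0.
  by have := lin 3%N 1%N 1%N isT isT isT; rewrite /= !simp.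
have m40 : m 4%N 0%N = 0.
  by have := lin 4%N 1%N 1%N isT isT isT; rewrite /= !simp.
have m11 : m 1%N 1%N = 0.
  by have := lin 1%N 0%N 3%N isT isT isT; rewrite /= !simp.
have m31 : m 3%N 1%N = 0.
  by have := lin 3%N 0%N 3%N isT isT isT; rewrite /= m00 !simp.
have m41 : m 4%N 1%N = 0.
  by have := lin 4%N 0%N 3%N isT isT isT; rewrite /= !simp.
have m14 : m 1%N 4%N = 0.
  by have := lin 1%N 2%N 3%N isT isT isT; rewrite /= !simp.
have m34 : m 3%N 4%N = 0.
  by have := lin 3%N 2%N 3%N isT isT isT; rewrite /= m20 !simp.
have m44 : m 4%N 4%N = 0.
  by have := lin 4%N 2%N 3%N isT isT isT; rewrite /= !simp.
have m22 : m 2%N 2%N = 0.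
  by have := lin 2%N 0%N 4%N isT isT isT; rewrite /= !simp.
have m23 : m 2%N 3%N = 0.
  by have := lin 2%N 1%N 4%N isT isT isT; rewrite /= !simp.
have m32 : m 3%N 2%N = 0.
  by have := lin 3%N 0%N 4%N isT isT isT; rewrite /= !simp.
have m42 : m 4%N 2%N = 0.
  by have := lin 4%N 0%N 4%N isT isT isT; rewrite /= m00 !simp.
have m33 : m 3%N 3%N = 0.
  by have := lin 3%N 1%N 4%N isT isT isT; rewrite /= !simp.
have m43 : m 4%N 3%N = 0.
  by have := lin 4%N 1%N 4%N isT isT isT; rewrite /= m10 !simp.
have m01 : m 0%N 1%N = 0.
  by apply: dbl; have := lin 0%N 0%N 3%N isT isT isT; rewrite /= !simp.
have m24 : m 2%N 4%N = 0.
  by apply: dbl; have := lin 2%N 2%N 3%N isT isT isT; rewrite /= !simp.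
have m02 : m 0%N 2%N = 0.
  by apply: dbl; have := lin 0%N 0%N 4%N isT isT isT; rewrite /= !simp.
have m13 : m 1%N 3%N = 0.
  by apply: dbl; have := lin 1%N 1%N 4%N isT isT isT; rewrite /= !simp.
have m04 : m 0%N 4 = - m 2%N 1%N%N.
  by apply/eqP; rewrite -addr_eq0 addrC; apply/eqP; have := lin 2%N 0%N 3%N isT isT isT;
    rewrite /= !simp.
have m03 : m 0%N 3 = - m 1%N 2.
  by apply/eqP; rewrite -addr_eq0 addrC; apply/eqP; have := lin 1%N 0%N 4%N isT isT isT;
    rewrite /= !simp.
(* For this choice the contraction is m21 times basis vector 1, and the three forms are m21 times
   the coordinates c1, c4 and c3. The cubic equation thus reads m21^3 = 0 up to sign; the entry (1,
   2) is treated likewise with c2, c3 and c4. *)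
have m21 : m 2%N 1%N = 0.
  pose Y := cyclic T X (basis 3) (basis 1) (basis 2) (basis 0).
  have YE n : (n < 5)%N -> crd Y n = m 2%N 1%N * (1 == n)%:R.
    move=> n5; rewrite /Y crd_cyclic /omega !bl// !crd_basis//=.
    by rewrite ?m00 ?m10 ?m20 ?m13 ?m14 ?m22 ?m23 ?m24 ?m01 ?m02 !simp.
  have := XT (inr (basis 3, (basis 1, basis 2, basis 0), (basis 0, basis 3), (basis 2, basis 0),
    (basis 1, basis 4, basis 3))).
  rewrite /= -/Y /wedge3 !bl// !tri_T1_13 !YE// !crd_basis//= ?m00 ?m10 ?m20 ?m22 ?m11 !simp.
  by move/eqP; rewrite ?oppr_eq0 !mulf_eq0 !orbb => /eqP.
have m12 : m 1%N 2%N = 0.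
  pose Y := cyclic T X (basis 4) (basis 2) (basis 1) (basis 0).
  have YE n : (n < 5)%N -> crd Y n = m 1%N 2%N * (2 == n)%:R.
    move=> n5; rewrite /Y crd_cyclic /omega !bl// !crd_basis//=.
    by rewrite ?m00 ?m10 ?m20 ?m13 ?m14 ?m22 ?m23 ?m24 ?m01 ?m02 !simp.
  have := XT (inr (basis 4, (basis 2, basis 1, basis 0), (basis 0, basis 4), (basis 1, basis 0),
    (basis 2, basis 3, basis 4))).
  rewrite /= -/Y /wedge3 !bl// !tri_T1_13 !YE// !crd_basis//= ?m00 ?m10 ?m20 ?m22 ?m11 !simp.
  by move/eqP; rewrite ?oppr_eq0 !mulf_eq0 !orbb => /eqP.
apply/matrixP => i j; rewrite [RHS]mxE; transitivity (m i j).
  by rewrite /m /crd /basis !inord_val -rowE mxE.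
move: i j => [[|[|[|[|[|//]]]]] ?] [[|[|[|[|[|//]]]]] ?] /=;
  by rewrite ?m04 ?m03 ?m21 ?m12 ?oppr0.
Qed.
End Target.
End Special.

(** * The order *)

Section Order.
Variable R : realType.
Local Notation t := (@tensor_of_label R).

Lemma T1_5_not_degenerates_T1_13 s : code s \in [:: (0, 2, 1); (2, 0, 1)]%N ->
  ~ degenerates (permute s (t T1_5)) (t T1_13).
Proof.
move=> sp /eqn_degenerates[|X X0 XT].
  exists (skew34 (Cplx R)); last exact: (T1_5_skew (@permute_table R s T1_5) sp).
  apply/negP => /eqP/matrixP/(_ (inord 4) (inord 3)); rewrite !mxE !inordK//= => /eqP.
  by rewrite oner_eq0.
by move/eqP: X0; apply; exact: (T1_13_rigid (@tensor_of_labelE R T1_13) XT).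
Qed.

Lemma obstructed_not_degenerates a b : (a, b) \in obstructed -> ~ degenerates_perm (t a) (t b).
Proof.
move=> /(allP obstructed_separated)/allP sep [s]; have /or3P[] := sep _ (code_perms6 s).
- exact: separated_not_degenerates.
- exact: split_separated_not_degenerates.
by case/andP => /eqP[-> ->]; exact: T1_5_not_degenerates_T1_13.
Qed.

Lemma connect_degenerates u v : connect arrow u v -> degenerates_perm (t u) (t v).
Proof.
case/connectP => p; elim: p u => [|w p IH] u /=; first by move=> _ ->;
  exact: degenerates_perm_refl.
by move=> /andP[/(@arrow_degenerates R) uw wp vE]; exact: degenerates_perm_trans uw (IH w wp vE).
Qed.

Lemma degenerates_permE u v : degenerates_perm (t u) (t v) <-> connect arrow u v.
Proof.
split=> [uv|]; last exact: connect_degenerates.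
have /orP[|/hasP[[a b] ab /andP[]]] := allP (allP obstructed_all u (labelsP u)) v (labelsP v).
  by rewrite reachE.
rewrite !reachE => /connect_degenerates au /connect_degenerates vb.
by case: (obstructed_not_degenerates ab);
  exact: degenerates_perm_trans (degenerates_perm_trans au uv) vb.
Qed.

Lemma connect_antisym u v : connect arrow u v -> connect arrow v u -> u = v.
Proof.
move=> uv vu; apply/eqP.
have := allP (allP reach_antisym u (labelsP u)) v (labelsP v).
by rewrite !reachE uv vu orbF.
Qed.

Lemma isomorphic_label u v : isomorphic_perm (t u) (t v) -> u = v.
Proof.
move=> uv; apply: connect_antisym; apply/degenerates_permE;
  apply: isomorphic_perm_degenerates => //.
exact: isomorphic_perm_sym.
Qed.

(** Only the tensors of [K] lying between the two listed ones have to be listed. This covers both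
    [listed] itself and, once tensors of minimal border rank are known to be listed, the whole
    space. *)
Lemma minimal_degenerationE (K : set (tensor R)) u v :
    (forall w, K (t w)) ->
    (forall S, K S -> degenerates_perm (t u) S -> degenerates_perm S (t v) -> listed S) ->
  minimal_degeneration K (t u) (t v) <-> arrow u v.
Proof.
move=> Kt Kl; have /eqP -> := allP (allP arrow_cover u (labelsP u)) v (labelsP v).
rewrite reachE; split=> [[/degenerates_permE uv nuv nS]|/and3P[uv cuv /allP cov]].
  apply/and3P; split => //.
    by apply/eqP => uv'; apply: nuv; rewrite uv'; exact: isomorphic_perm_refl.
  apply/allP => w _; rewrite !reachE; apply/implyP => /andP[uw wv].
  have [//|wu] := eqVneq w u; have [//|wv'] := eqVneq w v.
  case: nS; exists (t w); split; [exact: Kt | exact/degenerates_permE | exact/degenerates_permE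
    | |].
    by move=> /isomorphic_label wu'; rewrite wu' eqxx in wu.
  by move=> /isomorphic_label wv''; rewrite wv'' eqxx in wv'.
split; first exact/degenerates_permE.
  by move=> /isomorphic_label uv'; rewrite uv' eqxx in uv.
move=> [S [KS uS Sv nuS nSv]]; have [w wS] := Kl S KS uS Sv.
have uw : connect arrow u w.
  apply/degenerates_permE; apply: degenerates_perm_trans uS _.
  exact/isomorphic_perm_degenerates/isomorphic_perm_sym.
have wv : connect arrow w v.
  apply/degenerates_permE; apply: degenerates_perm_trans Sv.
  exact: isomorphic_perm_degenerates.
have := cov w (labelsP w); rewrite !reachE uw wv /= => /orP[/eqP wu|/eqP wv'].
  by apply: nuS; rewrite -wu.
by apply: nSv; rewrite -wv'; exact: isomorphic_perm_sym.
Qed.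

End Order.

(** * Tensors between two listed ones *)

Lemma reach_T5_1 : let t := reach_table in all (reach t T5_1) labels.
Proof. by vm_compute. Qed.

Section Contraction.
Variables (K : numFieldType) (X : topologicalType) (T : X -> tns K).
Hypothesis Tc : forall i j k, continuous (fun p => T p i j k).

Lemma contraction_continuous (n : nat) (a b c : 'rV[K]_5) :
  continuous (fun p : X * 'rV[K]_(1 * 5) => let l := row 0 (vec_mx p.2) in
    tri (T p.1) (if n == 0%N then l else a) (if n == 1%N then l else b)
      (if n == 2%N then l else c)).
Proof.
have lc i : continuous (fun p : X * 'rV[K]_(1 * 5) => row 0 (vec_mx p.2) 0 i).
  rewrite (_ : (fun _ => _) = fun p : X * 'rV[K]_(1 * 5) => p.2 0 (mxvec_index 0 i)).
    exact: continuous_snd_entry.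
  by apply/funext => p; rewrite !mxE.
apply: tri_continuous3 => [i j k|i|i|i].
- exact: (@continuous_fst K X _ (fun x => T x i j k)).
- by case: eqP => _; [exact: lc | exact: cst_continuous].
- by case: eqP => _; [exact: lc | exact: cst_continuous].
by case: eqP => _; [exact: lc | exact: cst_continuous].
Qed.
End Contraction.

Section Coordinates.
Variable C : numFieldType.
Implicit Types (T : tns C) (l a b c : 'rV[C]_5).

Lemma tri_coord1 T l b c : tri T l b c = \sum_i l 0 i * tri T (dl C i) b c.
Proof.
apply/eqP; rewrite -subr_eq0; apply/eqP.
apply: (linear_eq0 (F := fun l => tri T l b c - \sum_i l 0 i * tri T (dl C i) b c)) => [k d
  d'|i]; last by rewrite sum_dl subrr.
have -> : \sum_i (k *: d + d') 0 i * tri T (dl C i) b c =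
    k * (\sum_i d 0 i * tri T (dl C i) b c) + \sum_i d' 0 i * tri T (dl C i) b c.
  by rewrite mulr_sumr -big_split; apply: eq_bigr => i _; rewrite !mxE /=; ring.
by rewrite triP1; ring.
Qed.

Lemma tri_coord2 T l a c : tri T a l c = \sum_i l 0 i * tri T a (dl C i) c.
Proof.
apply/eqP; rewrite -subr_eq0; apply/eqP.
apply: (linear_eq0 (F := fun l => tri T a l c - \sum_i l 0 i * tri T a (dl C i) c)) => [k d
  d'|i]; last by rewrite sum_dl subrr.
have -> : \sum_i (k *: d + d') 0 i * tri T a (dl C i) c =
    k * (\sum_i d 0 i * tri T a (dl C i) c) + \sum_i d' 0 i * tri T a (dl C i) c.
  by rewrite mulr_sumr -big_split; apply: eq_bigr => i _; rewrite !mxE /=; ring.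
by rewrite triP2; ring.
Qed.

Lemma tri_coord3 T l a b : tri T a b l = \sum_i l 0 i * tri T a b (dl C i).
Proof.
apply/eqP; rewrite -subr_eq0; apply/eqP.
apply: (linear_eq0 (F := fun l => tri T a b l - \sum_i l 0 i * tri T a b (dl C i))) => [k d
  d'|i]; last by rewrite sum_dl subrr.
have -> : \sum_i (k *: d + d') 0 i * tri T a b (dl C i) =
    k * (\sum_i d 0 i * tri T a b (dl C i)) + \sum_i d' 0 i * tri T a b (dl C i).
  by rewrite mulr_sumr -big_split; apply: eq_bigr => i _; rewrite !mxE /=; ring.
by rewrite triP3; ring.
Qed.

End Coordinates.

Section BorderRank.
Variable R : realType.
Local Notation C := (Cplx R).
Local Notation tensor := (tensor R).
Local Notation act := (@Defs.act R).
Local Notation orbit := (@Defs.orbit R).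
Local Notation t := (@tensor_of_label R).
Implicit Types (T S : tensor).

Lemma tri_sum_of_simple n (a b c : 'I_n -> 'rV[C]_5) x y z :
  tri (sum_of_simple a b c) x y z = \sum_(s < n) dotp (a s) x * dotp (b s) y * dotp (c s) z.
Proof.
symmetry; apply: (tri_ext (F := fun x y z => \sum_(s < n) dotp (a s) x * dotp (b s) y * dotp (c
  s) z)).
- move=> k d d' e f; rewrite mulr_sumr -big_split; apply: eq_bigr => s _ /=.
  by rewrite [k *: d + d']addrC dotp_line; ring.
- move=> k d e e' f; rewrite mulr_sumr -big_split; apply: eq_bigr => s _ /=.
  by rewrite [k *: e + e']addrC dotp_line; ring.
- move=> k d e f f'; rewrite mulr_sumr -big_split; apply: eq_bigr => s _ /=.
  by rewrite [k *: f + f']addrC dotp_line; ring.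
have dotp_dl (l : 'rV[C]_5) i : dotp l (dl C i) = l 0 i.
  by rewrite /dotp -(sum_dl (fun j => l 0 j)); apply: eq_bigr => j _; rewrite mulrC.
by move=> i j k; apply: eq_bigr => s _; rewrite !dotp_dl.
Qed.

Lemma rank_le_act r g1 g2 g3 T : rank_le r T -> rank_le r (act g1 g2 g3 T).
Proof.
move=> [a [b [c ->]]].
exists (fun s => \row_i dotp (a s) (dl C i *m g1)), (fun s => \row_i dotp (b s) (dl C i *m g2)),
  (fun s => \row_i dotp (c s) (dl C i *m g3)).
apply: tensorP => i j k; rewrite -[LHS]tri_dl tri_act tri_sum_of_simple.
by apply: eq_bigr => s _; rewrite !mxE.
Qed.

Lemma rank_le_permute r s T : rank_le r T -> rank_le r (permute s T).
Proof.
move=> [a [b [c ->]]]; rewrite permuteE.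
have := code_perms6 s; rewrite !inE => /or4P[/eqP->|/eqP->|/eqP->|/or3P[/eqP->|/eqP->|/eqP->]].
- by exists a, b, c.
- by exists a, c, b; apply: tensorP => i j k; apply: eq_bigr => ? _ /=; ring.
- by exists b, a, c; apply: tensorP => i j k; apply: eq_bigr => ? _ /=; ring.
- by exists c, a, b; apply: tensorP => i j k; apply: eq_bigr => ? _ /=; ring.
- by exists b, c, a; apply: tensorP => i j k; apply: eq_bigr => ? _ /=; ring.
by exists c, b, a; apply: tensorP => i j k; apply: eq_bigr => ? _ /=; ring.
Qed.

Lemma border_rank_degenerates r T S : rank_le r T -> degenerates_perm T S -> closure (rank_le r)
  S.
Proof.
move=> Tr [s]; apply: closureS => _ [g1 [g2 [g3 [_ _ _ ->]]]].
exact/rank_le_act/rank_le_permute.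
Qed.

Lemma T5_1_entries : all (fun u => Z.eqb (ztensor T5_1 u.1.1 u.1.2 u.2)
  (if ((u.1.1 == 0%N) || (u.1.1 == u.1.2)) && (u.1.2 == u.2) then 1 else 0)%BZ) alltriples5.
Proof. by vm_compute. Qed.

Lemma rank_le_T5_1 : rank_le 5 (t T5_1).
Proof.
(* All slices of [T5_1] are diagonal, the first being the identity: the summand s is (e_0 + e_s)
   times e_s times e_s, with e_0 alone as first vector when s = 0. *)
exists (fun s => \row_i ((i == 0 :> nat) || (i == s :> nat))%:R), (fun s => dl C s),
  (fun s => dl C s).
apply: tensorP => i j k; rewrite tensor_of_labelE /sum_of_simple.
have /Z.eqb_spec -> := allP T5_1_entries _ (mem_alltriples5 i j k).
rewrite (eq_bigr (fun s => dl C j 0 s * (((i == 0 :> nat) || (i == s :> nat))%:R * dl C s 0 k))).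
  by rewrite sum_dl !mxE eqxx /= [k == j]eq_sym -val_eqE; do 2!case: (_ == _); case: (_ == _);
    rewrite /= ?zK1 ?zK0 ?mul0r ?mulr0 ?mulr1.
by move=> s _; rewrite mulrAC mulrC !mxE !eqxx /= [s == j]eq_sym; ring.
Qed.

(* T is not concise in its n-th factor. *)
Definition killed (n : nat) T : Prop := exists2 l : 'rV[C]_5, l != 0 &
  forall a b c, tri T (if n == 0%N then l else a) (if n == 1%N then l else b) (if n == 2%N then
    l else c) = 0.

(** The vector annihilating the tensor matters only up to scaling, so compactness provides one for
    the limit. Contrapositively, whatever degenerates to a concise tensor is concise. *)
Lemma killed_degenerates n T S : killed n T -> degenerates T S -> killed n S.
Proof.
move=> [l l0 lT] TS.
pose F (u : 'rV[C]_5 * 'rV[C]_5 * 'rV[C]_5) (S : tensor) (L : 'I_1 -> 'rV[C]_5) : C :=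
  tri S (if n == 0%N then L 0 else u.1.1) (if n == 1%N then L 0 else u.1.2)
    (if n == 2%N then L 0 else u.2).
have [u|u S' L s s0|_ [g1 [g2 [g3 [u1 u2 u3 ->]]]]|L L0 LS] :=
    @closure_projective R tensor 1 5 (orbit T) _ F S _ _ _ TS.
- exact: (@contraction_continuous C tensor id (@entry_continuous R) n u.1.1 u.1.2 u.2).
- by rewrite /F; case: n {F lT} => [|[|[|n]]] /=; rewrite ?(triZ1, triZ2, triZ3) => ->;
  rewrite ?mulr0.
- exists (fun=> l *m invmx (if n == 0%N then g1 else if n == 1%N then g2 else g3)) => [_|u].
    set g := (X in invmx X); have gu : g \in unitmx by rewrite /g; case: ifP => _ //; case: ifP.
    by apply: contra l0 => /eqP e; rewrite -(mulmxKV gu l) e mul0mx.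
  rewrite /F tri_act; case: n {F} lT => [|[|[|n]]] lT /=; rewrite ?mulmxKV//; exact: lT.
by exists (L 0) => // a b c; exact: (LS (a, b, c)).
Qed.

Lemma killed_permute n s T : (n < 3)%N -> killed n T -> exists2 n',
  (n' < 3)%N & killed n' (permute s T).
Proof.
move=> n3 [l l0 lT]; rewrite permuteE; have cP := code_perms6 s.
exists (sel n (code s).1.1 (code s).1.2 (code s).2); last first.
  exists l => // a b c; rewrite tri_permn//; move: cP n3 lT.
  by rewrite !inE => /or4P[/eqP->|/eqP->|/eqP->|/or3P[/eqP->|/eqP->|/eqP->]];
    case: n => [|[|[|//]]] _ lT; first [exact: lT a b c | exact: lT b a c | exact: lT a c b
      | exact: lT b c a | exact: lT c a b | exact: lT c b a].
move: cP n3; rewrite !inE => /or4P[/eqP->|/eqP->|/eqP->|/or3P[/eqP->|/eqP->|/eqP->]];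
  by case: n {lT} => [|[|[|//]]].
Qed.

Definition flattening (n : nat) (z : ztns) : seq (seq Z) :=
  [seq [seq (if n == 0%N then z i p.1 p.2 else if n == 1%N then z p.1 i p.2 else z p.1 p.2 i)
       | i <- iota 0 5] | p <- allpairs5].

Lemma flattening_rank :
  all (fun u => let z := lookup (table u) in all (fun n => rk 5 (flattening n z) == 5%N) (iota 0
    3)) labels.
Proof. by vm_compute. Qed.

Lemma label_not_killed n u : (n < 3)%N -> ~ killed n (t u).
Proof.
move=> n3 [l l0 lT]; have := allP (allP flattening_rank u (labelsP u)) n.
rewrite mem_iota => /(_ n3)/eqP r5.
have szf : all (fun r => size r == 5%N) (flattening n (lookup (table u))).
  by apply/allP => r /mapP[p _ ->]; rewrite size_map.
have [d [B [dr _ BP]]] := @rkP C 5 _ szf.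
have d0 : d = 0%N by move: dr; rewrite r5; lia.
move/negP: l0; apply; rewrite -submx0; apply: (submx_trans (B := B)); last first.
  by subst d; rewrite (flatmx0 B) sub0mx.
rewrite -BP; apply/allP => r /mapP[p /allpairs5P[j [k ->]] ->].
(* The pair (j, k) indexes the two factors other than n in increasing order, so the middle factor
   carries j for n = 0 and k for n = 2. *)
apply/eqP; rewrite -(lT (dl C j) (if n == 0%N then dl C j else dl C k) (dl C k)) /dotr.
move: n3; clear; case: n => [|[|[|//]]] _ /=;
  [rewrite tri_coord1 | rewrite tri_coord2 | rewrite tri_coord3];
  by apply: eq_bigr => i _; rewrite tri_dl tensor_of_labelE mulrC;
    case: i => [[|[|[|[|[|//]]]]] ?].
Qed.

Lemma dotp_mx (l x : 'rV[C]_5) : dotp l x = (l *m x^T) 0 0.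
Proof. by rewrite mxE; apply: eq_bigr => i _; rewrite mxE. Qed.

Lemma vspace_annihilator (V : {vspace 'rV[C]_5}) : V <> fullv ->
  exists2 l : 'rV[C]_5, l != 0 & forall a, a \in V -> dotp a l = 0.
Proof.
move=> Vf; pose M : 'M[C]_(\dim V, 5) := \matrix_i (vbasis V)`_i.
have [l lM l0] : exists2 l : 'rV[C]_5, (l <= kermx M^T)%MS & l != 0.
  apply/rowV0Pn; rewrite -mxrank_eq0 mxrank_ker -lt0n subn_gt0.
  apply: (@leq_ltn_trans (\dim V)); first exact: rank_leq_col.
  have d5 : \dim (fullv : {vspace 'rV[C]_5}) = 5%N by rewrite dimvf dim_matrix.
  have V5 : (\dim V <= 5)%N by have := dimvS (subvf V); rewrite d5.
  rewrite ltn_neqAle V5 andbT; apply: contra_not_neq Vf => dV.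
  by apply/eqP; rewrite eqEdim subvf d5 dV.
exists l => // a /coord_vbasis ->; rewrite dotp_mx.
have /sub_kermxP lM0 := lM.
have -> : \sum_i coord (vbasis V) i a *: (vbasis V)`_i = (\row_i coord (vbasis V) i a) *m M.
  by rewrite mulmx_sum_row; apply: eq_bigr => i _; rewrite rowK mxE.
have -> : (\row_i coord (vbasis V) i a) *m M *m l^T = (\row_i coord (vbasis V) i a) *m (l *m
  M^T)^T.
  by rewrite trmx_mul trmxK mulmxA.
by rewrite lM0 trmx0 mulmx0 mxE.
Qed.

(** A proper subspace has a nonzero annihilator, which kills every simple summand with a vector in
    that subspace, hence the tensor. *)
Lemma concise_not_killed T : (forall n, (n < 3)%N -> ~ killed n T) -> concise T.
Proof.
move=> nk V1 V2 V3 [n [a [b [c [abc TE]]]]].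
split; apply: contrapT => /vspace_annihilator[l l0 lV].
- apply: (nk 0%N) => //; exists l => // x y z; rewrite TE tri_sum_of_simple big1// => s _.
  by rewrite /= lV ?mul0r//; case: (abc s).
- apply: (nk 1%N) => //; exists l => // x y z; rewrite TE tri_sum_of_simple big1// => s _.
  by rewrite /= [dotp _ l]lV ?mulr0 ?mul0r//; case: (abc s).
apply: (nk 2%N) => //; exists l => // x y z; rewrite TE tri_sum_of_simple big1// => s _.
by rewrite /= [dotp _ l]lV ?mulr0//; case: (abc s).
Qed.

Lemma minimal_border_rank_between u v S :
  degenerates_perm (t u) S -> degenerates_perm S (t v) -> minimal_border_rank S.
Proof.
move=> uS [s Sv]; split.
  apply: concise_not_killed => n n3 /(killed_permute s n3)[n' n'3 /killed_degenerates/(_ Sv)].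
  exact: label_not_killed.
apply: border_rank_degenerates rank_le_T5_1 _; apply: degenerates_perm_trans uS.
by apply/degenerates_permE; rewrite -reachE; exact: allP reach_T5_1 u (labelsP u).
Qed.

End BorderRank.

Theorem theorem1p4 (R : realType) :
  let t := @tensor_of_label R in
  [/\ forall u v : label,
        degenerates_perm (t u) (t v) <-> connect arrow u v,
      forall u v : label,
        minimal_degeneration (@listed R) (t u) (t v) <-> arrow u v,
      #|[pred uv : label * label |
          `[< minimal_degeneration (@listed R) (t uv.1) (t uv.2) >]]|
        = 66%N
    & (forall T : tensor R, minimal_border_rank T -> listed T) ->
      forall u v : label,
        minimal_degeneration setT (t u) (t v) <-> arrow u v].
Proof.
have listedE u v : minimal_degeneration (@listed R) (tensor_of_label R u) (tensor_of_label R v)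
  <-> arrow u v.
  by apply: minimal_degenerationE => // w; exists w; exact: isomorphic_perm_refl.
split=> [|//||mbr u v]; first exact: degenerates_permE.
  rewrite -card_arrow; apply: eq_card => -[u v]; rewrite !inE /=.
  by apply/asboolP/idP => /listedE.
by apply: minimal_degenerationE => // S _ uS Sv; apply: mbr;
  exact: minimal_border_rank_between uS Sv.
Qed.
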